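(* For every $n\ge1$ there is a unique polynomial $\Phi_n\in\mathbb{Q}[Y_0,Y_1,Y_2]$ such that $C_n(q)=\Phi_n(A_0(q),A_1(q),A_2(q))$ for all $0<q<1$. Moreover, for every $n\ge 2$, \[\Phi_{2n-1}=\frac{6B_{2n}}{n}Y_0-\frac{36B_{2n}}{n}Y_1+\Big(1+\frac{30B_{2n}}{n}\Big)Y_2+(\text{terms of total degree}\ge 2),\] \[\Phi_{2n}=-\frac{6B_{2n}}{n}Y_1+\Big(\frac{6B_{2n}}{n}-1\Big)Y_2+(\text{terms of total degree}\ge 2).\]
   Context: $B_m$ denotes the $m$-th Bernoulli number ($B_0=1$, $B_1=-\tfrac12$, $B_2=\tfrac16$, $B_4=-\tfrac1{30}$). For $m\ge1$ let $\sigma(m)$ be the sum of the positive divisors of $m$, and for $i\ge 0$, $0<q<1$, let $A_i(q)=\sum_{m\ge1}m^i\sigma(m)q^m$. Polynomials $S_i(n)$: let $a_0,a_1,\dots$ be indeterminates, $a(x)=\sum_{i\ge0}a_ix^i$. For a positive integer $j$ set $G(x)=\prod_{i=0}^{j-1}\frac{1+a(x)x^2}{1+ix}$, $H(x)=\prod_{i=1-j}^{-1}\frac{1+ix}{1+a(x)x^2}$, $u=2j-1$, $v=j(j-1)$. For each $n\ge1$ there are unique $S_0(n),\dots,S_n(n)\in\mathbb{Q}[a_0,\dots,a_{n-2}]$ (constants if $n=1$), independent of $j$, such that for every positive integer $j$ the coefficient of $x^{n-1}$ in $\frac{G(x)-H(x)}{x^2}(1+a(x)x^2)$ equals $u\big(a_{n-1}+S_0(n)+\sum_{i=1}^nS_i(n)v^i\big)$.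 Write $S_i(n)(c_1,\dots,c_{n-1})$ for the substitution $a_k=c_{k+1}$. Recursion: with indeterminates $X_0,X_1,\dots$ and the derivation $D$ of $\mathbb{Q}[X_0,X_1,\dots]$ with $D(X_k)=X_{k+1}$, put $P_1=X_0$, $P_{m+1}=D(P_m)-3X_0P_m$, and $\widehat C_m=-S_0(m)(\widehat C_1,\dots,\widehat C_{m-1})+\sum_{i=1}^{m}3\cdot2^iS_i(m)(\widehat C_1,\dots,\widehat C_{m-1})P_i$ for $m\ge1$. Then $C_n(q):=\widehat C_n(A_0(q),A_1(q),\dots)$ (these $C_n(q)$ are the coefficients in the asymptotic expansion $x_k=-kq^{1-k}(1+\sum_{i\le n}C_i(q)k^{-1-i}+o(k^{-1-n}))$ of the zeros $x_1>x_2>\cdots$ of $\sum_{n\ge0}q^{n(n-1)/2}x^n/n!$). *)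

(* Defs.v *)
From HB Require Import structures.
From mathcomp Require Import all_boot all_order all_algebra finmap.
From mathcomp Require Import boolp classical_sets filter reals topology.
From mathcomp.multinomials Require Import monalg.
From mathcomp Require Import normedtype.
From Stdlib Require Import ClassicalEpsilon.

Set Implicit Arguments.
Unset Strict Implicit.
Unset Printing Implicit Defensive.

Import GRing.Theory Num.Theory numFieldNormedType.Exports.
Local Open Scope ring_scope.

(* Bernoulli numbers: B_0 = 1, sum_{k=0}^{m} C(m+1,k) B_k = 0 (m >= 1),
   so B_1 = -1/2, B_2 = 1/6, B_4 = -1/30. *)
Fixpoint bern_upto (m : nat) : seq rat :=
  match m with
  | 0 => [:: 1]
  | m'.+1 =>
      let s := bern_upto m' in
      rcons s (- (\sum_(k < m'.+1) ('C(m'.+2, k))%:R * s`_k) / (m'.+2)%:R)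
  end.

Definition bernoulli (m : nat) : rat := (bern_upto m)`_m.

Definition sigma (m : nat) : nat := \sum_(d <- divisors m) d.

Definition Aser (R : realType) (i : nat) (q : R) : R :=
  limn (fun N : nat => \sum_(1 <= m < N) ((m%:R) ^+ i * (sigma m)%:R * q ^+ m)).

(* Polynomials with rational coefficients in countably many indeterminates
   Z_0, Z_1, ... (used both for Q[a_0,a_1,...] and Q[X_0,X_1,...]). *)
Definition MP := {malg rat[cmonom nat]}.

Definition var (k : nat) : MP := << ucm k >>.

Definition peval (I : choiceType) (S : comNzRingType) (cf : rat -> S) (x : I -> S)
    (p : {malg rat[cmonom I]}) : S :=
  mmap cf (fun mon : cmonom I => \prod_(k <- finsupp mon) x k ^+ mon k) p.

Definition subst (c : nat -> MP) (p : MP) : MP :=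
  peval (fun r : rat => r%:MP) c p.

Definition reval (R : realType) (I : choiceType) (x : I -> R)
    (p : {malg rat[cmonom I]}) : R :=
  peval (fun r : rat => ratr r) x p.

Definition vars_below (b : nat) (p : MP) : Prop :=
  forall mon, mon \in msupp p -> forall k, k \in finsupp mon -> (k < b)%N.

(* The polynomials S_i(n).  Power series in x over Q[a_0,a_1,...] are
   represented by polynomials in {poly MP}; all computations are done
   modulo x^(N+1), which is exact for the coefficients of index <= N. *)

Definition ax (N : nat) : {poly MP} := \poly_(k < N.+1) var k.

(* 1/(1+c) mod x^(N+1), for c with zero constant term *)
Definition inv1p (N : nat) (c : {poly MP}) : {poly MP} :=
  \sum_(k < N.+1) (- c) ^+ k.

Definition Gser (N j : nat) : {poly MP} :=
  \prod_(i < j) ((1 + ax N * 'X^2) * inv1p N ('X * (i%:R))).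

(* H(x) = prod_{i=1-j}^{-1} (1+ix)/(1 + a(x)x^2)  (mod x^(N+1));
   the index i = -l with l = 1, ..., j-1 *)
Definition Hser (N j : nat) : {poly MP} :=
  \prod_(1 <= l < j) ((1 - 'X * (l%:R)) * inv1p N (ax N * 'X^2)).

(* coefficient of x^(n-1) in  (G(x)-H(x))/x^2 * (1 + a(x)x^2),
   i.e. coefficient of x^(n+1) in (G(x)-H(x)) * (1 + a(x)x^2) *)
Definition Scoef (n j : nat) : MP :=
  ((Gser n.+1 j - Hser n.+1 j) * (1 + ax n.+1 * 'X^2))`_n.+1.

(* S : nat -> MP is the family (S_0(n), ..., S_n(n)) (S i = 0 for i > n),
   with S_i(n) in Q[a_0,...,a_(n-2)], satisfying the defining identity
   for every positive integer j, with u = 2j-1, v = j(j-1). *)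
Definition is_Sfam (n : nat) (S : nat -> MP) : Prop :=
  (forall i, (n < i)%N -> S i = 0) /\
  (forall i, vars_below n.-1 (S i)) /\
  (forall j : nat, (0 < j)%N ->
     Scoef n j =
     ((2 * j%:R - 1 : rat)%:MP) *
       (var n.-1 + S 0%N +
        \sum_(1 <= i < n.+1) S i * ((j%:R * (j%:R - 1) : rat)%:MP) ^+ i)).

(* S_i(n), as the (unique) family satisfying is_Sfam *)
Definition Spoly (n : nat) : nat -> MP :=
  epsilon (inhabits (fun _ => 0)) (is_Sfam n).

(* The derivation D of Q[X_0,X_1,...] with D(X_k) = X_(k+1). *)
Definition Dmon (mon : cmonom nat) : MP :=
  \sum_(k <- finsupp mon) ((mon k)%:R * << divcm mon (ucm k) >> * var k.+1).

Definition Dder (p : MP) : MP := mmap (fun r : rat => r%:MP) Dmon p.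

(* P_1 = X_0, P_(m+1) = D(P_m) - 3 X_0 P_m   (P 0 is unused) *)
Fixpoint Ppoly (m : nat) : MP :=
  match m with
  | 0 => 0
  | 1 => var 0
  | m'.+1 => Dder (Ppoly m') - 3%:R * var 0 * Ppoly m'
  end.

Definition Chat_step (m : nat) (c : nat -> MP) : MP :=
  let sb := subst (fun k => c k.+1) in
  - sb (Spoly m 0%N) +
  \sum_(1 <= i < m.+1) ((3 * 2 ^ i)%:R * sb (Spoly m i) * Ppoly i).

(* Chat_upto m k = \hat C_k for 1 <= k <= m *)
Fixpoint Chat_upto (m : nat) : nat -> MP :=
  match m with
  | 0 => fun _ => 0
  | m'.+1 => let c := Chat_upto m' in
             fun k => if k == m'.+1 then Chat_step m'.+1 c else c k
  end.

Definition Chat (m : nat) : MP := Chat_upto m m.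

Definition Cq (R : realType) (n : nat) (q : R) : R :=
  reval (fun k : nat => Aser k q) (Chat n).

Definition QY := {malg rat[cmonom 'I_3]}.
Definition Yvar (i : 'I_3) : cmonom 'I_3 := ucm i.
Definition Yone : cmonom 'I_3 := @onecm _.

(* Main.v *)
(* Write [D = q d/dq], so that [D A_i = A_(i+1)].  A count of the solutions of
   [a x + b y = n] (Van der Pol's identity) gives [A_3 = A_2 - 24 A_0 A_2 + 36 A_1^2],
   so every [A_k] is a polynomial in [A_0, A_1, A_2] with linear part [A_(min k 2)],
   and substituting these polynomials in [\hat C_n] gives [Phi_n].  Uniqueness is
   the algebraic independence of [A_0, A_1, A_2], equivalently of the Eisenstein
   series [P, Q, R] with their Ramanujan differential system.  In the coordinates
   [tau = Q^3 / R^2], [p = P Q / R], [rho = R / Q] the system becomes triangular: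
   [tau] is transcendental, [p] satisfies a Riccati equation over [Q(tau)] without
   rational solutions, and [rho] carries the weight.

   For the linear terms, the coefficient of [x^k] in [G] is a polynomial in [j],
   given by Newton's recursion from power sums, i.e. from Faulhaber polynomials,
   and [H] is its image under [j -> 1 - j]; being antisymmetric, the difference is
   [2 j - 1] times a polynomial in [j (j - 1)].  At [a = 0] its coefficients of [j]
   and [j^2] are Bernoulli numbers, its value at [j = 2] is elementary, and these
   three numbers determine the linear part of [\hat C_n] modulo the
   identification of [A_2, A_3, ...]. *)

Require Import Defs.
From HB Require Import structures.
From mathcomp Require Import all_boot all_order all_algebra finmap.
From mathcomp Require Import boolp classical_sets filter reals topology.
From mathcomp.multinomials Require Import monalg.
From mathcomp Require Import normedtype sequences.
From mathcomp Require Import zify ring lra.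
From Stdlib Require Import ClassicalEpsilon.
Import Order.TTheory GRing.Theory Num.Theory numFieldNormedType.Exports.
Set Implicit Arguments.
Unset Strict Implicit.
Unset Printing Implicit Defensive.
Local Open Scope ring_scope.

(** * Formal power series over the rationals *)

(** The statement concerns real numbers [A_i(q)], while derivations, orders of vanishing and
    relations of least degree call for formal series over [rat]. Series with coefficients of
    polynomial growth link the two: on them evaluation at [0 < q < 1] is multiplicative, and a
    series that vanishes at all these [q] is zero. The inductive steps of the independence proof
    rest on one remark: [D] of a quotient of power series is never a nonzero constant, as [D] kills
    constant terms. A relation of least degree is compared with its own derivative, and
    differentiating the comparison with respect to [p] produces a quotient that contradicts this.
    For the linear terms, [P_i] has linear part [X_(i-1)], so that of [\hat C_n] is the sum of
    [3 2^i s_i X_(i-1)], with [s_i] the constant term of [S_i(n)]. The weights [3 2^i] are [u v^i]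
    at [j = 2], where for [a = 0] the products [G] and [H] are [1 / (1 + x)] and [1 - x]; hence the
    sum of all coefficients is [(-1)^(n+1)], and only [s_1] and [s_2] remain to be found. *)

Record fps : Type := Fps { scoef : nat -> rat }.
Coercion scoef : fps >-> Funclass.

Lemma fpsP (f g : fps) : (forall n, f n = g n) -> f = g.
Proof. by case: f g => f [g] /= /funext ->. Qed.

HB.instance Definition _ := gen_eqMixin fps.
HB.instance Definition _ := gen_choiceMixin fps.

Definition szero := Fps (fun=> 0).
Definition sopp (f : fps) := Fps (fun n => - f n).
Definition sadd (f g : fps) := Fps (fun n => f n + g n).
Definition sone := Fps (fun n => (n == 0)%:R).
Definition smul (f g : fps) := Fps (fun n => \sum_(i < n.+1) f i * g (n - i)%N).

Fact saddA : associative sadd.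
Proof. by move=> f g h; apply: fpsP => n; rewrite /= addrA. Qed.
Fact saddC : commutative sadd.
Proof. by move=> f g; apply: fpsP => n; rewrite /= addrC. Qed.
Fact sadd0 : left_id szero sadd.
Proof. by move=> f; apply: fpsP => n; rewrite /= add0r. Qed.
Fact saddN : left_inverse szero sopp sadd.
Proof. by move=> f; apply: fpsP => n; rewrite /= addNr. Qed.

HB.instance Definition _ := GRing.isZmodule.Build fps saddA saddC sadd0 saddN.

Definition strunc (N : nat) (f : fps) : {poly rat} := \poly_(i < N) f i.

Lemma coef_strunc N (f : fps) n : (n < N)%N -> (strunc N f)`_n = f n.
Proof. by move=> nN; rewrite coef_poly nN. Qed.

(** The ring laws for series are inherited from [{poly rat}] through truncation. *)
Lemma smul_trunc N (f g : fps) n :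
  (n < N)%N -> smul f g n = (strunc N f * strunc N g)`_n.
Proof.
move=> nN; rewrite coefM /=; apply: eq_bigr => i _.
by rewrite !coef_strunc // (leq_ltn_trans _ nN) // ?leq_subr // -ltnS.
Qed.

Fact smulC : commutative smul.
Proof.
by move=> f g; apply: fpsP => n; rewrite !(smul_trunc _ _ (ltnSn n)) mulrC.
Qed.
Fact smulA : associative smul.
Proof.
move=> f g h; apply: fpsP => n.
transitivity ((strunc n.+1 f * (strunc n.+1 g * strunc n.+1 h))`_n).
  rewrite coefM /=; apply: eq_bigr => i _.
  by rewrite coef_strunc // -(smul_trunc (N := n.+1)) // ltnS leq_subr.
rewrite mulrA coefM /=; apply: eq_bigr => i _.
by rewrite coef_strunc ?ltnS ?leq_subr // -(smul_trunc (N := n.+1)).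
Qed.
Fact smul1 : left_id sone smul.
Proof.
move=> f; apply: fpsP => n.
rewrite /= big_ord_recl /= subn0 mul1r big1 ?addr0 // => i _.
by rewrite /bump /= mul0r.
Qed.
Fact smulDl : left_distributive smul sadd.
Proof.
move=> f g h; apply: fpsP => n /=.
by rewrite -big_split; apply: eq_bigr => i _; rewrite mulrDl.
Qed.
Fact sone_neq0 : sone != szero.
Proof. by apply/eqP => /(congr1 (fun f : fps => f 0%N)) /eqP; rewrite /= oner_eq0. Qed.

HB.instance Definition _ :=
  GRing.Zmodule_isComNzRing.Build fps smulA smulC smul1 smulDl sone_neq0.

Lemma scoefD (f g : fps) n : (f + g) n = f n + g n. Proof. by []. Qed.
Lemma scoefB (f g : fps) n : (f - g) n = f n - g n. Proof. by []. Qed.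
Lemma scoef0 n : (0 : fps) n = 0. Proof. by []. Qed.
Lemma scoef1 n : (1 : fps) n = (n == 0)%:R. Proof. by []. Qed.
Lemma scoefM (f g : fps) n : (f * g) n = \sum_(i < n.+1) f i * g (n - i)%N.
Proof. by []. Qed.
Lemma scoef0M (f g : fps) : (f * g) 0%N = f 0%N * g 0%N.
Proof. by rewrite scoefM big_ord1. Qed.
Lemma scoef_sum (I : Type) (r : seq I) (P : pred I) (F : I -> fps) n :
  (\sum_(i <- r | P i) F i) n = \sum_(i <- r | P i) F i n.
Proof. by elim/big_rec2: _ => // i y z _ <-. Qed.

Definition fpsC (c : rat) : fps := Fps (fun n => if n is 0 then c else 0).

Fact fpsC_additive : {morph fpsC : x y / x - y}.
Proof. by move=> x y; apply: fpsP => -[|n] //; rewrite scoefB /= subr0. Qed.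
Fact fpsC_multiplicative : multiplicative fpsC.
Proof.
split=> [x y|]; apply: fpsP => -[|n] //; first by rewrite scoef0M.
by rewrite scoefM big1 // => -[[|i] ?] _ /=; rewrite ?mulr0 ?mul0r.
Qed.
HB.instance Definition _ := GRing.isAdditive.Build rat fps fpsC fpsC_additive.
HB.instance Definition _ :=
  GRing.isMultiplicative.Build rat fps fpsC fpsC_multiplicative.

Lemma scoef_fpsCM c (f : fps) n : (fpsC c * f) n = c * f n.
Proof.
rewrite scoefM big_ord_recl /= subn0 big1 ?addr0 // => i _.
by rewrite mul0r.
Qed.

Definition sord (f : fps) (m : nat) := forall i, (i < m)%N -> f i = 0.

Lemma sord_coefM (f g : fps) m l :
  sord f m -> sord g l -> (f * g) (m + l)%N = f m * g l.
Proof.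
move=> fm gl; have ml : (m < (m + l).+1)%N by lia.
rewrite scoefM (bigD1 (Ordinal ml)) //= addKn big1 ?addr0 // => i im.
have [lt|ge] := ltnP i m; first by rewrite fm // mul0r.
rewrite gl ?mulr0 //; have : i != m :> nat by apply: contra im => /eqP e; apply/eqP/val_inj.
by have := ltn_ord i; lia.
Qed.

Lemma sordM (f g : fps) m l : sord f m -> sord g l -> sord (f * g) (m + l).
Proof.
move=> fm gl n nml; rewrite scoefM big1 // => i _.
have [lt|ge] := ltnP i m; first by rewrite fm // mul0r.
by rewrite gl ?mulr0 //; have := ltn_ord i; lia.
Qed.

Lemma sord_exists (f : fps) : f != 0 -> exists2 m, sord f m & f m != 0.
Proof.
move=> f0; have ex : exists n, f n != 0.
  apply: contrapT => nex; case/eqP: f0; apply: fpsP => n.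
  by apply/eqP; apply: contrapT => /negP h; apply: nex; exists n.
case: (ex_minnP ex) => m fm mmin; exists m => // i im.
by apply/eqP; apply: contraTT im => /mmin; rewrite -leqNgt.
Qed.

Fact series_integral (f g : fps) : f * g = 0 -> (f == 0) || (g == 0).
Proof.
move=> fg0; apply/norP => -[/sord_exists[m fm fm0] /sord_exists[l gl gl0]].
have := sord_coefM fm gl; rewrite fg0 => /esym/eqP.
by rewrite mulf_eq0 (negPf fm0) (negPf gl0).
Qed.

(** Inverses are chosen classically; the equation determines them, and a series that is not a unit
    is its own inverse by convention. *)
Definition sunit : {pred fps} := fun f => `[< exists g, g * f = 1 >].
Definition sinv (f : fps) : fps :=
  if pselect (exists g, g * f = 1) is left e then projT1 (cid e) else f.

Fact smulVf : {in sunit, left_inverse 1 sinv *%R}.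
Proof. by move=> f /asboolP uf; rewrite /sinv; case: pselect => // e; case: cid. Qed.
Fact sunitP (f g : fps) : g * f = 1 -> sunit f.
Proof. by move=> gf; apply/asboolP; exists g. Qed.
Fact sinv_out : {in [predC sunit], sinv =1 id}.
Proof. by move=> f /asboolPn nf; rewrite /sinv; case: pselect. Qed.

HB.instance Definition _ :=
  GRing.ComNzRing_hasMulInverse.Build fps smulVf sunitP sinv_out.
HB.instance Definition _ :=
  GRing.ComUnitRing_isIntegral.Build fps series_integral.

Lemma sordX (f : fps) k : f 0%N = 0 -> sord (f ^+ k) k.
Proof.
move=> f0; elim: k => [|k IH]; first by [].
by rewrite exprS -add1n; apply: sordM IH => -[].
Qed.

(* The geometric series in [1 - f], cut at order [n] when reading off the
   [n]-th coefficient. *)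
Lemma series_unit (f : fps) : f 0%N = 1 -> f \is a GRing.unit.
Proof.
move=> f1; apply/unitrP.
pose e := 1 - f; have e0 : e 0%N = 0 by rewrite /e scoefB scoef1 f1 subrr.
pose g := Fps (fun n => (\sum_(k < n.+1) e ^+ k) n).
suff gf : g * f = 1 by exists g; rewrite gf mulrC gf.
apply: fpsP => n.
have gE m : (m <= n)%N -> g m = (\sum_(k < n.+1) e ^+ k) m.
  move=> mn; rewrite [LHS]/= !scoef_sum -(subnK mn) addnC -addSn big_split_ord /=.
  by rewrite [X in _ + X]big1 ?addr0 // => i _; rewrite (@sordX e _ e0) //; lia.
have -> : (g * f) n = ((\sum_(k < n.+1) e ^+ k) * f) n.
  by rewrite !scoefM; apply: eq_bigr => i _; rewrite gE // -ltnS.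
have -> : f = 1 - e by rewrite /e opprB addrC subrK.
rewrite mulrC -opprB mulNr -subrX1 opprB scoefB.
by rewrite (@sordX e _ e0) ?subr0.
Qed.

Definition sD (f : fps) : fps := Fps (fun n => n%:R * f n).

Lemma sDE f n : sD f n = n%:R * f n. Proof. by []. Qed.

Fact sD_additive : {morph sD : x y / x - y}.
Proof. by move=> f g; apply: fpsP => n; exact: mulrBr. Qed.
HB.instance Definition _ := GRing.isAdditive.Build fps fps sD sD_additive.

Lemma sDM (f g : fps) : sD (f * g) = sD f * g + f * sD g.
Proof.
apply: fpsP => n; rewrite scoefD sDE !scoefM mulr_sumr -big_split.
apply: eq_bigr => i _; rewrite !sDE.
have -> : n%:R = i%:R + (n - i)%:R :> rat by rewrite -natrD subnKC // -ltnS.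
by rewrite mulrDl mulrA [X in _ + X]mulrCA.
Qed.

Lemma sD_fpsC c : sD (fpsC c) = 0.
Proof. by apply: fpsP => -[|n]; rewrite sDE ?mul0r ?mulr0. Qed.

Lemma sD1 : sD 1 = 0.
Proof. by rewrite -(rmorph1 fpsC) sD_fpsC. Qed.

(* [D u] has no constant term for [u = f / g] a quotient of power series. *)
Lemma sD_quotient_fpsC (f g : fps) (c : rat) :
  g != 0 -> sD f * g - f * sD g = fpsC c * g ^+ 2 -> c = 0.
Proof.
move=> /sord_exists[m gm gm0] e.
have Dord h l : sord h l -> sord (sD h) l by move=> hl i /hl /= ->; rewrite mulr0.
(* If [f] had order [l < m], the coefficient of index [l + m] would be [(l - m) f_l g_m], nonzero,
   on the left and 0 on the right. In index [2 m] the left side then cancels. *)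
have fm : sord f m.
  case: (eqVneq f 0) => [->|/sord_exists[l fl fl0]] //.
  move=> i im; have [|li] := ltnP i l; first exact: fl.
  have /(congr1 (fun h : fps => h (l + m)%N)) := e.
  rewrite scoefB (sord_coefM (Dord _ _ fl) gm) (sord_coefM fl (Dord _ _ gm)).
  rewrite scoef_fpsCM expr2 !sDE.
  rewrite (sordM gm gm) ?ltn_add2r ?(leq_ltn_trans li) //= mulr0 => /eqP.
  rewrite mulrCA -mulrA -mulrBl mulf_eq0 mulf_eq0 (negPf fl0) (negPf gm0).
  by rewrite !orbF subr_eq0 eqr_nat => /eqP lm; move: li im; rewrite lm => ?; rewrite ltnNge => /negP.
have /(congr1 (fun h : fps => h (m + m)%N)) := e.
rewrite scoefB (sord_coefM (Dord _ _ fm) gm) (sord_coefM fm (Dord _ _ gm)).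
rewrite scoef_fpsCM expr2 (sord_coefM gm gm) !sDE => /eqP.
rewrite (_ : _ - _ = 0); last by ring.
by rewrite eq_sym !mulf_eq0 (negPf gm0) !orbF => /eqP.
Qed.

(** * Algebraic independence of solutions of the Ramanujan system *)

Section TopCoef.
Variable K : comNzRingType.
Implicit Types (p q : {poly K}).

(** The value [a] may be 0: degrees are only bounded, so cancellation of leading terms needs no case
    distinction. *)
Definition top_coef (m : nat) (a : K) p : Prop := (size p <= m.+1)%N /\ p`_m = a.

Lemma top_coefM m n a b p q :
  top_coef m a p -> top_coef n b q -> top_coef (m + n) (a * b) (p * q).
Proof.
move=> [sp <-] [sq <-]; split.
  apply: leq_trans (size_polyMleq _ _) _; have := leq_add sp sq.
  by rewrite addSn addnS; case: (_ + _)%N.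
have mn : (m < (m + n).+1)%N by lia.
rewrite coefM (bigD1 (Ordinal mn)) //= addKn big1 ?addr0 // => i im.
have [lt|ge] := ltnP m i; first by rewrite [p`_i]nth_default ?mul0r // (leq_trans sp).
have : i != m :> nat by apply: contra im => /eqP e; apply/eqP/val_inj.
move=> im'; rewrite [q`__]nth_default ?mulr0 //; apply: leq_trans sq _.
by have := ltn_ord i; lia.
Qed.

Lemma top_coefD m a b p q :
  top_coef m a p -> top_coef m b q -> top_coef m (a + b) (p + q).
Proof.
move=> [sp <-] [sq <-]; split; last by rewrite coefD.
by apply: leq_trans (size_polyD _ _) _; rewrite geq_max sp.
Qed.

Lemma top_coefN m a p : top_coef m a p -> top_coef m (- a) (- p).
Proof. by move=> [sp <-]; split; rewrite ?size_polyN ?coefN. Qed.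

Lemma top_coefC c : top_coef 0 c c%:P.
Proof. by split; rewrite ?size_polyC_leq1 // coefC. Qed.

Lemma top_coefX : top_coef 1 1 'X.
Proof. by split; rewrite ?size_polyX ?coefX. Qed.

Lemma top_coefS m p : (size p <= m)%N -> top_coef m 0 p.
Proof. by move=> sp; split; [exact: leqW|rewrite nth_default]. Qed.

Lemma top_coefXderiv m a p :
  top_coef m a p -> top_coef m (m%:R * a) ('X * p^`()).
Proof.
move=> [sp <-]; split; last first.
  by rewrite coefXM; case: m sp => [|m] _ /=; rewrite ?mul0r // coef_deriv mulr_natl.
apply/leq_sizeP => j mj; rewrite coefXM coef_deriv.
by case: j mj => // j mj; rewrite nth_default ?mul0rn // (leq_trans sp) //= -ltnS.
Qed.

End TopCoef.

(* The substitution [f = g H - 12 (X^2 - X) H'] makes [g] linear; its values at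
   [0] and [1] and its slope, read off at infinity, are incompatible. *)
Lemma riccati_no_rational_solution (f H : {poly rat}) :
  H != 0 -> coprimep f H ->
  12%:R * ('X^2 - 'X) * (f^`() * H - f * H^`())
    <> f ^+ 2 + (6%:R * 'X - 4%:R) * f * H + 'X * H ^+ 2.
Proof.
move=> H0 cop E.
pose d := (size H).-1; pose h := H`_d.
have sH : size H = d.+1 by rewrite /d prednK // size_poly_gt0.
have h0 : h != 0 by rewrite /h -lead_coefE lead_coef_eq0.
have tH : top_coef d h H by split; rewrite ?sH.
(* Modulo [H] the equation reads [f * (f + 12 (X^2 - X) H') = 0], and [f] is coprime to [H]. *)
have [g gE] : exists g, f + 12%:R * ('X^2 - 'X) * H^`() = g * H.
  apply/dvdpP; rewrite -(@Gauss_dvdpl _ _ f); last by rewrite coprimep_sym.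
  apply/dvdpP; exists (12%:R * ('X^2 - 'X) * f^`() - (6%:R * 'X - 4%:R) * f - 'X * H).
  apply/eqP; rewrite -subr_eq0; apply/eqP.
  rewrite (_ : _ - _ = f ^+ 2 + (6%:R * 'X - 4%:R) * f * H + 'X * H ^+ 2
     - 12%:R * ('X^2 - 'X) * (f^`() * H - f * H^`())); last by ring.
  by rewrite E subrr.
have tl : top_coef 1 1 ('X - 1%:P : {poly rat}).
  have := top_coefD (top_coefX rat) (top_coefN (top_coefS (size_polyC_leq1 (1 : rat)))).
  by rewrite subr0.
(* Coefficients of index [2 e + 2]: the left side contributes [12 ((e + 1) - e) a b], and [X H^2]
   has smaller degree. *)
have top e a b : top_coef e.+1 a f -> top_coef e b H ->
    12%:R * (a * b) = a ^+ 2 + 6%:R * (a * b).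
  move=> tf tb.
  have tL := top_coefM (top_coefM (top_coefC 12%:R) tl)
    (top_coefD (top_coefM (top_coefXderiv tf) tb)
               (top_coefN (top_coefM tf (top_coefXderiv tb)))).
  have t64 : top_coef 1 6%:R (6%:R%:P * 'X - 4%:R%:P : {poly rat}).
    have := top_coefD (top_coefM (top_coefC 6%:R) (top_coefX rat))
      (top_coefN (top_coefS (size_polyC_leq1 (4%:R : rat)))).
    by rewrite mulr1 subr0.
  have e2 : (1 + e.+1 + e = e.+1 + e.+1)%N by lia.
  have e3 : (0 + 1 + (e.+1 + e) = e.+1 + e.+1)%N by lia.
  have t3 := top_coefM (top_coefM t64 tf) tb.
  rewrite e2 in t3; rewrite e3 in tL.
  have [_ cR] := top_coefD (top_coefM tf tf) t3; have [_ cL] := tL.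
  have sX : (size ('X * H ^+ 2)%R <= (e.+1 + e.+1))%N.
    have [s1 _] := top_coefM (top_coefM (top_coefX rat) tb) tb.
    by rewrite expr2 mulrA (leq_trans s1) //; lia.
  have := congr1 (fun p : {poly rat} => p`_(e.+1 + e.+1)) E.
  rewrite coefD [('X * _)`__]nth_default // addr0.
  rewrite (_ : 12%:R * ('X^2 - 'X) * (f^`() * H - f * H^`()) =
     12%:R%:P * ('X - 1%:P) * ('X * f^`() * H - f * ('X * H^`()))); last first.
    by rewrite polyC1 rmorph_nat; ring.
  rewrite (_ : f ^+ 2 + (6%:R * 'X - 4%:R) * f * H =
     f * f + (6%:R%:P * 'X - 4%:R%:P) * f * H); last first.
    by rewrite !rmorph_nat; ring.
  rewrite cL cR -[e.+1]addn1 natrD => h'.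
  rewrite expr2 [X in _ = _ + X]mulrA -h'; ring.
have sf : (size f <= d.+2)%N.
  rewrite leqNgt; apply/negP => lt.
  pose e := (size f).-2; have se : size f = e.+2 by rewrite /e; lia.
  have tf : top_coef e.+1 (lead_coef f) f by split; rewrite ?lead_coefE ?se.
  have tb : top_coef e 0 H by apply: top_coefS; rewrite sH; lia.
  have := top _ _ _ tf tb; rewrite !mulr0 addr0 => /esym/eqP.
  by rewrite sqrf_eq0 lead_coef_eq0 -size_poly_eq0 se.
have tf : top_coef d.+1 f`_d.+1 f by [].
set phi := f`_d.+1 in tf.
have tg := top_coefD tf (top_coefM (top_coefM (top_coefC 12%:R) tl) (top_coefXderiv tH)).
have gE' : f + 12%:R%:P * ('X - 1%:P) * ('X * H^`()) = g * H.
  by rewrite -gE polyC1 rmorph_nat; ring.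
have sg : (size g <= 2)%N.
  have [g0|g0] := eqVneq g 0; first by rewrite g0 size_poly0.
  have [sgH _] := tg; move: sgH; rewrite gE' size_mul // sH addnS /= => sgH.
  by move: sgH; rewrite -[(0 + 1 + d).+1]/(2 + d)%N leq_add2r.
have tg' : top_coef 1 g`_1 g by [].
have g1E : g`_1 * h = phi + 12%:R * (d%:R * h).
  have [_ e1] := top_coefM tg' tH; have [_ e2] := tg.
  by rewrite -e1 -gE' e2; ring.
have phiE : phi = 0 \/ phi = 6%:R * h.
  have := top _ _ _ tf tH => e.
  have : phi * (phi - 6%:R * h) = 0.
    by apply: (addIr (12%:R * (phi * h))); rewrite {2}e; ring.
  by move/eqP; rewrite mulf_eq0 subr_eq0 => /orP[/eqP|/eqP]; [left|right].
(* The slope of [g] is [12 d] or [12 d + 6], according to the two values of [phi]. *)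
have g1 : 0 <= g`_1.
  have : exists2 k : nat, phi = k%:R * h & true.
    by case: phiE => ->; [exists 0%N|exists 6%N]; rewrite ?mul0r.
  case=> k kE _; have : g`_1 * h = (k + 12 * d)%:R * h.
    by rewrite g1E kE natrD natrM; ring.
  by move/(mulIf h0) => ->; rewrite ler0n.
have nz x : f.[x] = 0 -> H.[x] = 0 -> False.
  move=> fx Hx; have := @coprimep_root _ _ _ x cop.
  by rewrite /root fx Hx eqxx => /(_ isT) /eqP.
have gH x : g.[x] * H.[x] = f.[x] + 12%:R * (x ^+ 2 - x) * H^`().[x].
  have := congr1 (fun p : {poly rat} => p.[x]) gE.
  rewrite -[12%:R]/(12%:R : {poly rat}) -(rmorph_nat (@polyC rat)).
  by rewrite !(hornerD, hornerM, hornerC, hornerN, hornerXn, hornerX) => ->.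
have Ex x : 12%:R * (x ^+ 2 - x) * (f^`().[x] * H.[x] - f.[x] * H^`().[x])
    = f.[x] ^+ 2 + (6%:R * x - 4%:R) * f.[x] * H.[x] + x * H.[x] ^+ 2.
  have := congr1 (fun p : {poly rat} => p.[x]) E.
  rewrite !expr2 -!(rmorph_nat (@polyC rat)).
  by rewrite !(hornerD, hornerM, hornerC, hornerN, hornerX).
(* At 0 the factor [X^2 - X] vanishes, so [g = f / H] there, and the equation becomes
   [y (y - 4) = 0] for this value. *)
have g0 : 0 <= g.[0].
  have := Ex 0; have := gH 0; rewrite expr2 !(mul0r, mulr0, subr0, sub0r, addr0) => h1 /esym/eqP.
  have H0' : H.[0] != 0.
    apply/eqP => H0'; move: (h1); rewrite H0' mulr0 => /esym f0'.
    exact: (nz 0).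
  rewrite (_ : _ + _ = f.[0] * (f.[0] - 4%:R * H.[0])); last by ring.
  rewrite mulf_eq0 subr_eq0 -h1 mulf_eq0 (negPf H0') orbF => /orP[/eqP-> //|/eqP].
  by move/(mulIf H0') => ->; rewrite ler0n.
(* At 1 the equation becomes [(y + 1)^2 = 0]. *)
have gm1 : g.[1] = -1.
  have := Ex 1; have := gH 1; rewrite expr2 !(mul1r, subrr, mulr0, mul0r, addr0) => h1 h2.
  have fH : f.[1] = - H.[1].
    apply/eqP; rewrite -addr_eq0 -sqrf_eq0; apply/eqP; rewrite [RHS]h2; ring.
  have H1 : H.[1] != 0 by apply/eqP => H1; apply: (nz 1) => //; rewrite fH H1 oppr0.
  by apply: (mulIf H1); rewrite h1 fH mulN1r.
have : g.[1] = g.[0] + g`_1.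
  rewrite !(@horner_coef_wide _ 2) // !big_ord_recl !big_ord0 /= /bump /=.
  by rewrite !expr0 !expr1; ring.
by rewrite gm1; lra.
Qed.

(** * Derivations of iterated polynomial rings and their evaluation in series *)

Section EvalAt.
Variables (A : comNzRingType) (e : {rmorphism A -> fps}) (x : fps).
Definition eval_at (F : {poly A}) : fps := (map_poly e F).[x].

Fact eval_at_additive : {morph eval_at : F G / F - G}.
Proof. by move=> F G; rewrite /eval_at rmorphB hornerD hornerN. Qed.
Fact eval_at_multiplicative : multiplicative eval_at.
Proof.
by split=> [F G|]; rewrite /eval_at ?rmorphM ?rmorph1 ?hornerM ?hornerC.
Qed.
HB.instance Definition _ := GRing.isAdditive.Build {poly A} fps eval_at eval_at_additive.
HB.instance Definition _ :=
  GRing.isMultiplicative.Build {poly A} fps eval_at eval_at_multiplicative.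

Lemma eval_atD F G : eval_at (F + G) = eval_at F + eval_at G.
Proof. exact: rmorphD. Qed.
Lemma eval_atM F G : eval_at (F * G) = eval_at F * eval_at G.
Proof. exact: rmorphM. Qed.
Lemma eval_atN F : eval_at (- F) = - eval_at F.
Proof. exact: rmorphN. Qed.
Lemma eval_at_exp F n : eval_at (F ^+ n) = eval_at F ^+ n.
Proof. exact: rmorphXn. Qed.
Lemma eval_at_nat n : eval_at n%:R = n%:R.
Proof. exact: rmorph_nat. Qed.
Lemma eval_atC a : eval_at a%:P = e a.
Proof. by rewrite /eval_at map_polyC hornerC. Qed.
Lemma eval_atX : eval_at 'X = x.
Proof. by rewrite /eval_at map_polyX hornerX. Qed.
Definition eval_atE :=
  (eval_atX, eval_atC, eval_at_nat, eval_at_exp, eval_atN, eval_atD, eval_atM).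
End EvalAt.

Section DerPoly.
Variables (A : comNzRingType) (dA : {additive A -> A}) (c : {poly A}).

(** For a derivation [dA], this is its extension to [{poly A}] that sends [X] to [c]. *)
Definition dpoly (F : {poly A}) : {poly A} := map_poly dA F + F^`() * c.

Lemma coef_map_dA F i : (map_poly dA F)`_i = dA F`_i.
Proof. by rewrite coef_map_id0 ?raddf0. Qed.

Fact dpoly_additive : {morph dpoly : F G / F - G}.
Proof.
move=> F G; rewrite /dpoly derivB mulrBl opprD addrACA; congr (_ + _).
by apply/polyP => i; rewrite !(coefB, coef_map_dA) raddfB.
Qed.
HB.instance Definition _ := GRing.isAdditive.Build {poly A} {poly A} dpoly dpoly_additive.

(** This commutator allows relations to be differentiated with respect to the indeterminate, which
    lowers their degree. *)
Lemma deriv_dpoly F : (dpoly F)^`() = dpoly F^`() + F^`() * c^`().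
Proof.
rewrite /dpoly derivD derivM -addrA; congr (_ + _).
by apply/polyP => i; rewrite !(coef_deriv, coef_map_dA) raddfMn.
Qed.

(** The series operator is [k rho^-1 D], written without the inverse. Being a derivation, it is
    determined by its values on coefficients and on the indeterminate. *)
Lemma dpoly_eval (k : nat) (rho : fps) (e : {rmorphism A -> fps}) (x : fps) :
  (forall a, k%:R * sD (e a) = rho * e (dA a)) ->
  k%:R * sD x = rho * eval_at e x c ->
  forall F, k%:R * sD (eval_at e x F) = rho * eval_at e x (dpoly F).
Proof.
move=> ea ex; elim/poly_ind => [|F a IH].
  by rewrite !raddf0 !mulr0.
have -> : dpoly (F * 'X + a%:P) = dpoly F * 'X + (dA a)%:P + F * c.
  rewrite /dpoly derivD derivM derivX derivC addr0 mulr1 mulrDl mulrDl.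
  have -> : map_poly dA (F * 'X + a%:P) = map_poly dA F * 'X + (dA a)%:P.
    by apply/polyP => -[|i]; rewrite !(coefD, coefMX, coefC, coef_map_dA) /= ?addr0 ?add0r.
  by ring.
rewrite !(eval_atD, eval_atM, eval_atC, eval_atX) raddfD /= sDM.
rewrite /dpoly !(eval_atD, eval_atM) in IH.
rewrite [RHS]mulrDr [rho * (_ + e _)]mulrDr mulrA -IH -ea [rho * (_ * _)]mulrCA -ex.
by ring.
Qed.
End DerPoly.

(* In terms of Eisenstein series, [tau = Q^3 / R^2], [p = P Q / R] and
   [rho = R / Q]; twelve times [rho^-1 D] preserves [rat[tau, p]]. *)
Section Independence.
Variables (tau p rho : fps).
Hypothesis rho0 : rho 0%N = 1.
Hypothesis tau0 : tau 0%N = 1.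
Hypothesis tau_neq1 : tau != 1.
Hypothesis sDtau : 12%:R * sD tau = rho * (12%:R * (tau ^+ 2 - tau)).
Hypothesis sDp :
  12%:R * sD p = rho * (- p ^+ 2 + (6%:R * tau - 4%:R) * p - tau).
Hypothesis sDrho : 12%:R * sD rho = rho ^+ 2 * (2%:R * p - 6%:R * tau + 4%:R).

Definition dtau : {poly rat} -> {poly rat} :=
  dpoly \0 (12%:R * ('X^2 - 'X)).
HB.instance Definition _ := GRing.Additive.on dtau.

Definition cp : {poly {poly rat}} :=
  - 'X^2 + (6%:R * 'X - 4%:R)%:P * 'X - ('X)%:P.
Definition dp : {poly {poly rat}} -> {poly {poly rat}} := dpoly dtau cp.
HB.instance Definition _ := GRing.Additive.on dp.

(** [beta] plays two roles: it is the derivative of [cp] with respect to [p], and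
    [12 D rho = - rho^2 beta]. This coincidence makes [beta] cancel in the quotients formed
    below. *)
Definition beta : {poly {poly rat}} := - 2%:R * 'X + (6%:R * 'X - 4%:R)%:P.
Definition crho : {poly {poly {poly rat}}} := - beta%:P * 'X.
Definition drho := dpoly dp crho.
HB.instance Definition _ := GRing.Additive.on drho.

Definition ev1 := eval_at fpsC tau.
HB.instance Definition _ := GRing.RMorphism.on ev1.
Definition ev2 := eval_at ev1 p.
HB.instance Definition _ := GRing.RMorphism.on ev2.
Definition ev3 := eval_at ev2 rho.
HB.instance Definition _ := GRing.RMorphism.on ev3.

Lemma ev1_der h : 12%:R * sD (ev1 h) = rho * ev1 (dtau h).
Proof.
apply: dpoly_eval => [a|]; first by rewrite sD_fpsC !raddf0 !mulr0.
rewrite sDtau; congr (_ * _).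
by rewrite !eval_atE.
Qed.

Lemma ev2_cp : ev2 cp = - p ^+ 2 + (6%:R * tau - 4%:R) * p - tau.
Proof.
rewrite /ev2 /cp !eval_atE /= /ev1.
by rewrite !eval_atE.
Qed.

Lemma ev2_der F : 12%:R * sD (ev2 F) = rho * ev2 (dp F).
Proof. by apply: dpoly_eval; [exact: ev1_der|rewrite sDp -ev2_cp]. Qed.

Lemma ev2_beta : ev2 beta = - 2%:R * p + (6%:R * tau - 4%:R).
Proof.
rewrite /ev2 /beta !eval_atE /= /ev1.
by rewrite !eval_atE.
Qed.

Lemma ev3_der F : 12%:R * sD (ev3 F) = rho * ev3 (drho F).
Proof.
apply: dpoly_eval; first exact: ev2_der.
rewrite sDrho /crho !eval_atE /= ev2_beta.
by ring.
Qed.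

Lemma rho_neq0 : rho != 0.
Proof. by apply/eqP => /(congr1 (fun f : fps => f 0%N)) /eqP; rewrite rho0. Qed.

Lemma ev1_coef0 h : ev1 h 0%N = h.[1].
Proof.
elim/poly_ind: h => [|h c IH]; first by rewrite rmorph0 horner0.
by rewrite /ev1 !eval_atE scoefD scoef0M -/ev1 IH tau0 !hornerE.
Qed.

(** Transcendence of a non-constant series: once the root [tau 0 = 1] is split off with its
    multiplicity, the cofactor takes a value with nonzero constant term. *)
Lemma ev1_neq0 h : h != 0 -> ev1 h != 0.
Proof.
move=> h0; have [m [q]] := multiplicity_XsubC h 1; rewrite h0 /= => q1 ->.
rewrite rmorphM rmorphXn mulf_neq0 ?expf_neq0 //.
  apply/eqP => /(congr1 (fun f : fps => f 0%N)); rewrite ev1_coef0 => /eqP q1'.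
  by rewrite /root q1' in q1.
by rewrite /= /ev1 !eval_atE rmorph1 subr_eq0.
Qed.

Lemma ev1_inj h1 h2 : ev1 h1 = ev1 h2 -> h1 = h2.
Proof.
move=> e; apply/eqP; rewrite -subr_eq0; apply: contraT => /ev1_neq0.
by rewrite rmorphB /= e subrr eqxx.
Qed.

Lemma dtauE h : dtau h = 12%:R * ('X^2 - 'X) * h^`().
Proof.
rewrite /dtau /dpoly mulrC [map_poly _ _](_ : _ = 0) ?addr0 ?add0r //.
by apply/polyP => i; rewrite coef_map_id0 // coef0.
Qed.

Lemma p_not_rational (f H : {poly rat}) :
  H != 0 -> ev1 H * p + ev1 f != 0.
Proof.
move=> H0; apply/negP => /eqP e.
pose d := gcdp f H.
have d0 : d != 0 by rewrite gcdp_eq0 negb_and H0 orbT.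
have [fE HE] : f = (f %/ d) * d /\ H = (H %/ d) * d.
  by rewrite !divpK ?dvdp_gcdl ?dvdp_gcdr.
set f1 := f %/ d in fE; set H1 := H %/ d in HE.
have H10 : H1 != 0 by apply: contraNneq H0 => h; rewrite HE h mul0r.
have cop : coprimep f1 H1.
  by apply: coprimep_div_gcd; rewrite H0 orbT.
have {}e : ev1 H1 * p = - ev1 f1.
  apply/eqP; rewrite -addr_eq0; apply/eqP/(mulIf (ev1_neq0 d0)).
  by rewrite mul0r -e HE fE !rmorphM /=; ring.
apply: (riccati_no_rational_solution H10 cop); apply: ev1_inj.
have De := congr1 (fun s => 12%:R * sD s) e.
rewrite raddfN /= mulrN ev1_der sDM mulrDr mulrA ev1_der mulrCA sDp in De.
set h := ev1 H1 in e De *; set g := ev1 f1 in e De *.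
have {}De : rho * (ev1 (dtau H1) * p + h * (- p ^+ 2 + (6%:R * tau - 4%:R) * p - tau) + ev1 (dtau f1)) = 0.
  by rewrite !mulrDr -[rho * ev1 (dtau f1)]opprK -De; ring.
move/eqP: De; rewrite mulf_eq0 (negPf rho_neq0) /= => /eqP De.
rewrite !(rmorph_nat, rmorphXn, rmorphB, rmorphN, rmorphD, rmorphM) /=.
rewrite [ev1 'X]eval_atX -/h -/g.
rewrite !dtauE !(rmorph_nat, rmorphXn, rmorphB, rmorphN, rmorphD, rmorphM) /= [ev1 'X]eval_atX in De.
set h' := ev1 H1^`() in De *; set g' := ev1 f1^`() in De *.
apply/eqP; rewrite -subr_eq0; apply/eqP.
rewrite (_ : _ - _ = h * (12%:R * (tau ^+ 2 - tau) * h' * p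
   + h * (- p ^+ 2 + (6%:R * tau - 4%:R) * p - tau) + 12%:R * (tau ^+ 2 - tau) * g')
   - (h * p + g) * (12%:R * (tau ^+ 2 - tau) * h' - (h * p - g) + (6%:R * tau - 4%:R) * h)); last by ring.
by rewrite De e addNr; ring.
Qed.


Lemma deriv_dp F : (dp F)^`() = dp F^`() + beta * F^`().
Proof.
rewrite deriv_dpoly mulrC; congr (_ + _ * _); rewrite /cp /beta.
rewrite derivB derivD derivN derivXn derivM derivX !derivC mul0r add0r subr0 mulr1.
by rewrite expr1 mulNr mulr_natl [in RHS]mulr_natl.
Qed.

Lemma deriv_beta : beta^`() = - 2%:R.
Proof. by rewrite /beta derivD derivM derivX derivC derivN -polyC_natr !derivC; ring. Qed.

Lemma ev2_dp_eq0 F : ev2 F = 0 -> ev2 (dp F) = 0.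
Proof.
move=> F0; apply: (mulfI rho_neq0).
by rewrite -ev2_der F0 raddf0 !mulr0.
Qed.

Lemma natr_neq0_fps n : n.+1%:R != 0 :> fps.
Proof.
apply/eqP => /(congr1 (fun f : fps => f 0%N)); rewrite -(rmorph_nat fpsC) /=.
by move/eqP; rewrite pnatr_eq0.
Qed.

Lemma size_cp : (size cp <= 3)%N.
Proof.
rewrite /cp; apply: leq_trans (size_polyD _ _) _; rewrite geq_max; apply/andP; split.
  apply: leq_trans (size_polyD _ _) _; rewrite geq_max size_polyN size_polyXn /=.
  by rewrite (leq_trans (size_polyMleq _ _)) // size_polyX addn2 /= ltnS (leq_trans (size_polyC_leq1 _)).
by rewrite size_polyN (leq_trans (size_polyC_leq1 _)).
Qed.

Lemma coef_cp2 : cp`_2 = -1.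
Proof. by rewrite /cp !(coefB, coefD, coefN) coefXn coefCM coefX coefC /= mulr0 subr0 addr0. Qed.

(** On top, [dp] sends [a p^k] to [- k a p^(k+1)], because [cp] begins with [- p^2]; adding [k p F]
    cancels this term. *)
Lemma top_dp k (F : {poly {poly rat}}) : (size F <= k.+1)%N ->
  (size (dp F + (k%:R * 'X) * F)%R <= k.+1)%N.
Proof.
move=> sF; have tF : top_coef k F`_k F by [].
have t1 : top_coef k.+1 0 (map_poly dtau F).
  by apply: top_coefS; apply/leq_sizeP => j kj; rewrite coef_map_dA nth_default ?raddf0 // (leq_trans sF).
have t2 : top_coef k.+1 (- (k%:R * F`_k)) (F^`() * cp).
  case: k sF tF {t1} => [|k] sF tF.
    have [->//|] := eqVneq F^`() 0; last first.
      by rewrite [F]size1_polyC // derivC eqxx.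
    by rewrite mul0r oppr0 mul0r; apply: top_coefS; rewrite size_poly0.
  have tF' : top_coef k (k.+1%:R * F`_k.+1) F^`().
    split; last by rewrite coef_deriv mulr_natl.
    by apply/leq_sizeP => j kj; rewrite coef_deriv nth_default ?mul0rn // (leq_trans sF).
  have := top_coefM tF' (conj size_cp coef_cp2 : top_coef 2 (-1) cp).
  by rewrite mulrN1 addn2.
have t3 : top_coef k.+1 (k%:R * F`_k) (k%:R * 'X * F).
  have := top_coefM (top_coefM (top_coefC k%:R) (top_coefX _)) tF.
  by rewrite mulr1 add0n add1n polyC_natr.
have [s c] := top_coefD (top_coefD t1 t2) t3.
move: s c; rewrite add0r addNr -/(dpoly _ _ _) -/(dp F) => s c.
apply/leq_sizeP => j; rewrite leq_eqVlt => /orP[/eqP<- //|kj].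
by rewrite nth_default // (leq_trans s).
Qed.

(** Let [F] be a relation of least degree in [p]. By [top_dp] its derivative can be corrected to a
    relation [F1] of no larger degree, so [F1] is proportional to [F]. Differentiating this
    proportionality once and twice in [p] gives first-order equations for [g = F'(p)] and
    [u = F''(p)], from which [u / (g rho)] has a nonzero constant as derivative. In degree one [u]
    vanishes, and the irrationality of [p] is used instead. *)
Lemma ev2_neq0 (F : {poly {poly rat}}) : F != 0 -> ev2 F != 0.
Proof.
have [n] := ubnP (size F); elim: n F => // n IH F; rewrite ltnS => sFn F0.
have [s1|s1] := leqP (size F) 1.
  rewrite [F]size1_polyC // /ev2 eval_atC ev1_neq0 //.
  by move: F0; rewrite [F]size1_polyC // polyC_eq0 coefC.
pose k := (size F).-2; have sF : size F = k.+2 by rewrite /k; case: (size F) s1 => [|[]].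
apply/negP => /eqP evF.
pose H := lead_coef F; have HF : F`_k.+1 = H by rewrite /H lead_coefE sF.
have H0 : H != 0 by rewrite lead_coef_eq0.
pose F1 := dp F + (k.+1%:R * 'X) * F; pose c := F1`_k.+1.
have sF1 : (size F1 <= k.+2)%N by apply: top_dp; rewrite sF.
have small (G : {poly {poly rat}}) : (size G <= k.+1)%N -> ev2 G = 0 -> G = 0.
  move=> sG e; apply/eqP; apply: contraT => G0.
  have := IH G; rewrite e eqxx; apply=> //.
  by apply: leq_trans sFn; rewrite sF.
have rel : H%:P * F1 - c%:P * F = 0.
  apply: small.
    apply/leq_sizeP => j; rewrite leq_eqVlt => /orP[/eqP<-|kj].
      by rewrite coefB !coefCM HF mulrC subrr.
    by rewrite coefB !coefCM !nth_default ?mulr0 ?subrr ?sF // (leq_trans sF1).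
  rewrite rmorphB !rmorphM /= evF rmorphD rmorphM /= evF ev2_dp_eq0 //.
  by rewrite !(mulr0, addr0, subr0).
pose K : {poly {poly rat}} := k.+1%:R.
(* Proportionality makes [F] an eigenvector of [H dp], with an eigenvalue [M] that is linear in
   [p]. *)
pose M := c%:P - K * H%:P * 'X.
have {rel} r0 : H%:P * dp F = M * F.
  apply/eqP; rewrite -subr_eq0; apply/eqP; rewrite -rel /M /F1 -/K; ring.
have M' : M^`() = - K * H%:P.
  by rewrite /M derivB derivC derivM derivX derivM derivC /K -polyC_natr derivC; ring.
have r1 : H%:P * (dp F^`() + beta * F^`()) = - K * H%:P * F + M * F^`().
  by have := congr1 deriv r0; rewrite derivM derivC mul0r add0r deriv_dp => ->; rewrite derivM M'.
have r2 : H%:P * dp F^`()^`() =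
   (M - 2%:R * beta * H%:P) * F^`()^`() - 2%:R * (K - 1) * H%:P * F^`().
  have : (H%:P * (dp F^`() + beta * F^`()))^`() = (- K * H%:P * F + M * F^`())^`() by rewrite r1.
  rewrite derivM derivC mul0r add0r derivD deriv_dp derivM deriv_beta.
  rewrite derivD [in RHS]derivM [in RHS]derivM [in RHS]derivM M'.
  have -> : (- K)^`() = 0 by rewrite /K -polyC_natr -polyCN derivC.
  rewrite derivC => e.
  apply: (addIr (H%:P * (beta * F^`()^`() + (- 2%:R * F^`() + beta * F^`()^`())))).
  by rewrite -mulrDr addrA e; ring.
clearbody M.
have g1 : ev2 F^`() != 0.
  have s' : (size F^`() <= k.+1)%N by rewrite -ltnS -sF lt_size_deriv.
  apply/eqP => /(small _ s') e'; have := coef_deriv F k; rewrite e' coef0 HF.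
  by move/esym/eqP; rewrite -mulr_natl mulf_eq0 (negPf H0) orbF -polyC_natr polyC_eq0 pnatr_eq0.
case: k => [|k] in sF HF F1 c sF1 small K M r0 M' r1 r2 *.
  have := p_not_rational F`_0 H0; rewrite -evF.
  have -> : F = H%:P * 'X + (F`_0)%:P.
    apply/polyP => -[|[|i]]; rewrite coefD coefCM coefX coefC /= ?mulr0 ?mulr1 ?add0r ?addr0 //.
    by rewrite nth_default // sF.
  rewrite /ev2 !eval_atE coefD coefCM coefX coefC mulr0 add0r /= => /negP; apply.
  by rewrite eqxx.
pose be := beta; have beE : ev2 be = _ := ev2_beta.
rewrite -/be in r1 r2; clearbody be.
pose h := ev1 H; have h0 : h != 0 by apply: ev1_neq0.
pose u := ev2 F^`()^`(); set g := ev2 F^`() in g1; pose m := ev2 M; pose b := ev2 be.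
have e1 : 12%:R * (h * sD g) = rho * ((m - h * b) * g).
  rewrite mulrCA ev2_der; have [d1 d1E] : exists d1, d1 = dp F^`() by exists (dp F^`()).
  rewrite -d1E in r1 *; have := congr1 ev2 r1; rewrite !(rmorphD, rmorphM) /= evF mulr0 add0r [ev2 H%:P]eval_atC /= -/h -/g -/m -/b => e.
  by rewrite mulrBl -e; ring.
have e2 : 12%:R * (h * sD u) = rho * ((m - 2%:R * b * h) * u - 2%:R * k.+1%:R * h * g).
  rewrite mulrCA ev2_der; have [d2 d2E] : exists d2, d2 = dp F^`()^`() by exists (dp F^`()^`()).
  rewrite -d2E in r2 *; have := congr1 ev2 r2.
  rewrite !(rmorph_nat, rmorph1, rmorphB, rmorphM) /= [ev2 H%:P]eval_atC /= -/h -/g -/m -/b -/u => e.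
  by rewrite mulrCA e -[k.+2]addn1 natrD addrK.
have e3 : 12%:R * sD rho = - rho ^+ 2 * b by rewrite sDrho /b beE; ring.
(* The factor [b] enters twice through [u], and once each through [g] and [rho]; so it cancels in
   the quotient, as does [m], and only the inhomogeneous term of [e2] is left. *)
have : 12%:R * (sD u * (g * rho) - u * sD (g * rho)) = - (2%:R * k.+1%:R) * (g * rho) ^+ 2.
  apply: (mulfI h0); rewrite sDM.
  rewrite (_ : h * _ = 12%:R * (h * sD u) * (g * rho) - u * (12%:R * (h * sD g)) * rho
      - u * h * g * (12%:R * sD rho)); last by ring.
  by rewrite e1 e2 e3; ring.
have gr : g * rho != 0 by rewrite mulf_neq0 ?rho_neq0.
move=> e; have := @sD_quotient_fpsC u (g * rho) (- (2%:R * k.+1%:R) / 12%:R) gr.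
suff h' : sD u * (g * rho) - u * sD (g * rho) = fpsC (- (2%:R * k.+1%:R) / 12%:R) * (g * rho) ^+ 2.
  by move/(_ h')/eqP; rewrite mulf_eq0 oppr_eq0 invr_eq0 mulf_eq0 !pnatr_eq0.
apply: (mulfI (natr_neq0_fps 11)); rewrite e [RHS]mulrA -(rmorph_nat fpsC 12) -[fpsC 12%:R * _](rmorphM fpsC); congr (_ * _).
by rewrite [12%:R * _]mulrC divfK ?pnatr_eq0 // rmorphN rmorphM !rmorph_nat.
Qed.


Lemma coef_drho F i : (drho F)`_i = dp F`_i - i%:R * beta * F`_i.
Proof.
rewrite /drho /dpoly coefD coef_map_dA /crho mulrA coefMX; case: i => [|i] /=.
  by rewrite mul0r mul0r subr0 addr0.
by rewrite -polyCN coefMC coef_deriv -mulr_natl; ring.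
Qed.

(** A relation of least degree in [rho] may be assumed to have a nonzero constant coefficient [E];
    let [G] be its leading one. Eliminating the top term between the relation and its derivative
    leaves zero by minimality, so [E / G] satisfies the same equation as [rho^(k+1)]. This is
    impossible inside [rat[tau, p]], as differentiation in [p] shows. *)
Lemma ev3_neq0 (F : {poly {poly {poly rat}}}) : F != 0 -> ev3 F != 0.
Proof.
have [n] := ubnP (size F); elim: n F => // n IH F; rewrite ltnS => sFn F0.
have [s1|s1] := leqP (size F) 1.
  rewrite [F]size1_polyC // /ev3 eval_atC ev2_neq0 //.
  by move: F0; rewrite [F]size1_polyC // polyC_eq0 coefC.
pose k := (size F).-2; have sF : size F = k.+2 by rewrite /k; case: (size F) s1 => [|[]].
have [E0|E0] := eqVneq F`_0 0.
  have FE : F = (\poly_(i < k.+1) F`_i.+1) * 'X.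
    apply/polyP => -[|i]; rewrite coefMX //= coef_poly; case: ltnP => // ki.
    by rewrite nth_default // sF.
  rewrite FE rmorphM /= {2}/ev3 eval_atX mulf_neq0 ?rho_neq0 //; apply: IH.
    by apply: leq_trans sFn; rewrite sF ltnS size_poly.
  by apply: contraNneq F0 => h; rewrite FE h mul0r.
apply/negP => /eqP evF.
set E := F`_0 in E0; pose G := F`_k.+1.
have G0 : G != 0 by rewrite /G -[k.+1]/(k.+2.-1) -sF -lead_coefE lead_coef_eq0.
have dF0 : ev3 (drho F) = 0.
  by apply: (mulfI rho_neq0); rewrite -ev3_der evF raddf0 !mulr0.
(* The bracket is the top coefficient of [drho F], so the terms of degree [k + 1] cancel. *)
pose K := G%:P * drho F - (dp G - k.+1%:R * beta * G)%:P * F.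
have K0 : K = 0.
  have sK : (size K < n)%N.
    apply: leq_trans sFn; rewrite sF ltnS; apply/leq_sizeP => j.
    rewrite leq_eqVlt => /orP[/eqP<-|kj]; rewrite coefB !coefCM coef_drho.
      by rewrite -/G; ring.
    by rewrite [F`_j]nth_default ?sF // raddf0 !mulr0 subrr mulr0 subrr.
  apply/eqP; apply: contraT => /(IH K sK).
  rewrite /K [ev3 (_ - _)]rmorphB /= [ev3 (_ * drho F)]rmorphM [ev3 (_ * F)]rmorphM /=.
  by rewrite evF dF0 !mulr0 subrr eqxx.
have [b bE] : exists b, b = beta by exists beta.
have [dE dEE] : exists dE, dE = dp E by exists (dp E).
have [dG dGE] : exists dG, dG = dp G by exists (dp G).
have [dE' dE'E] : exists dE', dE' = dp E^`() by exists (dp E^`()).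
have [dG' dG'E] : exists dG', dG' = dp G^`() by exists (dp G^`()).
have DdE : dE^`() = dE' + b * E^`() by rewrite dEE deriv_dp dE'E bE.
have DdG : dG^`() = dG' + b * G^`() by rewrite dGE deriv_dp dG'E bE.
have Db : b^`() = - 2%:R by rewrite bE deriv_beta.
have Dk : (k.+1%:R : {poly {poly rat}})^`() = 0 by rewrite -polyC_natr derivC.
have r1 : G * dE - E * dG = - k.+1%:R * b * E * G.
  have := congr1 (fun P : {poly {poly {poly rat}}} => P`_0) K0.
  rewrite /K coefB !coefCM coef_drho coef0 -/E mul0r mul0r subr0 -dEE -dGE -bE => e.
  apply/eqP; rewrite -subr_eq0; apply/eqP; rewrite -[RHS]e; ring.
have r2 : G^`() * dE + G * (dE' + b * E^`()) - E^`() * dG - E * (dG' + b * G^`())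
    = 2%:R * k.+1%:R * E * G - k.+1%:R * b * (E^`() * G + E * G^`()).
  have : (G * dE - E * dG)^`() = (- k.+1%:R * b * E * G)^`() by rewrite r1.
  rewrite derivB !derivM DdE DdG Db derivN Dk => e.
  transitivity (G^`() * dE + G * (dE' + b * E^`()) - (E^`() * dG + E * (dG' + b * G^`()))).
    by ring.
  by rewrite e; ring.
pose e := ev2 E; pose g := ev2 G; pose e' := ev2 E^`(); pose g' := ev2 G^`().
have e0 : e != 0 by apply: ev2_neq0.
have g0 : g != 0 by apply: ev2_neq0.
have He : 12%:R * sD e = rho * ev2 dE by rewrite ev2_der dEE.
have Hg : 12%:R * sD g = rho * ev2 dG by rewrite ev2_der dGE.
have He' : 12%:R * sD e' = rho * ev2 dE' by rewrite ev2_der dE'E.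
have Hg' : 12%:R * sD g' = rho * ev2 dG' by rewrite ev2_der dG'E.
have Hr : 12%:R * sD rho = - rho ^+ 2 * ev2 b by rewrite sDrho bE ev2_beta; ring.
have {}r1 := congr1 ev2 r1; have {}r2 := congr1 ev2 r2.
rewrite !(rmorph_nat, rmorphN, rmorphB, rmorphD, rmorphM) /= -/e -/g -/e' -/g' in r1 r2.
set be := ev2 b in r1 r2 Hr.
(* This is the numerator of [D] applied to [(E'/E - G'/G) / rho], with primes for derivatives in
   [p]. *)
have e12 : 12%:R * (sD (e' * g - g' * e) * (rho * e * g) - (e' * g - g' * e) * sD (rho * e * g))
   = 2%:R * k.+1%:R * (rho * e * g) ^+ 2.
  rewrite raddfB /= !sDM.
  rewrite (_ : _ * _ = (12%:R * sD e' * g + e' * (12%:R * sD g) - 12%:R * sD g' * e - g' * (12%:R * sD e)) * (rho * e * g)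
     - (e' * g - g' * e) * (12%:R * sD rho * e * g + rho * (12%:R * sD e) * g + rho * e * (12%:R * sD g))); last by ring.
  rewrite He Hg He' Hg' Hr.
  apply/eqP; rewrite -subr_eq0; apply/eqP.
  rewrite (_ : _ - _ = rho ^+ 2 * (e * g * ((g' * ev2 dE + g * (ev2 dE' + be * e') - e' * ev2 dG - e * (ev2 dG' + be * g'))
    - (2%:R * k.+1%:R * e * g - k.+1%:R * be * (e' * g + e * g')))
    - (e' * g + e * g') * ((g * ev2 dE - e * ev2 dG) - (- k.+1%:R * be * e * g)))); last by ring.
  by rewrite r1 r2; ring.
have B0 : rho * e * g != 0 by rewrite !mulf_neq0 ?rho_neq0.
have := @sD_quotient_fpsC (e' * g - g' * e) _ (2%:R * k.+1%:R / 12%:R) B0.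
suff h' : sD (e' * g - g' * e) * (rho * e * g) - (e' * g - g' * e) * sD (rho * e * g)
    = fpsC (2%:R * k.+1%:R / 12%:R) * (rho * e * g) ^+ 2.
  by move/(_ h')/eqP; rewrite mulf_eq0 invr_eq0 mulf_eq0 !pnatr_eq0.
apply: (mulfI (natr_neq0_fps 11)); rewrite e12 [RHS]mulrA -(rmorph_nat fpsC 12) -[fpsC 12%:R * _](rmorphM fpsC); congr (_ * _).
by rewrite [12%:R * _]mulrC divfK ?pnatr_eq0 // rmorphM !rmorph_nat.
Qed.

End Independence.

(** * A convolution identity for the sum of divisors *)

Section VanDerPol.
Variable n : nat.
Let I := 'I_n.+1.
Implicit Types (w : (I * I) * (I * I)) (f : nat -> nat -> nat -> nat -> rat).

(* Quadruples [((a, b), (x, y))] with [a x + b y = n]. *)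
Definition quad w : bool :=
  [&& (0 < w.1.1)%N, (0 < w.1.2)%N, (0 < w.2.1)%N, (0 < w.2.2)%N
    & (w.1.1 * w.2.1 + w.1.2 * w.2.2 == n)%N].

Definition at4 f w : rat := f w.1.1 w.1.2 w.2.1 w.2.2.

(** The bijection is [(a, b, x, y) -> (a - b, b, x, x + y)], which preserves [a x + b y]; [h] below
    is its inverse. *)
Lemma quad_shear f :
  \sum_(w | quad w && (w.1.2 < w.1.1)%N) at4 f w =
  \sum_(w | quad w && (w.2.1 < w.2.2)%N)
     at4 (fun a b x y => f (a + b)%N b x (y - x)%N) w.
Proof.
pose h w : (I * I) * (I * I) :=
  ((inord (w.1.1 + w.1.2), w.1.2), (w.2.1, inord (w.2.2 - w.2.1))).
pose h' w : (I * I) * (I * I) :=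
  ((inord (w.1.1 - w.1.2), w.1.2), (w.2.1, inord (w.2.2 + w.2.1))).
(* All four entries are positive, so sums of neighbours stay at most [n] and [inord] never falls
   back to its default. *)
have aux w : quad w -> (w.2.2 + w.2.1 < n.+1)%N /\ (w.1.1 + w.1.2 < n.+1)%N.
  by case/and5P=> ? ? ? ? /eqP; split; nia.
have hK w : quad w -> (w.2.1 < w.2.2)%N ->
    [/\ quad (h w), ((h w).1.2 < (h w).1.1)%N & h' (h w) = w].
  move=> qw lt; have [_ l1] := aux _ qw.
  have l2 : (w.2.2 - w.2.1 < n.+1)%N by have := ltn_ord w.2.2; lia.
  case: w qw lt l1 l2 => [[a b] [x y]] /= /and5P[/= a0 b0 x0 y0 /eqP e] lt l1 l2.
  rewrite /quad /h /h' /= !inordK //; split; [|lia|].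
    by apply/and5P; split=> //; first [lia | apply/eqP; nia].
  by congr (_, _, (_, _)); apply: val_inj; rewrite /= inordK /=; have := ltn_ord a; have := ltn_ord y; lia.
have h'K w : quad w -> (w.1.2 < w.1.1)%N ->
    [/\ quad (h' w), ((h' w).2.1 < (h' w).2.2)%N & h (h' w) = w].
  move=> qw lt; have [l1 _] := aux _ qw.
  have l2 : (w.1.1 - w.1.2 < n.+1)%N by have := ltn_ord w.1.1; lia.
  case: w qw lt l1 l2 => [[a b] [x y]] /= /and5P[/= a0 b0 x0 y0 /eqP e] lt l1 l2.
  rewrite /quad /h /h' /= !inordK //; split; [|lia|].
    by apply/and5P; split=> //; first [lia | apply/eqP; nia].
  by congr (_, _, (_, _)); apply: val_inj; rewrite /= inordK /=; have := ltn_ord a; have := ltn_ord y; lia.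
rewrite (reindex_onto h h') => [|w /andP[qw lt]]; last by case: (h'K w qw lt).
apply: eq_big => [w|w /andP[/andP[qh lt] /eqP e]].
  apply/idP/idP => [/andP[/andP[q lt] /eqP e]|/andP[q lt]].
    by have [] := h'K _ q lt; rewrite e => -> ->.
  by have [-> -> /eqP ->] := hK _ q lt.
have [q lt'] : quad w /\ (w.2.1 < w.2.2)%N by have [] := h'K _ qh lt; rewrite e.
have [_ l1] := aux _ q.
by rewrite /at4 /= !inordK // (leq_ltn_trans (leq_subr _ _)).
Qed.


Lemma quad_swap f (C : rel (I * I)) :
  \sum_(w | quad w && C w.1 w.2) at4 f w =
  \sum_(w | quad w && C (w.1.2, w.1.1) (w.2.2, w.2.1))
     at4 (fun a b x y => f b a y x) w.
Proof.
pose h w := ((w.1.2, w.1.1), (w.2.2, w.2.1)).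
have hK : cancel h h by case=> [[? ?] [? ?]].
rewrite (reindex_inj (can_inj hK)); apply: eq_bigl => w /=.
congr (_ && _); rewrite /quad /=.
by rewrite (addnC (w.1.2 * _)%N); apply/and5P/and5P => -[].
Qed.

Definition diag_sum f := \sum_(w | quad w && (w.1.1 == w.1.2 :> nat)) at4 f w.

(* [g] is [f] pulled back along the shear; both are swap-invariant, so each
   full sum is twice the sum over a half plus the diagonal, and [g] vanishes
   on the diagonal [x = y]. *)
Lemma quad_sum_shear f :
  (forall a b x y, f b a y x = f a b x y) ->
  (forall a b x, f a b x 0%N = 0) ->
  forall g, (forall a b x y, g b a y x = g a b x y) ->
  (forall a b x, g a b x x = 0) ->
  (forall a b x y, (x < y)%N -> g a b x y = f (a + b)%N b x (y - x)%N) ->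
  \sum_(w | quad w) at4 f w - \sum_(w | quad w) at4 g w = diag_sum f.
Proof.
move=> fs f0 g gs g0 gh.
pose h a b x y := f (a + b)%N b x (y - x)%N.
have split3 (F : (I * I) * (I * I) -> rat) (u v : (I * I) * (I * I) -> nat) :
    \sum_(w | quad w) F w = \sum_(w | quad w && (v w < u w)%N) F w
     + \sum_(w | quad w && (u w < v w)%N) F w
     + \sum_(w | quad w && (u w == v w)) F w.
  rewrite (bigID (fun w => (v w < u w)%N)) /= -addrA; congr (_ + _).
  rewrite (bigID (fun w => (u w < v w)%N)) /=; congr (_ + _).
    by apply: eq_bigl => w; rewrite -andbA; congr andb; lia.
  by apply: eq_bigl => w; rewrite -andbA; congr andb; lia.
rewrite (split3 _ (fun w => w.1.1 : nat) (fun w => w.1.2 : nat)).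
rewrite [X in _ - X](split3 _ (fun w => w.2.2 : nat) (fun w => w.2.1 : nat)).
rewrite (quad_shear f).
rewrite (@quad_swap f (fun ab _ => (ab.1 < ab.2)%N)) /=.
rewrite (@quad_swap g (fun _ xy => (xy.2 < xy.1)%N)) /=.
have -> : \sum_(w | quad w && (w.1.2 < w.1.1)%N) at4 (fun a b x y => f b a y x) w
        = \sum_(w | quad w && (w.2.1 < w.2.2)%N) at4 h w.
  rewrite -quad_shear; apply: eq_bigr => w _.
  by rewrite /at4 fs.
have -> : \sum_(w | quad w && (w.2.1 < w.2.2)%N) at4 (fun a b x y => g b a y x) w
        = \sum_(w | quad w && (w.2.1 < w.2.2)%N) at4 h w.
  by apply: eq_bigr => w /andP[_ lt]; rewrite /at4 gs gh.
have -> : \sum_(w | quad w && (w.2.1 < w.2.2)%N) at4 g w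
        = \sum_(w | quad w && (w.2.1 < w.2.2)%N) at4 h w.
  by apply: eq_bigr => w /andP[_ lt]; rewrite /at4 gh.
rewrite [X in _ - (_ + X)]big1 => [|w /andP[_ /eqP e]]; last by rewrite /at4 e g0.
by rewrite addr0 /diag_sum addrAC subrr add0r.
Qed.

(* [divisors 0 = [:: 1]], hence the explicit value at [0]. *)
Definition sigma0 (k : nat) : rat := if k is 0 then 0 else (sigma k)%:R.

(** Both factors range up to [n] whatever [k] is, so these sums use the index type of the
    quadruples; no factorization is missed for [0 < k <= n], and the sum is empty for [k = 0]. *)
Definition dsum (k : nat) (u : nat -> nat -> rat) : rat :=
  \sum_(a < n.+1) \sum_(x < n.+1 | [&& (0 < a)%N, (0 < x)%N & (a * x == k)%N]) u a x.

Lemma dsumC k u : dsum k u = dsum k (fun a x => u x a).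
Proof.
rewrite /dsum; under eq_bigr do rewrite big_mkcond /=.
rewrite exchange_big /=; apply: eq_bigr => x _; rewrite -big_mkcond /=.
by apply: eq_bigl => a; rewrite mulnC; apply/and3P/and3P => -[].
Qed.

Lemma dsum_sigma k : (k <= n)%N -> dsum k (fun a _ => a%:R) = sigma0 k.
Proof.
case: k => [_|k kn].
  rewrite /dsum /sigma0 big1 // => a _.
  by rewrite big_pred0 // => x; lia.
rewrite /dsum /sigma0 /sigma natr_sum.
transitivity (\sum_(a < n.+1 | (a %| k.+1)%N) a%:R : rat).
  rewrite [RHS]big_mkcond; apply: eq_bigr => a _.
  case: ifP => [/dvdnP[x e]|nd].
    have xn : (x < n.+1)%N by have : (0 < a)%N by [case: (nat_of_ord a) e => //; lia]; nia.
    rewrite (big_pred1 (Ordinal xn)) // => y; apply/and3P/eqP => [[a0 y0 /eqP e']|->].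
      by apply: val_inj => /=; apply/eqP; rewrite -(eqn_pmul2l a0) e' e mulnC.
    by rewrite /= mulnC -e; split=> //; [case: (nat_of_ord a) e|case: (x) e] => //; lia.
  rewrite big_pred0 // => x; apply/and3P => -[_ _ /eqP e].
  by rewrite -e dvdn_mulr in nd.
rewrite -(big_mkord (fun a => (a %| k.+1)%N) (fun a => a%:R)) -big_filter.
apply: perm_big; apply: uniq_perm; rewrite ?divisors_uniq ?filter_uniq ?iota_uniq //.
move=> d; rewrite mem_filter mem_index_iota -dvdn_divisors //=.
by case: (boolP (d %| k.+1)%N) => // /dvdn_leq; lia.
Qed.

Lemma quad_conv (u v : nat -> nat -> rat) :
  \sum_(w | quad w) at4 (fun a b x y => u a x * v b y) w =
  \sum_(k < n.+1) dsum k u * dsum (n - k) v.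
Proof.
rewrite (partition_big (fun w => inord (w.1.1 * w.2.1) : I) predT) //=.
apply: eq_bigr => k _; rewrite /dsum.
pose C1 (p : I * I) := [&& (0 < p.1)%N, (0 < p.2)%N & (p.1 * p.2 == k)%N].
pose C2 (p : I * I) := [&& (0 < p.1)%N, (0 < p.2)%N & (p.1 * p.2 == n - k)%N].
have e1 (C : pred (I * I)) F : \sum_(a < n.+1) \sum_(x < n.+1 | C (a, x)) F a x
    = \sum_(p : I * I | C p) (F p.1 p.2 : rat).
  under eq_bigr do rewrite big_mkcond /=; rewrite pair_big /= [RHS]big_mkcond /=.
  by apply: eq_bigr => -[].
rewrite (e1 C1) (e1 C2) big_distrlr /=.
rewrite pair_big /=.
pose h (z : (I * I) * (I * I)) := ((z.1.1, z.2.1), (z.1.2, z.2.2)).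
have hK : cancel h h by case=> [[? ?] [? ?]].
rewrite (reindex_inj (can_inj hK)) /=; apply: eq_bigl => -[[a x] [b y]].
rewrite /quad /C1 /C2 /h /=; have := ltn_ord k => kn.
apply/andP/andP => -[].
  case/and5P=> a0 b0 x0 y0 /eqP e /eqP ek.
  have {}ek : (a * x)%N = k by rewrite -ek inordK //; nia.
  by split; apply/and3P; split=> //; apply/eqP; lia.
case/and3P=> a0 x0 /eqP e1'; case/and3P=> b0 y0 /eqP e2; split.
  by apply/and5P; split=> //; apply/eqP; lia.
by apply/eqP/val_inj; rewrite /= inordK //; lia.
Qed.

End VanDerPol.

Lemma sum_mul_rev (s : nat) :
  \sum_(x < s) (x%:R * (s%:R - x%:R)) = (s%:R ^+ 3 - s%:R) / 6%:R :> rat.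
Proof.
(* Freeing the inner occurrence of [s] makes the induction possible. *)
have H (c : rat) : \sum_(x < s) (x%:R * (c - x%:R)) =
    c * (s%:R * (s%:R - 1)) / 2%:R - (s%:R - 1) * s%:R * (2%:R * s%:R - 1) / 6%:R.
  elim: s => [|s IH]; first by rewrite big_ord0; field.
  by rewrite big_ord_recr /= IH -[s.+1]addn1 natrD; field.
by rewrite H; field.
Qed.

(** On the diagonal [n = a s] with [s = x + y]. Summing over [x] gives [a^3 s (s^3 - s) / 12 = (n^3
    s - n^2 a) / 12], and both [a] and [s] run through the divisors of [n]. *)
Lemma quad_diag (n : nat) (f : nat -> nat -> nat -> nat -> rat) :
  (forall a x y, f a a x y = a%:R ^+ 3 * x%:R * y%:R * (x + y)%:R / 2) ->
  diag_sum n f = (n%:R ^+ 3 - n%:R ^+ 2) * sigma0 n / 12%:R.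
Proof.
move=> fE.
pose C (a x y : nat) := [&& (0 < a)%N, (0 < x)%N, (0 < y)%N & (a * (x + y) == n)%N].
have -> : diag_sum n f = \sum_(a < n.+1) \sum_(x < n.+1) \sum_(y < n.+1 | C a x y)
    (a%:R ^+ 3 * x%:R * y%:R * (x + y)%:R / 2).
  transitivity (\sum_(z : 'I_n.+1 * ('I_n.+1 * 'I_n.+1) | C z.1 z.2.1 z.2.2)
     (z.1%:R ^+ 3 * z.2.1%:R * z.2.2%:R * (z.2.1 + z.2.2)%:R / 2 : rat)).
    rewrite /diag_sum.
    pose h (z : 'I_n.+1 * ('I_n.+1 * 'I_n.+1)) := ((z.1, z.1), z.2).
    pose h' (w : ('I_n.+1 * 'I_n.+1) * ('I_n.+1 * 'I_n.+1)) := (w.1.1, w.2).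
    rewrite (reindex_onto h h') => [|[[a b] [x y]] /andP[_ /eqP /= e]]; last first.
      by congr (_, _, _); apply: val_inj.
    apply: eq_big => [[a [x y]]|[a [x y]] _]; last by rewrite /at4 /= fE.
    by rewrite /quad /C /= !eqxx !andbT mulnDr; case: (0 < a)%N.
  rewrite [LHS]big_mkcond /= -(pair_bigA _ (fun (a : 'I_n.+1) (z : 'I_n.+1 * 'I_n.+1) => if C a z.1 z.2 then a%:R ^+ 3 * z.1%:R * z.2%:R * (z.1 + z.2)%:R / 2 else 0 : rat)) /=.
  apply: eq_bigr => a _.
  rewrite -(pair_bigA _ (fun x y : 'I_n.+1 => if C a x y then a%:R ^+ 3 * x%:R * y%:R * (x + y)%:R / 2 else 0 : rat)) /=.
  by apply: eq_bigr => x _; rewrite -big_mkcond.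
transitivity (dsum n n (fun a s => (n%:R ^+ 3 * s%:R - n%:R ^+ 2 * a%:R) / 12%:R)).
  apply: eq_bigr => a _.
  transitivity (\sum_(s < n.+1 | [&& (0 < a)%N, (0 < s)%N & (a * s == n)%N])
     \sum_(x < s) (a%:R ^+ 3 * x%:R * (s%:R - x%:R) * s%:R / 2 : rat)).
    rewrite [RHS](_ : _ = \sum_(x < n.+1) \sum_(s < n.+1 |
       [&& (0 < a)%N, (0 < s)%N & (a * s == n)%N] && (x < s)%N)
       (a%:R ^+ 3 * x%:R * (s%:R - x%:R) * s%:R / 2 : rat)); last first.
      rewrite (exchange_big_dep (fun s : 'I_n.+1 => [&& (0 < a)%N, (0 < s)%N & (a * s == n)%N])) /=.
        apply: eq_bigr => s Hs.
        rewrite (big_ord_widen_cond n.+1 predT (fun x => a%:R ^+ 3 * x%:R * (s%:R - x%:R) * s%:R / 2)) //.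
          by apply: eq_bigl => x; rewrite Hs.
        exact: ltnW (ltn_ord s).
      by move=> x s _ /andP[].
    apply: eq_bigr => x _; have [x0|x0] := posnP x.
      rewrite big_pred0 => [|y]; last by rewrite /C x0 andbF.
      by rewrite big1 // => s _; rewrite x0; ring.
    rewrite (reindex_onto (fun s : 'I_n.+1 => inord (s - x)) (fun y : 'I_n.+1 => inord (y + x))).
      apply: eq_big => [s|s].
        rewrite inordK ?(leq_ltn_trans (leq_subr _ _)) //; apply/andP/andP => -[].
          case/and4P=> a0 _ sx0 /eqP e _; split; last by lia.
          by apply/and3P; split=> //; [lia|apply/eqP; nia].
        case/and3P=> a0 s0 /eqP e xs; split; first by rewrite /C; apply/and4P; split; nia.
        by apply/eqP/val_inj; rewrite /= inordK; have := ltn_ord s; lia.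
      rewrite inordK ?(leq_ltn_trans (leq_subr _ _)) // => /andP[/and4P[_ _ sx _] _].
      by rewrite natrD natrB; [field|lia].
    move=> y /and4P[a0 _ y0 /eqP e]; have h : (y + x < n.+1)%N by nia.
    by apply: val_inj; rewrite /= !inordK; have := ltn_ord y; lia.
  apply: eq_bigr => s /and3P[a0 s0 /eqP e].
  transitivity (a%:R ^+ 3 * s%:R / 2 * \sum_(x < s) (x%:R * (s%:R - x%:R)) : rat).
    by rewrite mulr_sumr; apply: eq_bigr => x _; ring.
  have -> : n%:R = a%:R * s%:R :> rat by rewrite -natrM e.
  by rewrite sum_mul_rev; field.
have dD u v : dsum n n (fun a x => u a x - v a x) = dsum n n u - dsum n n v.
  by rewrite /dsum -sumrB; apply: eq_bigr => a _; rewrite sumrB.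
have dZ c u : dsum n n (fun a x => c * u a x) = c * dsum n n u.
  by rewrite /dsum mulr_sumr; apply: eq_bigr => a _; rewrite mulr_sumr.
rewrite [LHS](_ : _ = dsum n n (fun a s => n%:R ^+ 3 / 12%:R * s%:R - n%:R ^+ 2 / 12%:R * a%:R)).
  by rewrite dD !dZ dsumC !dsum_sigma //; ring.
by apply: eq_bigr => a _; apply: eq_bigr => x _; ring.
Qed.

Lemma van_der_pol (n : nat) :
  \sum_(k < n.+1) ((3 * k%:R * (n - k)%:R - k%:R ^+ 2 - (n - k)%:R ^+ 2)
      * sigma0 k * sigma0 (n - k)) =
  (n%:R ^+ 3 - n%:R ^+ 2) * sigma0 n / 12%:R :> rat.
Proof.
pose N (z : nat) : rat := z%:R.
(* The cubic form in [a], [b] is chosen so that [a^2 b x^2 y], [b^3 x^2 y] and their mirror images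
   cancel in [f - g]. Each remaining monomial is a product of powers of [a x] and [b y] with one of
   [a], [x] and one of [b], [y], so that its sum is a convolution of values of [sigma]. *)
pose f a b x y : rat := N x * N y * (N x + N y) * (N a + N b)
   * (2 * N a - N b) * (2 * N b - N a) / 4.
pose g a b x y : rat := N x * N y * (N y - N x) * (N b - N a)
   * (N a + 2 * N b) * (2 * N a + N b) / 4.
have fs a b x y : f b a y x = f a b x y by rewrite /f; ring.
have f0 a b x : f a b x 0%N = 0 by rewrite /f /N; ring.
have gs a b x y : g b a y x = g a b x y by rewrite /g; ring.
have g0 a b x : g a b x x = 0 by rewrite /g; ring.
have gf a b x y : (x < y)%N -> g a b x y = f (a + b)%N b x (y - x)%N.
  by move=> lt; rewrite /f /g /N natrB ?(ltnW lt) // natrD; field.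
have := @quad_sum_shear n f fs f0 g gs g0 gf.
rewrite quad_diag => [<-|a x y]; last by rewrite /f /N natrD; field.
pose u1 (a x : nat) : rat := N a ^+ 3 * N x ^+ 2.
pose u2 (a x : nat) : rat := N a * N x ^+ 2.
pose u3 (a x : nat) : rat := N a ^+ 2 * N x.
pose u4 (a x : nat) : rat := N x.
have -> : \sum_(w | @quad n w) at4 f w - \sum_(w | @quad n w) at4 g w =
   - \sum_(w | @quad n w) at4 (fun a b x y => u1 a x * u4 b y) w
   - \sum_(w | @quad n w) at4 (fun a b x y => u4 a x * u1 b y) w
   + 3 / 2 * (\sum_(w | @quad n w) at4 (fun a b x y => u2 a x * u3 b y) w
     + \sum_(w | @quad n w) at4 (fun a b x y => u3 a x * u2 b y) w) :> rat.
  rewrite -!sumrB -!big_split /= mulr_sumr -sumrN -sumrB -big_split /=.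
  by apply: eq_bigr => w _; rewrite /at4 /f /g /u1 /u2 /u3 /u4; field.
rewrite !quad_conv -!big_split /= mulr_sumr -sumrN -sumrB -big_split /=.
apply: eq_bigr => k _; have := ltn_ord k; rewrite ltnS => kn.
have d1 k' : (k' <= n)%N -> dsum n k' u1 = N k' ^+ 2 * sigma0 k'.
  move=> ?; rewrite /N -(@dsum_sigma n) // /dsum mulr_sumr; apply: eq_bigr => a _.
  by rewrite mulr_sumr; apply: eq_bigr => x /and3P[_ _ /eqP <-]; rewrite natrM /u1 /N; ring.
have d2 k' : (k' <= n)%N -> dsum n k' u2 = N k' * sigma0 k'.
  move=> ?; rewrite dsumC /N -(@dsum_sigma n) // /dsum mulr_sumr; apply: eq_bigr => a _.
  by rewrite mulr_sumr; apply: eq_bigr => x /and3P[_ _ /eqP <-]; rewrite natrM /u2 /N; ring.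
have d3 k' : (k' <= n)%N -> dsum n k' u3 = N k' * sigma0 k'.
  move=> ?; rewrite /N -(@dsum_sigma n) // /dsum mulr_sumr; apply: eq_bigr => a _.
  by rewrite mulr_sumr; apply: eq_bigr => x /and3P[_ _ /eqP <-]; rewrite natrM /u3 /N; ring.
have d4 k' : (k' <= n)%N -> dsum n k' u4 = sigma0 k'.
  by move=> ?; rewrite dsumC /N -(@dsum_sigma n).
by rewrite !(d1, d2, d3, d4) ?leq_subr // /N; field.
Qed.

(** * Evaluation and linear parts of polynomials *)

Section Monomials.
Variable I : choiceType.
Implicit Types (k : cmonom I) (i : I).

Lemma cmonom_divK k i : i \in finsupp k -> k = mulcm (ucm i) (divcm k (ucm i)).
Proof.
move=> ik; apply/eqP/cmP => j; rewrite mulcmE divcmE ucmE.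
case: eqP => [<-|_]; last by rewrite subn0.
by rewrite subnKC // lt0n cmE_neq0.
Qed.

Lemma cmonom_ind (P : cmonom I -> Prop) :
  P (onecm I) -> (forall i k, P k -> P (mulcm (ucm i) k)) -> forall k, P k.
Proof.
move=> P1 PM k; have [n] := ubnP (mdeg k); elim: n k => // n IH k.
have [k0|/fset0Pn[i ik]] := eqVneq (finsupp k) fset0.
  suff -> : k = onecm I by [].
  by apply/eqP/cmP => j; rewrite onecmE; apply/eqP; rewrite cmE_eq0 k0.
rewrite (cmonom_divK ik) mdegM mdegU ltnS add1n => kn.
by apply: PM; apply: IH.
Qed.

Lemma mdeg1P k : mdeg k = 1%N -> exists i, k = ucm i.
Proof.
have [k0|/fset0Pn[i ik]] := eqVneq (finsupp k) fset0.
  by rewrite /mdeg k0 big_seq_fset0.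
rewrite (cmonom_divK ik) mdegM mdegU add1n => -[/mdeg_eq0I ->].
by exists i; rewrite [mulcm _ _]mulmC mul1m.
Qed.

Variables (S : comNzRingType) (x : I -> S).

Definition mon_eval k : S := \prod_(i <- finsupp k) x i ^+ k i.

Lemma mon_evalw (d : {fset I}) k :
  (finsupp k `<=` d)%fset -> mon_eval k = \prod_(i <- d) x i ^+ k i.
Proof.
move=> kd; rewrite /mon_eval (big_fset_incl _ kd) // => i _.
by rewrite -cmE_eq0 => /eqP ->; rewrite expr0.
Qed.

Lemma mon_eval1 : mon_eval (onecm I) = 1.
Proof. by rewrite /mon_eval mdom1 big_seq_fset0. Qed.

Lemma mon_evalM k1 k2 : mon_eval (mulcm k1 k2) = mon_eval k1 * mon_eval k2.
Proof.
rewrite [mon_eval k1](mon_evalw (fsubsetUl _ (finsupp k2))) [mon_eval k2](mon_evalw (fsubsetUr (finsupp k1) _)).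
rewrite /mon_eval mdomD -big_split /=.
by apply: eq_bigr => i _; rewrite mulcmE exprD.
Qed.

Lemma mon_evalU i : mon_eval (ucm i) = x i.
Proof. by rewrite /mon_eval mdomU big_seq_fset1 cmUU expr1. Qed.

Fact mon_eval_mmorphism : mmorphism mon_eval.
Proof. by split; [exact: mon_evalM|exact: mon_eval1]. Qed.
HB.instance Definition _ :=
  monalg.isMultiplicative.Build (cmonom I) S mon_eval mon_eval_mmorphism.

Variable cf : {rmorphism rat -> S}.

Fact peval_additive : {morph (peval cf x) : p q / p - q}.
Proof. exact: (raddfB (mmap cf mon_eval)). Qed.
Fact peval_multiplicative : multiplicative (peval cf x).
Proof.
split=> [p q|]; first exact: (rmorphM (mmap cf mon_eval)).
exact: (rmorph1 (mmap cf mon_eval)).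
Qed.
HB.instance Definition _ :=
  GRing.isAdditive.Build {malg rat[cmonom I]} S (peval cf x) peval_additive.
HB.instance Definition _ :=
  GRing.isMultiplicative.Build {malg rat[cmonom I]} S (peval cf x) peval_multiplicative.

Lemma pevalC c : peval cf x c%:MP = cf c.
Proof. exact: (mmapC (h := mon_eval)). Qed.

Lemma pevalU i : peval cf x << ucm i >> = x i.
Proof. by rewrite /peval mmapU /= rmorph1 mul1r [LHS]mon_evalU. Qed.

Lemma pevalE p : peval cf x p = \sum_(k <- msupp p) cf p@_k * mon_eval k.
Proof. by []. Qed.

End Monomials.

(** Statements compatible with sums and products then need checking only on constants and
    indeterminates. *)
Lemma malg_poly_ind (I : choiceType) (P : {malg rat[cmonom I]} -> Prop) :
  (forall c, P c%:MP) -> (forall i, P << ucm i >>) ->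
  (forall p q, P p -> P q -> P (p + q)) ->
  (forall p q, P p -> P q -> P (p * q)) -> forall p, P p.
Proof.
move=> PC PU PD PM p; rewrite (monalgE p).
elim/big_ind: _ => [| |k _]; first by rewrite -malgC0E; apply: PC.
  exact: PD.
have -> : << p@_k *g k >> = (p@_k)%:MP * << k >> :> {malg rat[cmonom I]}.
  by rewrite malgM_def fgmulUU mulr1 mul1m.
apply: (PM (p@_k)%:MP << k >> (PC _)); elim/cmonom_ind: k => [|i k IH].
  by rewrite -/(malgC _); apply: PC.
have -> : << mulcm (ucm i) k >> = << ucm i >> * << k >> :> {malg rat[cmonom I]}.
  by rewrite malgM_def fgmulUU mulr1.
exact: (PM << ucm i >> << k >> (PU i) IH).
Qed.

Lemma peval_comp (I : choiceType) (S T : comNzRingType) (f : {rmorphism S -> T})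
    (cf : rat -> S) (cg : rat -> T) (x : I -> S) p :
  (forall c, f (cf c) = cg c) ->
  f (peval cf x p) = peval cg (fun i => f (x i)) p.
Proof.
move=> fc; rewrite /peval /mmap raddf_sum; apply: eq_bigr => k _ /=.
rewrite rmorphM fc rmorph_prod; congr (_ * _).
by apply: eq_bigr => i _; rewrite rmorphXn.
Qed.

Lemma eq_peval (I : choiceType) (S : comNzRingType) (cf : rat -> S) (x y : I -> S) p :
  x =1 y -> peval cf x p = peval cf y p.
Proof. by move=> /funext ->. Qed.

(** * Linear parts, and the derivation acting on them *)

Section LinearPart.
Variables (I : choiceType) (z : I -> rat).

(** The substitution of [z_i X] grades polynomials by total degree, so the coefficient of [X] is the
    linear part at the point [z]. *)
Definition dual_eval (p : {malg rat[cmonom I]}) : {poly rat} :=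
  peval (@polyC rat) (fun i => (z i)%:P * 'X) p.
Fact dual_eval_additive : {morph dual_eval : p q / p - q}.
Proof. exact: (peval_additive _ (@polyC rat : {rmorphism _ -> _})). Qed.
Fact dual_eval_multiplicative : multiplicative dual_eval.
Proof. exact: (peval_multiplicative _ (@polyC rat : {rmorphism _ -> _})). Qed.
HB.instance Definition _ :=
  GRing.isAdditive.Build {malg rat[cmonom I]} {poly rat} dual_eval dual_eval_additive.
HB.instance Definition _ :=
  GRing.isMultiplicative.Build {malg rat[cmonom I]} {poly rat} dual_eval dual_eval_multiplicative.

Definition lin (p : {malg rat[cmonom I]}) : rat := (dual_eval p)`_1.

Lemma mon_eval_dual k :
  mon_eval (fun i => (z i)%:P * 'X) k = (mon_eval z k)%:P * 'X^(mdeg k).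
Proof.
elim/cmonom_ind: k => [|i k IH].
  by rewrite !mon_eval1 mdeg1 mulr1.
by rewrite !mon_evalM !mon_evalU IH mdegM mdegU exprD expr1 polyCM; ring.
Qed.

Lemma coef0_dual p : (dual_eval p)`_0 = p@_(onecm I).
Proof.
rewrite /dual_eval pevalE coef_sum [X in _ = X@__](monalgE p) raddf_sum /=.
apply: eq_bigr => k _; rewrite mon_eval_dual mcoeffU coefCM coefCM coefXn eq_sym mdeg_eq0.
by case: eqVneq => [->|_]; rewrite ?mon_eval1 ?mulr1 ?mulr0.
Qed.

Lemma linE p : lin p = \sum_(k <- msupp p) p@_k * ((mdeg k == 1%N)%:R * mon_eval z k).
Proof.
rewrite /lin /dual_eval pevalE coef_sum.
by apply: eq_bigr => k _; rewrite mon_eval_dual !coefCM coefXn eq_sym [in RHS](mulrC _%:R).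
Qed.

Fact lin_additive : {morph lin : p q / p - q}.
Proof. by move=> p q; rewrite /lin rmorphB coefB. Qed.
HB.instance Definition _ := GRing.isAdditive.Build {malg rat[cmonom I]} rat lin lin_additive.

Lemma linM p q : lin (p * q) = lin p * q@_(onecm I) + p@_(onecm I) * lin q.
Proof.
rewrite /lin rmorphM coefM !big_ord_recl big_ord0 addr0 /= /bump /=.
by rewrite -!coef0_dual addrC.
Qed.

Lemma linC c : lin c%:MP = 0.
Proof. by rewrite /lin /dual_eval pevalC coefC. Qed.

Lemma linU i : lin << ucm i >> = z i.
Proof. by rewrite /lin /dual_eval pevalU coefCM coefX mulr1. Qed.

Lemma linCM c p : lin (c%:MP * p) = c * lin p.
Proof. by rewrite linM linC mul0r add0r mcoeffC eqxx. Qed.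

End LinearPart.

Lemma lin_coef (I : choiceType) (i0 : I) p :
  lin (fun i => (i == i0)%:R) p = p@_(ucm i0).
Proof.
rewrite linE [X in _ = X@__](monalgE p) raddf_sum /=; apply: eq_bigr => k _.
rewrite mcoeffU; case: (eqVneq k (ucm i0)) => [->|ki0].
  by rewrite mdegU mon_evalU !eqxx !mulr1n !mulr1.
case: eqP => [/mdeg1P[i ik]|_]; last by rewrite mul0r mulr0.
rewrite ik mon_evalU; case: eqP => [ii0|_]; last by rewrite !mulr0.
by rewrite ik ii0 eqxx in ki0.
Qed.

(** The derivation preserves total degree: beyond degree one, each term keeps another factor besides
    [X_(i+1)], and the constant monomial gives an empty sum. *)
Lemma lin_Dmon (z : nat -> rat) (k : cmonom nat) :
  lin z (Dmon k) = (mdeg k == 1%N)%:R * mon_eval (fun i => z i.+1) k.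
Proof.
rewrite /Dmon raddf_sum /=.
have [k1|k1] := eqVneq (mdeg k) 1%N.
  have [i ->] := mdeg1P k1.
  rewrite mdomU big_seq_fset1 mon_evalU mul1r cmUU mul1r.
  have -> : divcm (ucm i) (ucm i) = onecm nat.
    by apply/eqP/cmP => j; rewrite divcmE subnn onecmE.
  by rewrite -/(malgC 1) mpolyC1E mul1r linU.
rewrite mul0r big_seq big1 // => i ik.
have v0 : (var i.+1)@_(onecm nat) = 0 by rewrite mcoeffU [_ == _]cm1_eq1.
have d0 : (<< divcm k (ucm i) >> : MP)@_(onecm nat) = 0.
  rewrite mcoeffU; case: eqP => // d1; case/eqP: k1.
  by rewrite (cmonom_divK ik) d1 [mulcm _ _]mulm1 mdegU.
rewrite linM v0 mulr0 add0r -mpolyC_nat mcoeffCM d0 mulr0.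
by rewrite mul0r.
Qed.

Lemma lin_Dder (z : nat -> rat) (p : MP) :
  lin z (Dder p) = lin (fun i => z i.+1) p.
Proof.
rewrite /Dder mmapE raddf_sum linE /=; apply: eq_bigr => k _.
by rewrite linCM lin_Dmon.
Qed.

Lemma mcoeff1M (I : choiceType) (p q : {malg rat[cmonom I]}) :
  (p * q)@_(onecm I) = p@_(onecm I) * q@_(onecm I).
Proof. by rewrite -!(coef0_dual (fun=> 0)) rmorphM coef0M. Qed.

Lemma mcoeff1_Dder (p : MP) : (Dder p)@_(onecm nat) = 0.
Proof.
rewrite /Dder mmapE raddf_sum big1 // => k _ /=.
rewrite mcoeff1M /Dmon raddf_sum big1 ?mulr0 // => i _ /=.
by rewrite mcoeff1M [X in _ * X]mcoeffU [_ == _]cm1_eq1 mulr0.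
Qed.

Lemma PpolySE m : Ppoly m.+2 = Dder (Ppoly m.+1) - 3%:R * var 0 * Ppoly m.+1.
Proof. by []. Qed.

Lemma mcoeff1_Ppoly m : (Ppoly m)@_(onecm nat) = 0.
Proof.
case: m => [|m]; first exact: mcoeff0.
elim: m => [|m IH]; first by rewrite mcoeffU [_ == _]cm1_eq1.
by rewrite PpolySE raddfB /= mcoeff1_Dder mcoeff1M IH mulr0 subr0.
Qed.

(** The summand [3 X_0 P_m] starts in degree two, so linear parts see only the derivation, which
    shifts the index. *)
Lemma lin_Ppoly z m : lin z (Ppoly m.+1) = z m.
Proof.
elim: m z => [|m IH] z; first exact: linU.
rewrite PpolySE; have := mcoeff1_Ppoly m.+1; have := IH (fun i => z i.+1).
move: (Ppoly m.+1) => P LP P1; rewrite raddfB /= lin_Dder LP linM P1 mulr0 add0r.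
by rewrite mcoeff1M [(var 0)@__]mcoeffU [_ == _]cm1_eq1 mulr0 mul0r subr0.
Qed.

(** * Bernoulli numbers and Faulhaber polynomials *)

Section Symmetric.
Variable A : comNzRingType.
Hypothesis half : exists h : A, 2%:R * h = 1.
Implicit Types (T E q : {poly A}).

Let refl : {poly A} := 1 - 'X.

Lemma horner_comp_refl T x : (T \Po refl).[x] = T.[1 - x].
Proof. by rewrite horner_comp /refl !hornerE. Qed.

(** [E - E(0)] vanishes at 0, hence by symmetry at 1, and is therefore a multiple of the invariant
    monic polynomial [X^2 - X]; the quotient is again symmetric. The size bound allows one odd
    degree too many, which symmetry rules out in the base case. *)
Lemma symmetric_decomp n E : (size E <= n.*2.+2)%N -> E \Po refl = E ->
  exists S : nat -> A, E = \sum_(i < n.+1) (S i)%:P * ('X^2 - 'X) ^+ i.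
Proof.
elim: n E => [|n IH] E sE symE.
  exists (fun=> E`_0); rewrite big_ord1 expr0 mulr1.
  have e : E`_0 + E`_1 = E`_0.
    have := horner_comp_refl E 0; rewrite symE subr0 !(horner_coef_wide _ sE).
    by rewrite !big_ord_recl !big_ord0 /= !expr0 !expr1n expr0n !(mulr1, mulr0, addr0).
  have e1 : E`_1 = 0 by apply: (addrI E`_0); rewrite e addr0.
  apply/polyP => -[|[|i]]; rewrite coefC //=.
  by rewrite nth_default // (leq_trans sE).
pose c := E.[0].
have [q Eq] : exists q, E - c%:P = q * ('X - 0%:P).
  by apply/factor_theorem; rewrite /root !hornerE subrr.
have q1 : q.[1] = 0.
  have := congr1 (fun p : {poly A} => p.[1]) Eq.
  rewrite !hornerE subr0 mulr1 => <-.
  by rewrite -[X in X.[1]]symE horner_comp_refl !subrr.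
have [q2 q2E] : exists q2, q = q2 * ('X - 1%:P) by apply/factor_theorem/eqP.
pose v : {poly A} := 'X^2 - 'X.
have EE : E = c%:P + q2 * v.
  apply/eqP; rewrite -subr_eq0; apply/eqP.
  transitivity (E - c%:P - q2 * v); first by ring.
  by rewrite Eq q2E /v polyC0 polyC1; ring.
have vm : v \is monic.
  by rewrite /v monicE lead_coefDl ?lead_coefXn // size_polyN size_polyX size_polyXn.
have sv : size v = 3%N by rewrite /v size_polyDl ?size_polyXn // size_polyN size_polyX.
have vrefl : v \Po refl = v.
  by rewrite /v expr2 comp_polyB comp_polyM comp_polyX /refl; ring.
have sq : (size q2 <= n.*2.+2)%N.
  have [->|q20] := eqVneq q2 0; first by rewrite size_poly0.
  have : (size (q2 * v)%R <= n.*2.+4)%N.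
    have -> : q2 * v = E - c%:P by rewrite EE; ring.
    apply: leq_trans (size_polyD _ _) _; rewrite geq_max sE size_polyN.
    by rewrite (leq_trans (size_polyC_leq1 _)).
  by rewrite size_Mmonic // sv addn3.
have symq : q2 \Po refl = q2.
  apply: (monic_rreg vm); rewrite -{1}vrefl -comp_polyM.
  have -> : q2 * v = E - c%:P by rewrite EE; ring.
  by rewrite comp_polyB comp_polyC symE.
have [S SE] := IH q2 sq symq.
exists (fun i => if i is i'.+1 then S i' else c).
rewrite big_ord_recl expr0 mulr1 EE SE mulr_suml; congr (_ + _).
by apply: eq_bigr => i _; rewrite -mulrA -exprSr.
Qed.

(** An antisymmetric polynomial vanishes at the fixed point [h = 1/2]; since [X - h] is itself
    antisymmetric, the quotient is symmetric. *)
Lemma antisymmetric_decomp n T : (size T <= n.*2.+3)%N -> T \Po refl = - T ->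
  exists S : nat -> A,
    T = (2%:R * 'X - 1) * \sum_(i < n.+1) (S i)%:P * ('X^2 - 'X) ^+ i.
Proof.
move=> sT antiT; have [h h2] := half.
have Th : T.[h] = 0.
  have e : T.[h] = - T.[h].
    rewrite -hornerN -antiT horner_comp_refl; congr (_.[_]).
    by rewrite -h2; ring.
  have : 2%:R * T.[h] = 0 by rewrite mulr_natl mulr2n {2}e subrr.
  by move/(congr1 ( *%R h)); rewrite mulr0 mulrA [h * _]mulrC h2 mul1r.
have [q Tq] : exists q, T = q * ('X - h%:P) by apply/factor_theorem/eqP.
have sq : (size q <= n.*2.+2)%N.
  have [->|q0] := eqVneq q 0; first by rewrite size_poly0.
  by move: sT; rewrite Tq size_Mmonic ?monicXsubC // size_XsubC addn2.
have h2P : 2%:R * h%:P = 1 :> {poly A} by rewrite -(rmorph_nat polyC) -polyCM h2.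
have symq : q \Po refl = q.
  apply: (monic_rreg (monicXsubC h)).
  have : (q \Po refl) * (('X - h%:P) \Po refl) = - (q * ('X - h%:P)).
    by rewrite -comp_polyM -Tq.
  have -> : ('X - h%:P) \Po refl = - ('X - h%:P).
    by rewrite comp_polyB comp_polyX comp_polyC /refl -{1}h2P; ring.
  by rewrite mulrN => /oppr_inj.
have [S SE] := symmetric_decomp sq symq.
exists (fun i => h * S i); rewrite Tq SE mulr_suml mulr_sumr.
apply: eq_bigr => i _; rewrite polyCM -{2}h2P.
transitivity ((2%:R * h%:P) * ((S i)%:P * ('X^2 - 'X) ^+ i * ('X - h%:P))).
  by rewrite h2P mul1r.
by ring.
Qed.
End Symmetric.

Lemma poly_eq_nat (p q : {poly rat}) :
  (forall j : nat, (0 < j)%N -> p.[j%:R] = q.[j%:R]) -> p = q.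
Proof.
move=> pq; apply/eqP; rewrite -subr_eq0; apply: contraT => pq0.
pose s := [seq j%:R : rat | j <- iota 1 (size (p - q))].
have := max_poly_roots pq0 (rs := s); rewrite size_map size_iota ltnn; apply.
  apply/allP => x /mapP[j]; rewrite mem_iota => /andP[j0 _] ->.
  by rewrite /root !hornerE pq // subrr.
rewrite map_inj_uniq ?iota_uniq // => i j /eqP.
by rewrite eqr_nat => /eqP.
Qed.

Lemma size_bern_upto m : size (bern_upto m) = m.+1.
Proof. by elim: m => //= m IH; rewrite size_rcons IH. Qed.

Lemma nth_bern_upto m k : (k <= m)%N -> (bern_upto m)`_k = bernoulli k.
Proof.
elim: m => [|m IH]; first by rewrite leqn0 => /eqP ->.
rewrite leq_eqVlt => /orP[/eqP ->//|]; rewrite ltnS => km.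
by rewrite /= nth_rcons size_bern_upto ltnS km IH.
Qed.

Lemma bernoulli0 : bernoulli 0 = 1. Proof. by []. Qed.

Lemma bernoulliS m :
  bernoulli m.+1 = - (\sum_(k < m.+1) 'C(m.+2, k)%:R * bernoulli k) / m.+2%:R.
Proof.
rewrite /bernoulli /= nth_rcons size_bern_upto ltnn eqxx; congr (- _ / _).
by apply: eq_bigr => k _; rewrite nth_bern_upto // -ltnS.
Qed.

Lemma sum_bernoulli m :
  \sum_(k < m.+1) 'C(m.+1, k)%:R * bernoulli k = (m == 0%N)%:R.
Proof.
case: m => [|m]; first by rewrite big_ord1 bin0 mul1r.
rewrite big_ord_recr /= bernoulliS -[m.+2]/(m.+1.+1) binSn.
rewrite mulrC divfK ?pnatr_eq0 //; exact: subrr.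
Qed.

Lemma bernoulli1 : bernoulli 1 = - (1 / 2%:R).
Proof. by rewrite bernoulliS big_ord1 bernoulli0 bin0 mulNr. Qed.

(** With [B_1 = - 1/2] this is the sum of [i^r] over [0 <= i < j], without the term [i = j]: the
    range of the product [G]. *)
Definition faulhaber (r : nat) : {poly rat} :=
  \sum_(k < r.+1) ('C(r.+1, k)%:R * bernoulli k / r.+1%:R) *: 'X^(r.+1 - k).

Lemma coef_faulhaber r m : (m <= r)%N ->
  (faulhaber r)`_m.+1 = 'C(r.+1, m.+1)%:R * bernoulli (r - m) / r.+1%:R.
Proof.
move=> mr; rewrite /faulhaber coef_sum.
have rm : (r - m < r.+1)%N by rewrite ltnS leq_subr.
rewrite (bigD1 (Ordinal rm)) //= coefZ coefXn big1 ?addr0.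
  have -> : (r.+1 - (r - m) = m.+1)%N by lia.
  have -> : (r - m = r.+1 - m.+1)%N by lia.
  by rewrite eqxx mulr1 bin_sub.
move=> k km; rewrite coefZ coefXn; case: eqP; rewrite ?mulr0 // => e.
by case/eqP: km; apply: val_inj => /=; have := ltn_ord k; lia.
Qed.

Lemma faulhaber_coef0 r : (faulhaber r)`_0 = 0.
Proof.
rewrite /faulhaber coef_sum big1 // => k _; rewrite coefZ coefXn.
by case: eqP; rewrite ?mulr0 //; have := ltn_ord k; lia.
Qed.

Lemma faulhaber_coef1 r : (faulhaber r)`_1 = bernoulli r.
Proof.
by rewrite coef_faulhaber // subn0 bin1 mulrAC mulfV ?pnatr_eq0 // mul1r.
Qed.

Lemma faulhaber_coef2 r :
  (faulhaber r.+1)`_2 = r.+1%:R / 2%:R * bernoulli r.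
Proof.
rewrite coef_faulhaber // subSS subn0.
have e : 'C(r.+2, 2)%:R = r.+2%:R * r.+1%:R / 2%:R :> rat.
  apply: (canRL (mulfK _)); rewrite // -!natrM mulnC.
  by have := mul_bin_diag r.+2 1; rewrite /= bin1 => ->.
have r2 : r.+2%:R != 0 :> rat by rewrite pnatr_eq0.
rewrite e; move: r2 (bernoulli r); move: (r.+2%:R) (r.+1%:R) => a b a0 c.
by field.
Qed.

Lemma size_faulhaber r : (size (faulhaber r) <= r.+2)%N.
Proof.
apply: leq_trans (size_sum _ _ _) _; apply/bigmax_leqP => k _.
by rewrite (leq_trans (size_scale_leq _ _)) // size_polyXn ltnS leq_subr.
Qed.

(** After the binomial theorem and the exchange [C(r+1,k) C(r+1-k,i) = C(r+1,i) C(r+1-i,k)], the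
    inner sum over [k] is the defining relation of the Bernoulli numbers, which leaves only
    [i = r]. *)
Lemma faulhaber_step r (x : rat) :
  (faulhaber r).[x + 1] - (faulhaber r).[x] = x ^+ r.
Proof.
have r0 : r.+1%:R != 0 :> rat by rewrite pnatr_eq0.
apply: (mulfI r0); rewrite /faulhaber !horner_sum -sumrB mulr_sumr.
transitivity (\sum_(k < r.+1) \sum_(i < r.+1 | (i < r.+1 - k)%N)
     ('C(r.+1, i)%:R * x ^+ i) * ('C(r.+1 - i, k)%:R * bernoulli k)).
  apply: eq_bigr => k _; rewrite !hornerZ !hornerXn -mulrBr mulrCA.
  have -> (z : rat) : 'C(r.+1, k)%:R * bernoulli k / r.+1%:R * (r.+1%:R * z)
      = 'C(r.+1, k)%:R * bernoulli k * z.
    by move: r0 (bernoulli k) ('C(r.+1, k)%:R); move: (r.+1%:R) => a a0 b c; field.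
  rewrite [x + 1]addrC exprDn big_ord_recr /= subnn expr0 mul1r binn mulr1n addrK.
  rewrite (big_ord_widen r.+1 (fun i => 1 ^+ (r.+1 - k - i) * x ^+ i *+ 'C(r.+1 - k, i))); last exact: leq_subr.
  rewrite mulr_sumr; apply: eq_bigr => i ik; rewrite expr1n mul1r -[x ^+ i *+ _]mulr_natl.
  have e : ('C(r.+1, k) * 'C(r.+1 - k, i) = 'C(r.+1, i) * 'C(r.+1 - i, k))%N.
    have f0 (n : nat) : (0 < n`!)%N by exact: fact_gt0.
    apply/eqP; rewrite -(eqn_pmul2r (f0 k)) -(eqn_pmul2r (f0 i)) -(eqn_pmul2r (f0 (r.+1 - k - i)%N)).
    have ki : (k <= r.+1)%N by have := ltn_ord k; lia.
    have ki' : (i <= r.+1 - k)%N by lia.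
    have ii : (i <= r.+1)%N by lia.
    have ii' : (k <= r.+1 - i)%N by lia.
    have b1 := bin_fact ki; have b2 := bin_fact ki'.
    have b3 := bin_fact ii; have b4 := bin_fact ii'.
    have e : (r.+1 - i - k = r.+1 - k - i)%N by lia.
    rewrite e in b4; apply/eqP.
    transitivity ('C(r.+1, k) * (k`! * ('C(r.+1 - k, i) * (i`! * (r.+1 - k - i)`!))))%N; first by ring.
    rewrite b2 b1 -b3 -b4; ring.
  have -> : 'C(r.+1, k)%:R * bernoulli k * ('C(r.+1 - k, i)%:R * x ^+ i)
    = ('C(r.+1, k) * 'C(r.+1 - k, i))%:R * x ^+ i * bernoulli k by rewrite natrM; ring.
  by rewrite e natrM; ring.
rewrite (exchange_big_dep predT) //=.
transitivity (\sum_(i < r.+1) 'C(r.+1, i)%:R * x ^+ i * (i == r :> nat)%:R).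
  apply: eq_bigr => i _; rewrite -mulr_sumr; congr (_ * _).
  have ir : (r.+1 - i = (r - i).+1)%N by have := ltn_ord i; lia.
  rewrite (eq_bigl (fun k : 'I_r.+1 => (k < r.+1 - i)%N)); last first.
    by move=> k; have := ltn_ord k; have := ltn_ord i; lia.
  rewrite -(big_ord_widen r.+1 (fun k => 'C(r.+1 - i, k)%:R * bernoulli k)) ?leq_subr //.
  rewrite ir sum_bernoulli; congr (_%:R); have := ltn_ord i.
  by case: eqP; case: eqP => //; lia.
rewrite big_ord_recr /= eqxx mulr1 big1 ?add0r ?binSn // => i _.
by case: eqP; rewrite ?mulr0 //; have := ltn_ord i; lia.
Qed.

Lemma faulhaber_horner0 r : (faulhaber r).[0] = 0.
Proof. by rewrite horner_coef0 faulhaber_coef0. Qed.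

Lemma faulhaber_sum r (j : nat) : (faulhaber r).[j%:R] = \sum_(i < j) i%:R ^+ r.
Proof.
elim: j => [|j IH]; first by rewrite faulhaber_horner0 big_ord0.
by rewrite big_ord_recr /= -IH -[j.+1]addn1 natrD -(faulhaber_step r j%:R) addrC subrK.
Qed.

(** Both sides satisfy the same difference equation. They agree at 0 because the exponent is
    positive; for exponent 0 the convention [0^0 = 1] would break this. *)
Lemma faulhaber_refl r :
  faulhaber r.+1 \Po (1 - 'X) = (-1) ^+ r *: faulhaber r.+1.
Proof.
apply: poly_eq_nat => j _; rewrite horner_comp hornerZ !hornerE.
elim: j => [|j IH].
  have := faulhaber_step r.+1 0; rewrite add0r expr0n subr0 /= => /eqP.
  by rewrite subr_eq0 => /eqP ->; rewrite faulhaber_horner0 mulr0.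
rewrite -natr1; move: (j%:R : rat) IH => y IH.
have e1 : (faulhaber r.+1).[1 - y] - (faulhaber r.+1).[- y] = (-1) ^+ r.+1 * y ^+ r.+1.
  by rewrite -exprNn -faulhaber_step [- y + 1]addrC.
have e2 := faulhaber_step r.+1 y.
have -> : 1 - (y + 1) = - y by ring.
have -> : (faulhaber r.+1).[- y] = (-1) ^+ r * (faulhaber r.+1).[y] - (-1) ^+ r.+1 * y ^+ r.+1.
  by rewrite -e1 IH; ring.
by rewrite -[(faulhaber r.+1).[y + 1]](subrK (faulhaber r.+1).[y]) e2 exprS; ring.
Qed.

Lemma coef1_compN (q : {poly rat}) : (q \Po (- 'X))`_1 = - q`_1.
Proof.
elim/poly_ind: q => [|q c _]; first by rewrite comp_poly0 !coef0 oppr0.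
rewrite comp_poly_MXaddC mulrN !coefD coefN !coefMX !coefC /= !addr0; congr (- _).
by rewrite -!horner_coef0 horner_comp hornerN hornerX oppr0.
Qed.

(** For an odd exponent the Faulhaber polynomial [f] is invariant under [X -> 1 - X], while the
    difference equation turns [f(1 - X)] into [f(-X)] plus a monomial of degree at least 3. Linear
    coefficients then give [B = - B]. *)
Lemma bernoulli_odd r : bernoulli r.*2.+3 = 0.
Proof.
pose s := r.*2.+2; pose f := faulhaber s.+1.
have step : f \Po (1 - 'X) = (f \Po (- 'X)) + (- 'X) ^+ s.+1.
  apply: poly_eq_nat => j _; rewrite hornerD !horner_comp horner_exp !hornerE.
  by rewrite -(faulhaber_step s.+1 (- j%:R)) -/f [- _ + 1]addrC [RHS]addrC subrK.
have := congr1 (fun q : {poly rat} => q`_1) step.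
rewrite /f faulhaber_refl coefZ coefD coef1_compN [(- 'X) ^+ _]exprNn.
rewrite -/s faulhaber_coef1 -/s.
have -> : ((-1) ^+ s : rat) = 1 by rewrite /s -signr_odd /= negbK odd_double.
have -> : ((-1) ^+ s.+1 * 'X^(s.+1) : {poly rat})`_1 = 0.
  by rewrite -signr_odd /= /s /= negbK odd_double expr1 mulN1r coefN coefXn oppr0.
by rewrite mul1r; lra.
Qed.

(** * Existence of the polynomials S_i(n) *)

Lemma coef_expr_lt (A : comNzRingType) (c : {poly A}) n k : c`_0 = 0 -> (k < n)%N -> (c ^+ n)`_k = 0.
Proof.
move=> c0; elim: n k => // n IH k kn; rewrite exprS coefM big1 // => -[[|i] ik] _ /=.
  by rewrite c0 mul0r.
by rewrite IH ?mulr0 //; lia.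
Qed.

Section Truncated.
Variable N : nat.
Implicit Types (f g c m : {poly MP}).

Definition eqm f g := forall k, (k <= N)%N -> f`_k = g`_k.

Lemma eqmM f f' g g' : eqm f f' -> eqm g g' -> eqm (f * g) (f' * g').
Proof.
move=> ff gg k kN; rewrite !coefM; apply: eq_bigr => i _.
by rewrite ff ?gg // (leq_trans _ kN) ?leq_subr // -ltnS.
Qed.

(** Unlike the derivative, the Euler operator preserves congruence modulo [X^(N+1)]. *)
Definition xd f : {poly MP} := 'X * f^`().

Lemma coef_xd f k : (xd f)`_k = k%:R * f`_k.
Proof.
rewrite /xd coefXM; case: k => [|k] /=; first by rewrite mul0r.
by rewrite coef_deriv mulr_natl.
Qed.

Lemma xdM f g : xd (f * g) = xd f * g + f * xd g.
Proof. by rewrite /xd derivM; ring. Qed.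

Lemma eqm_xd f g : eqm f g -> eqm (xd f) (xd g).
Proof. by move=> fg k kN; rewrite !coef_xd fg. Qed.

(** [m] is the logarithmic derivative [x f' / f], written without division. *)
Definition logder f m := eqm (xd f) (f * m).

Lemma logderM f g m m' : logder f m -> logder g m' -> logder (f * g) (m + m').
Proof.
move=> fm gm k kN; rewrite xdM mulrDr coefD coefD; congr (_ + _).
  rewrite (_ : f * g * m = (f * m) * g); last by ring.
  exact: eqmM fm (fun _ _ => erefl) k kN.
by rewrite -mulrA; apply: eqmM (fun _ _ => erefl) gm k kN.
Qed.

Lemma logder1 : logder 1 0.
Proof. by move=> k _; rewrite mulr0 /xd derivC mulr0. Qed.

Lemma logder_prod (I : Type) (s : seq I) (f m : I -> {poly MP}) :
  (forall i, logder (f i) (m i)) -> logder (\prod_(i <- s) f i) (\sum_(i <- s) m i).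
Proof.
move=> fm; elim/big_rec2: _ => [|i g h _ hg]; first exact: logder1.
exact: logderM.
Qed.

Lemma inv1pP c : c`_0 = 0 -> eqm ((1 + c) * inv1p N c) 1.
Proof.
move=> c0 k kN; have e : (1 + c) * inv1p N c = 1 - (- c) ^+ N.+1.
  by rewrite -[RHS]opprB subrX1 /inv1p -mulNr; congr (_ * _); ring.
by rewrite e coefB coef_expr_lt ?subr0 // coefN c0 oppr0.
Qed.

Lemma inv1p_coef0 c : c`_0 = 0 -> (inv1p N c)`_0 = 1.
Proof.
move=> c0; have := inv1pP c0 (leq0n N).
by rewrite coef0M coefD c0 addr0 coef1 mul1r.
Qed.

Lemma logder_inv1p c : c`_0 = 0 -> logder (inv1p N c) (- xd c * inv1p N c).
Proof.
move=> c0; set J := inv1p N c.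
have e1 : eqm ((1 + c) * J) 1 := inv1pP c0.
have e2 k : (k <= N)%N -> (J * (xd c * J + (1 + c) * xd J))`_k = 0.
  move=> kN; have e3 : eqm (xd c * J + (1 + c) * xd J) 0.
    move=> i iN; have := eqm_xd e1 iN.
    have -> : xd 1 = 0 by rewrite /xd derivC mulr0.
    have -> : xd ((1 + c) * J) = xd c * J + (1 + c) * xd J; last by [].
    by rewrite xdM; congr (_ * _ + _); rewrite /xd derivD derivC add0r.
  by have := eqmM (fun _ _ => erefl (J`__)) e3 kN; rewrite mulr0 coef0.
move=> k kN.
have : ((1 + c) * J * xd J)`_k = (xd J)`_k.
  by have := eqmM e1 (fun _ _ => erefl ((xd J)`__)) kN; rewrite mul1r.
move=> <-; apply/eqP; rewrite -subr_eq0 -coefB -[X in _ == X](e2 k kN); apply/eqP.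
suff -> : (1 + c) * J * xd J - J * (- xd c * J) = J * (xd c * J + (1 + c) * xd J) by [].
by ring.
Qed.

Lemma logder_1p c : c`_0 = 0 -> logder (1 + c) (xd c * inv1p N c).
Proof.
move=> c0 k kN.
have -> : xd (1 + c) = 1 * xd c by rewrite mul1r /xd derivD derivC add0r.
rewrite (_ : (1 + c) * _ = (1 + c) * inv1p N c * xd c); last by ring.
exact/esym/(eqmM (inv1pP c0) (fun _ _ => erefl)).
Qed.

Lemma coef_inv1p_lin (i : MP) r : (r <= N)%N ->
  (inv1p N ('X * i%:P))`_r = (- i) ^+ r.
Proof.
move=> rN; rewrite /inv1p coef_sum.
have rN' : (r < N.+1)%N by [].
have e k : (- ('X * i%:P)) ^+ k = ((- i) ^+ k)%:P * 'X^k.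
  by rewrite -mulrN -polyCN exprMn mulrC polyC_exp.
rewrite (bigD1 (Ordinal rN')) //= e coefCM coefXn eqxx mulr1 big1 ?addr0 // => k kr.
rewrite e coefCM coefXn; case: eqP => [rk|]; rewrite ?mulr0 //.
by case/eqP: kr; apply: val_inj.
Qed.

Lemma logder_rec f m k : logder f m -> m`_0 = 0 -> (k < N)%N ->
  k.+1%:R * f`_k.+1 = \sum_(r < k.+1) m`_r.+1 * f`_(k - r).
Proof.
move=> fm m0 kN; rewrite -coef_xd fm // mulrC coefM big_ord_recl m0 mul0r add0r.
by apply: eq_bigr => r _; rewrite subSS.
Qed.

End Truncated.

Lemma mulfI_linv (A : pzRingType) (c a x y : A) : c * a = 1 -> a * x = a * y -> x = y.
Proof. by move=> ca /(congr1 ( *%R c)); rewrite !mulrA ca !mul1r. Qed.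

Lemma MP_natr_inj k (x y : MP) : k.+1%:R * x = k.+1%:R * y -> x = y.
Proof.
have e : (k.+1%:R^-1)%:MP * k.+1%:R = 1 :> MP.
  by rewrite -mpolyC_nat -mpolyCM mulVf ?pnatr_eq0 // mpolyC1E.
exact: mulfI_linv e.
Qed.

Section Newton.
Variable mu : nat -> {poly MP}.

Fixpoint newton_upto (n : nat) : seq {poly MP} :=
  if n is n'.+1 then
    let s := newton_upto n' in
    rcons s (((n'.+1%:R^-1)%:MP)%:P * \sum_(r < n'.+1) mu r.+1 * s`_(n' - r))
  else [:: 1].

Definition newton (n : nat) : {poly MP} := (newton_upto n)`_n.

Lemma size_newton_upto n : size (newton_upto n) = n.+1.
Proof. by elim: n => //= n IH; rewrite size_rcons IH. Qed.

Lemma nth_newton_upto n k : (k <= n)%N -> (newton_upto n)`_k = newton k.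
Proof.
elim: n => [|n IH]; first by rewrite leqn0 => /eqP ->.
rewrite leq_eqVlt => /orP[/eqP -> //|]; rewrite ltnS => kn.
by rewrite /= nth_rcons size_newton_upto ltnS kn IH.
Qed.

Lemma newtonS n : newton n.+1 =
  ((n.+1%:R^-1)%:MP)%:P * \sum_(r < n.+1) mu r.+1 * newton (n - r).
Proof.
rewrite /newton /= nth_rcons size_newton_upto ltnn eqxx; congr (_ * _).
by apply: eq_bigr => r _; rewrite nth_newton_upto // leq_subr.
Qed.

(** A weight count: [mu r] may have degree [2 r] in [j], and the indices in each product add up to
    the index of the coefficient. *)
Lemma size_newton : (forall r, (size (mu r.+1) <= r.+1.*2.+1)%N) ->
  forall n, (size (newton n) <= n.*2.+1)%N.
Proof.
move=> smu n; have [m] := ubnP n; elim: m n => // m IH [|n] nm.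
  by rewrite /newton /= size_poly1.
rewrite newtonS mul_polyC; apply: leq_trans (size_scale_leq _ _) _.
apply: leq_trans (size_sum _ _ _) _; apply/bigmax_leqP => r _.
apply: leq_trans (size_polyMleq _ _) _.
have := smu r; have rn : (n - r < m)%N by rewrite (leq_ltn_trans (leq_subr _ _)).
have := IH _ rn; have := ltn_ord r; move: (size _) (size _) => x y; lia.
Qed.

Lemma newton_eval (x : MP) (N : nat) (a M : nat -> MP) :
  a 0%N = 1 -> (forall r, (r < N)%N -> M r.+1 = (mu r.+1).[x]) ->
  (forall k, (k < N)%N -> k.+1%:R * a k.+1 = \sum_(r < k.+1) M r.+1 * a (k - r)%N) ->
  forall k, (k <= N)%N -> a k = (newton k).[x].
Proof.
move=> a0 Mx aS k; have [n] := ubnP k; elim: n k => // n IH [|k] kn kN.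
  by rewrite a0 /newton /= hornerC.
have e : k.+1%:R * (k.+1%:R^-1)%:MP = 1 :> MP.
  by rewrite -mpolyC_nat -mpolyCM mulfV ?pnatr_eq0 // mpolyC1E.
apply: (@MP_natr_inj k); rewrite aS // newtonS hornerM hornerC mulrA e mul1r horner_sum.
apply: eq_bigr => r _; rewrite hornerM Mx; last by rewrite (leq_trans _ kN).
have kr := leq_subr r k; rewrite -IH //; first exact: leq_ltn_trans kr kn.
exact: leq_trans kr (ltnW kN).
Qed.

End Newton.

Section LogCoefficients.
Variables (A : comNzRingType) (cf : {rmorphism rat -> A}) (c : nat -> A).

Definition faul (r : nat) : {poly A} := map_poly (cf) (faulhaber r).

(* The [r]-th power sum, as a polynomial in [j]: [mu r.[j]] is the coefficient
   of [x^r] in [x G'(x) / G(x)] when [c] is that of [x F'(x) / (1 + F(x))],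
   [F = a(x) x^2]. *)
Definition mu (r : nat) : {poly A} :=
  (-1) ^+ r * faul r + (c r)%:P * 'X.

Lemma size_mu r : (size (mu r.+1) <= r.+1.*2.+1)%N.
Proof.
apply: leq_trans (size_polyD _ _) _; rewrite geq_max; apply/andP; split.
  have -> : (-1) ^+ r.+1 * faul r.+1 = (-1) ^+ r.+1 *: faul r.+1.
    by rewrite -mul_polyC polyC_exp polyCN polyC1.
  apply: leq_trans (size_scale_leq _ _) _; apply: leq_trans (size_poly _ _) _.
  by apply: leq_trans (size_faulhaber _) _; lia.
apply: leq_trans (size_polyMleq _ _) _; rewrite size_polyX addn2 /=.
by apply: leq_trans (_ : 2 <= _)%N; rewrite ?ltnS ?size_polyC_leq1 //; lia.
Qed.

Lemma faul_nat r (j : nat) :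
  (faul r).[j%:R] = \sum_(i < j) i%:R ^+ r.
Proof.
rewrite -(rmorph_nat cf) /faul horner_map /= faulhaber_sum raddf_sum.
by apply: eq_bigr => i _; rewrite /= rmorphXn rmorph_nat.
Qed.

Lemma faul_refl r (j : nat) :
  (faul r.+1).[1 - j%:R] = (-1) ^+ r * \sum_(i < j) i%:R ^+ r.+1.
Proof.
have -> : 1 - j%:R = cf (1 - j%:R) :> A by rewrite rmorphB rmorph1 rmorph_nat.
rewrite /faul horner_map /=.
have -> : (faulhaber r.+1).[1 - j%:R] = (-1) ^+ r * (faulhaber r.+1).[j%:R].
  by rewrite -hornerZ -faulhaber_refl horner_comp !hornerE.
rewrite rmorphM rmorphXn rmorphN rmorph1 /=; congr (_ * _).
by rewrite faulhaber_sum raddf_sum; apply: eq_bigr => i _; rewrite /= rmorphXn rmorph_nat.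
Qed.

Lemma hornerXpN1 r x : ((-1) ^+ r : {poly A}).[x] = (-1) ^+ r.
Proof. by rewrite horner_exp hornerN hornerC. Qed.

Lemma mu_nat r (j : nat) :
  (mu r).[j%:R] = \sum_(i < j) (- i%:R) ^+ r + j%:R * c r.
Proof.
rewrite /mu hornerD hornerM hornerXpN1 faul_nat hornerM hornerC hornerX.
rewrite mulr_sumr; congr (_ + _); last exact: mulrC.
by apply: eq_bigr => i _; rewrite [RHS]exprNn.
Qed.

(** The reason why [H] is [G] at [1 - j]: reflection turns the power sums of the factors
    [1 / (1 + i x)], [i < j], into those of the factors [1 - l x], [1 <= l < j], and the exponent
    [j] of [1 + a(x) x^2] into [1 - j]. *)
Lemma mu_refl r (j : nat) : (0 < j)%N ->
  (mu r.+1).[1 - j%:R] =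
  \sum_(1 <= l < j) - (l%:R ^+ r.+1) - (j - 1)%:R * c r.+1.
Proof.
move=> j0; rewrite /mu hornerD hornerM hornerXpN1 faul_refl hornerM hornerC hornerX.
rewrite -(big_mkord predT (fun i : nat => (i%:R : A) ^+ r.+1)) big_ltn // expr0n add0r.
rewrite sumrN natrB //; set S := \sum_(_ <= _ < _) _.
have -> (s d x : A) : (-1) ^+ r.+1 * ((-1) ^+ r * s) + d * x = (-1) ^+ (r + r) * - s + d * x.
  by rewrite exprD exprS; ring.
by rewrite addnn -signr_odd odd_double expr0; ring.
Qed.

End LogCoefficients.

Lemma coef0_prod (A : comNzRingType) (I : Type) (s : seq I) (f : I -> {poly A}) :
  (forall i, (f i)`_0 = 1) -> (\prod_(i <- s) f i)`_0 = 1.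
Proof.
move=> f1; elim/big_rec: _ => [|i g _ g1]; first by rewrite coef1.
by rewrite coef0M f1 g1 mulr1.
Qed.

Section Coefficients.
Variable N : nat.

Let F : {poly MP} := ax N * 'X^2.

Lemma coef_axX2 k : (ax N * 'X^2)`_k = if (1 < k < N.+3)%N then var (k - 2) else 0.
Proof.
rewrite coefMXn; case: k => [|[|k]] //=.
by rewrite coef_poly !subSS !subn0 !ltnS.
Qed.

Lemma coef0_axX2 : F`_0 = 0.
Proof. by rewrite coef_axX2. Qed.

Definition clog (r : nat) : MP := (xd (ax N * 'X^2) * inv1p N (ax N * 'X^2))`_r.

Lemma coef0_Xnat (x : MP) : ('X * x%:P)`_0 = 0.
Proof. by rewrite coefXM. Qed.

Lemma xd_Xnat (x : MP) : xd ('X * x%:P) = 'X * x%:P.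
Proof. by rewrite /xd derivM derivX derivC; ring. Qed.

Lemma Gser_newton j k : (k <= N)%N -> (Gser N j)`_k = (newton (mu malgC clog) k).[j%:R].
Proof.
move=> kN; pose m i := xd F * inv1p N F + - xd ('X * (i%:R)%:P) * inv1p N ('X * (i%:R)%:P).
have ld : logder N (Gser N j) (\sum_(i < j) m i).
  rewrite /Gser; apply: (@logder_prod N 'I_j _ (fun i : 'I_j => (1 + ax N * 'X^2) * inv1p N ('X * i%:R)) m) => i.
  rewrite -(rmorph_nat (@polyC MP)).
  apply: logderM; first exact: logder_1p coef0_axX2.
  exact: logder_inv1p (coef0_Xnat _).
have m0 i : (m i)`_0 = 0.
  by rewrite /m xd_Xnat coefD [(xd F * _)`_0]coef0M coef_xd !mul0r add0r coef0M coefN coef0_Xnat oppr0 mul0r.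
apply: (@newton_eval _ _ N (fun k => (Gser N j)`_k) (fun r => (\sum_(i < j) m i)`_r)) kN.
- apply: coef0_prod => i; rewrite -(rmorph_nat (@polyC MP)) coef0M coefD coef0_axX2 coef1.
  by rewrite inv1p_coef0 ?coef0_Xnat // addr0 mulr1.
- move=> r rN; rewrite mu_nat coef_sum mulr_natl -[X in _ + _ *+ X](card_ord j) -sumr_const -big_split /=.
  apply: eq_bigr => i _; rewrite /m coefD addrC xd_Xnat; congr (_ + _).
  rewrite mulNr -mulrA coefN coefXM /= coefCM coef_inv1p_lin ?(ltnW rN) //.
  by rewrite exprS mulNr.
- move=> r rN; apply: (logder_rec ld) => //.
  by rewrite coef_sum big1 // => i _; exact: m0.
Qed.

Lemma Hser_newton j k : (0 < j)%N -> (k <= N)%N ->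
  (Hser N j)`_k = (newton (mu malgC clog) k).[1 - j%:R].
Proof.
move=> j0 kN; pose c (l : nat) : {poly MP} := 'X * (- (l%:R : MP))%:P.
pose m l := xd (c l) * inv1p N (c l) + - xd F * inv1p N F.
have cE l : 1 - 'X * l%:R = 1 + c l.
  by rewrite /c polyCN mulrN -(rmorph_nat (@polyC MP)).
have ld : logder N (Hser N j) (\sum_(1 <= l < j) m l).
  rewrite /Hser; apply: logder_prod => l; rewrite cE.
  apply: logderM; first exact: logder_1p (coef0_Xnat _).
  exact: logder_inv1p coef0_axX2.
have m0 i : (m i)`_0 = 0.
  by rewrite /m xd_Xnat coefD coef0M coef0_Xnat mul0r add0r coef0M coefN coef_xd mul0r oppr0 mul0r.
apply: (@newton_eval _ _ N (fun k => (Hser N j)`_k) (fun r => (\sum_(1 <= l < j) m l)`_r)) kN.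
- apply: coef0_prod => i; rewrite cE coef0M coefD coef0_Xnat coef1 addr0 mul1r.
  exact: inv1p_coef0 coef0_axX2.
- move=> r rN; rewrite mu_refl // coef_sum mulr_natl -sumr_const_nat -sumrB.
  apply: eq_bigr => i _; rewrite /m coefD xd_Xnat mulNr coefN; congr (_ - _).
  rewrite /c -mulrA coefXM /= coefCM coef_inv1p_lin ?(ltnW rN) // opprK.
  by rewrite exprS mulNr.
- move=> r rN; apply: (logder_rec ld) => //.
  by rewrite coef_sum big1 // => i _; exact: m0.
Qed.

End Coefficients.

(** * Dependence of the coefficients on the last indeterminate *)

Section Shift.
Variables (A : comNzRingType) (kappa : {rmorphism A -> A}) (w : A) (n : nat).
Implicit Types (f g : {poly A}) (e m : A).

(* Modulo [X^(n+2)], [f] differs from its image under [kappa] only by the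
   term [m * w * X^(n+1)]. *)
Definition shift e m f : Prop :=
  f`_0 = e /\ forall k, (k <= n.+1)%N ->
    f`_k = kappa f`_k + (if k == n.+1 then m * w else 0).

Lemma shift_kappa e m f : shift e m f -> kappa e = e.
Proof. by move=> [<- /(_ 0%N isT)]; rewrite /= addr0. Qed.

(** In the coefficient of index [n + 1] of a product, corrections enter only through the two extreme
    terms, so [m] obeys the Leibniz rule. *)
Lemma shiftM e e' m m' f g :
  shift e m f -> shift e' m' g -> shift (e * e') (m * e' + e * m') (f * g).
Proof.
move=> sf sg; have ke := shift_kappa sf; have ke' := shift_kappa sg.
case: sf sg => f0 fk [g0 gk]; split; first by rewrite coef0M f0 g0.
move=> k kn; rewrite coefM rmorph_sum /=; case: eqP => [->|/eqP kn'].
  have split3 (G : nat -> A) :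
      \sum_(i < n.+2) G i = G 0%N + \sum_(i < n) G i.+1 + G n.+1.
    by rewrite big_ord_recr big_ord_recl.
  rewrite (split3 (fun i => f`_i * g`_(n.+1 - i))).
  rewrite (split3 (fun i => kappa (f`_i * g`_(n.+1 - i)))).
  rewrite !subnn !subn0 f0 g0 !rmorphM ke ke' {1}(fk n.+1) // {1}(gk n.+1) // eqxx.
  rewrite [\sum_(i < n) f`_i.+1 * _](eq_bigr (fun i : 'I_n => kappa (f`_i.+1 * g`_(n.+1 - i.+1)))).
    by ring.
  move=> i _; have := ltn_ord i => ik; rewrite rmorphM {1}(fk i.+1); last by lia.
  rewrite {1}(gk (n.+1 - i.+1)%N); last by rewrite leq_subr.
  by rewrite !ifN ?addr0 // neq_ltn; lia.
rewrite addr0; apply: eq_bigr => i _; have := ltn_ord i => ik.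
rewrite rmorphM {1}(fk i); last by lia.
rewrite {1}(gk (k - i)%N); last by lia.
by rewrite !ifN ?addr0 // neq_ltn; lia.
Qed.

Lemma shiftD e e' m m' f g :
  shift e m f -> shift e' m' g -> shift (e + e') (m + m') (f + g).
Proof.
move=> [f0 fk] [g0 gk]; split; first by rewrite coefD f0 g0.
move=> k kn; rewrite coefD rmorphD /= {1}fk // {1}gk //.
by case: ifP => _; ring.
Qed.

Lemma shiftN e m f : shift e m f -> shift (- e) (- m) (- f).
Proof.
move=> [f0 fk]; split; first by rewrite coefN f0.
by move=> k kn; rewrite coefN rmorphN /= {1}fk //; case: ifP => _; ring.
Qed.

Lemma shift_fix f : (forall k, (k <= n.+1)%N -> kappa f`_k = f`_k) -> shift f`_0 0 f.
Proof. by move=> fk; split=> // k kn; rewrite fk // mul0r if_same addr0. Qed.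

Lemma shift1 : shift 1 0 1.
Proof.
have := @shift_fix 1; rewrite coef1 /=; apply => k _.
by rewrite coef1 rmorph_nat.
Qed.

Lemma shift_prod (I : Type) (s : seq I) (f : I -> {poly A}) m :
  (forall i, shift 1 m (f i)) -> shift 1 ((size s)%:R * m) (\prod_(i <- s) f i).
Proof.
move=> sf; elim: s => [|i s IH]; first by rewrite big_nil mul0r; exact: shift1.
rewrite big_cons /= -natr1 mulrDl mul1r; have := shiftM (sf i) IH.
by rewrite !mul1r mulr1 addrC.
Qed.

(** The constant term of [c] is 0, so its correction survives only in the summand [c ^+ 1]. *)
Lemma shift_geom N m c : shift 0 m c -> shift 1 m (\sum_(k < N.+2) c ^+ k).
Proof.
move=> sc; rewrite big_ord_recl big_ord_recl expr0 /bump /= expr1.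
have s0 : shift 0 0 (\sum_(i < N) c ^+ (1 + (1 + i))).
  elim/big_ind: _ => [|f g sf sg|i _].
  - by have := @shift_fix 0; rewrite coef0; apply => k _; rewrite coef0 rmorph0.
  - by have := shiftD sf sg; rewrite !addr0.
  - elim: (i : nat) => [|j IH]; first by have := shiftM sc sc; rewrite !(mul0r, mulr0, addr0) expr2.
    by have := shiftM sc IH; rewrite !(mul0r, mulr0, addr0) !addnS exprS.
by have := shiftD shift1 (shiftD sc s0); rewrite !(add0r, addr0).
Qed.

Lemma shift_1mX (l : nat) : shift 1 0 (1 - 'X * l%:R).
Proof.
have := @shift_fix (1 - 'X * l%:R); rewrite coefB coef1 coefXM subr0; apply => k _.
rewrite -polyC_natr coefB coef1 coefXM rmorphB /= (rmorph_nat kappa).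
case: eqP => _ /=; first by rewrite rmorph0.
by rewrite coefC; case: eqP => _; rewrite ?rmorph0 ?(rmorph_nat kappa).
Qed.

End Shift.

Lemma rmorph_sum_powers (A : comNzRingType) (kappa : {rmorphism A -> A}) n
    (S : nat -> A) (v : A) : kappa v = v ->
  kappa (\sum_(i < n.+1) S i * v ^+ i) = kappa (S 0%N) +
    \sum_(1 <= i < n.+1) (if (i <= n)%N then kappa (S i) else 0) * v ^+ i.
Proof.
move=> vK; rewrite rmorph_sum big_ord_recl expr0 mulr1 big_add1 /= big_mkord.
congr (_ + _); apply: eq_bigr => i _.
by rewrite ltn_ord rmorphM rmorphXn vK.
Qed.

Fact subst_additive (c : nat -> MP) : {morph subst c : p q / p - q}.
Proof. exact: (peval_additive c (@malgC _ rat : {rmorphism rat -> MP})). Qed.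
Fact subst_multiplicative (c : nat -> MP) : multiplicative (subst c).
Proof. exact: (peval_multiplicative c (@malgC _ rat : {rmorphism rat -> MP})). Qed.
HB.instance Definition _ c := GRing.isAdditive.Build MP MP (subst c) (subst_additive c).
HB.instance Definition _ c :=
  GRing.isMultiplicative.Build MP MP (subst c) (subst_multiplicative c).

Lemma substC c r : subst c r%:MP = r%:MP.
Proof. exact: (pevalC c (@malgC _ rat : {rmorphism rat -> MP})). Qed.

Lemma substU c k : subst c (var k) = c k.
Proof. exact: (pevalU c (@malgC _ rat : {rmorphism rat -> MP})). Qed.

Definition below (b k : nat) : MP := if (k < b)%N then var k else 0.

Lemma vars_below_subst b p : vars_below b (subst (below b) p).
Proof.
elim/malg_poly_ind: p => [r|k|p q IHp IHq|p q IHp IHq].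
- rewrite substC => m; rewrite msuppC; case: ifP => _; first by rewrite in_fset0.
  by rewrite in_fset1 => /eqP ->; rewrite mdom1 => k; rewrite in_fset0.
- rewrite -/(var k) substU /below; case: ifP => kb m; last by rewrite msupp0 in_fset0.
  rewrite msuppU oner_eq0 in_fset1 => /eqP -> i.
  by rewrite mdomU in_fset1 => /eqP ->.
- rewrite rmorphD => m /(fsubsetP (msuppD_le _ _)); rewrite in_fsetU.
  by case/orP => [/IHp|/IHq].
- rewrite rmorphM => m /msuppM_le[m1 [m2 [m1p m2q ->]]] k.
  by rewrite mdomD in_fsetU => /orP[]; [exact: IHp m1p k|exact: IHq m2q k].
Qed.

Section Existence.
Variable n : nat.
Let N := n.+1.
Let kappa : {rmorphism MP -> MP} := subst (below n.-1).

Lemma shift_axX2 : (0 < n)%N -> shift kappa (var n.-1) n 0 1 (ax N * 'X^2).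
Proof.
move=> n0; split; first by rewrite coef0_axX2.
move=> k kn; rewrite coef_axX2; case: eqP => [->|kn'].
  have -> : (1 < n.+1 < N.+3)%N by rewrite /N; lia.
  by rewrite /= substU /below ifN ?add0r ?mul1r ?subn2 //; lia.
rewrite addr0; case: ifP => h; last by rewrite rmorph0.
by rewrite /= substU /below ifT //; lia.
Qed.

(** The last indeterminate [a_(n-1)] enters linearly, [j] times through [G] and [j - 1] times
    through [H]: this is the term [u a_(n-1)] of the definition. The outer factor [1 + a(x) x^2]
    adds nothing, since [G - H] has no constant term. *)
Lemma shift_Scoef j : (0 < n)%N -> (0 < j)%N ->
  Scoef n j = kappa (Scoef n j) + (j%:R + (j - 1)%:R) * var n.-1.
Proof.
move=> n0 j0.
have sF := shift_axX2 n0.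
have s1F := shiftD (shift1 kappa (var n.-1) n) sF.
have sinv : shift kappa (var n.-1) n 1 (-1) (inv1p N (ax N * 'X^2)).
  by apply: shift_geom; have := shiftN sF; rewrite oppr0.
have sG : shift kappa (var n.-1) n 1 j%:R (Gser N j).
  have := @shift_prod MP kappa (var n.-1) n _ (index_enum 'I_j)
    (fun i : 'I_j => (1 + ax N * 'X^2) * inv1p N ('X * (i%:R))) 1.
  rewrite mulr1 [size _](_ : _ = j); last by rewrite -[RHS]card_ord cardT enumT.
  apply => i; have sI : shift kappa (var n.-1) n 1 0 (inv1p N ('X * i%:R)).
    rewrite -(rmorph_nat (@polyC MP)).
    rewrite -[X in shift _ _ _ X _ _](inv1p_coef0 N (coef0_Xnat i%:R)); apply: shift_fix => k kn.
    by rewrite coef_inv1p_lin // rmorphXn rmorphN rmorph_nat.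
  by have := shiftM s1F sI; rewrite addr0 add0r !mulr1 mulr0 addr0.
have sH : shift kappa (var n.-1) n 1 (- (j - 1)%:R) (Hser N j).
  have := @shift_prod MP kappa (var n.-1) n _ (index_iota 1 j)
    (fun l => (1 - 'X * (l%:R)) * inv1p N (ax N * 'X^2)) (-1).
  rewrite size_iota mulrN1; apply => l.
  have sX : shift kappa (var n.-1) n 1 0 (1 - 'X * (l%:R)) by exact: shift_1mX.
  by have := shiftM sX sinv; rewrite mul0r add0r !mul1r.
have [_ /(_ n.+1 (leqnn _))] := shiftM (shiftD sG (shiftN sH)) s1F.
rewrite eqxx -/(Scoef n j) => ShE; rewrite [LHS]ShE.
have gen (A : comNzRingType) (a b s w : A) :
    s + ((a - - b) * (1 + 0) + (1 - 1) * (0 + 1)) * w = s + (a + b) * w by ring.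
exact: gen.
Qed.

Definition gdiff k := newton (mu malgC (clog N)) k - (newton (mu malgC (clog N)) k \Po (1 - 'X)).

(* [Scoef n j] as a polynomial in [j]. *)
Definition Tpoly : {poly MP} := \sum_(i < n.+2) ((1 + ax N * 'X^2)`_i)%:P * gdiff (n.+1 - i).

Lemma Tpoly_nat j : (0 < j)%N -> Tpoly.[j%:R] = Scoef n j.
Proof.
move=> j0; rewrite /Tpoly horner_sum /Scoef coefMr; apply: eq_bigr => i _.
rewrite [RHS]mulrC hornerM hornerC /gdiff hornerD hornerN horner_comp coefB.
rewrite (Gser_newton _ (leq_subr _ _)) (Hser_newton j0 (leq_subr _ _)).
by rewrite hornerD hornerN hornerX hornerC.
Qed.

Lemma Tpoly_refl : Tpoly \Po (1 - 'X) = - Tpoly.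
Proof.
rewrite /Tpoly rmorph_sum -sumrN; apply: eq_bigr => i _.
rewrite /= comp_polyM comp_polyC -mulrN; congr (_ * _).
rewrite /gdiff opprB comp_polyB -comp_polyA comp_polyB comp_polyX.
rewrite [1 \Po _]comp_polyC (_ : 1 - (1 - 'X) = 'X) ?comp_polyXr //.
by rewrite opprB addrC subrK.
Qed.

(** The degree bound [2 n + 2] exceeds the degree of [u v^n] by one; antisymmetry excludes the extra
    even degree. *)
Lemma size_Tpoly : (size Tpoly <= n.*2.+3)%N.
Proof.
apply: leq_trans (size_sum _ _ _) _; apply/bigmax_leqP => i _.
rewrite mul_polyC; apply: leq_trans (size_scale_leq _ _) _.
apply: leq_trans (size_polyD _ _) _; rewrite size_polyN geq_max.
have s : (size (newton (mu malgC (clog N)) (n.+1 - i)) <= n.*2.+3)%N.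
  apply: leq_trans (size_newton (size_mu _ _) _) _; lia.
rewrite s /=; set q := newton _ _ in s *.
apply: leq_trans (size_comp_poly_leq _ _) _.
have -> : size (1 - 'X : {poly MP}) = 2%N.
  by rewrite -opprB size_polyN -polyC1 size_XsubC.
by rewrite muln1; case: (size q) s.
Qed.

Lemma Sfam_exists : (0 < n)%N -> exists S, is_Sfam n S.
Proof.
move=> n0.
have half : exists h : MP, 2%:R * h = 1.
  exists (2%:R^-1)%:MP; rewrite -mpolyC_nat -mpolyCM mulfV //.
have [S SE] := antisymmetric_decomp half size_Tpoly Tpoly_refl.
(* [kappa] removes [a_(n-1)] and all later indeterminates from the raw coefficients; [shift_Scoef]
   restores the term lost in this way. *)
exists (fun i => if (i <= n)%N then kappa (S i) else 0); split; [|split].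
- by move=> i ni; rewrite leqNgt ni.
- move=> i; case: ifP => _; first exact: vars_below_subst.
  by move=> m; rewrite msupp0 in_fset0.
move=> j j0.
have jE : (2%:R * j%:R - 1 : rat)%:MP = 2%:R * j%:R - 1 :> MP.
  by rewrite rmorphB rmorphM rmorph1 /= !mpolyC_nat.
have vE : (j%:R * (j%:R - 1) : rat)%:MP = j%:R ^+ 2 - j%:R :> MP.
  by rewrite rmorphM rmorphB rmorph1 /= !mpolyC_nat mulrBr mulr1 expr2.
rewrite jE vE shift_Scoef // -Tpoly_nat // SE.
have hE : ((2%:R * 'X - 1) * \sum_(i < n.+1) (S i)%:P * ('X^2 - 'X) ^+ i).[j%:R]
   = (2%:R * j%:R - 1) * \sum_(i < n.+1) S i * (j%:R ^+ 2 - j%:R) ^+ i.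
  rewrite hornerM hornerD hornerM hornerN hornerX -polyC1 -polyC_natr !hornerC horner_sum.
  congr (_ * _); apply: eq_bigr => i _.
  by rewrite hornerM hornerC horner_exp hornerD hornerN hornerX hornerXn.
have vK : kappa (j%:R ^+ 2 - j%:R) = j%:R ^+ 2 - j%:R.
  by rewrite rmorphB rmorphXn (rmorph_nat kappa).
have uK : kappa (2%:R * j%:R - 1) = 2%:R * j%:R - 1.
  by rewrite rmorphB rmorphM rmorph1 !(rmorph_nat kappa).
have eK := @rmorph_sum_powers MP kappa n S _ vK.
have gen (A : comNzRingType) (k : {rmorphism A -> A}) (u J x s0 s w K : A) :
    k u = u -> k x = s0 + s -> u = 2%:R * J - 1 -> K = J - 1 ->
    k (u * x) + (J + K) * w = u * (w + s0 + s).
  by move=> uk xk uJ ->; rewrite rmorphM uk xk uJ; ring.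
rewrite hE; apply: (gen MP kappa _ _ _ _ _ _ _ uK eK (erefl _)).
by rewrite natrB.
Qed.

End Existence.

(** * Constant terms of the polynomials S_i(n) *)

Definition const_term (p : MP) : rat := p@_(onecm nat).

Fact const_term_additive : {morph const_term : p q / p - q}.
Proof. by move=> p q; rewrite /const_term mcoeffB. Qed.
Fact const_term_multiplicative : multiplicative const_term.
Proof. by split=> [p q|]; [exact: mcoeff1M|exact: malgCK]. Qed.
HB.instance Definition _ := GRing.isAdditive.Build MP rat const_term const_term_additive.
HB.instance Definition _ :=
  GRing.isMultiplicative.Build MP rat const_term const_term_multiplicative.

Lemma const_termC c : const_term c%:MP = c.
Proof. exact: malgCK. Qed.

Lemma const_term_var k : const_term (var k) = 0.
Proof. by rewrite /const_term mcoeffU [_ == _]cm1_eq1. Qed.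

Lemma peval0 (I : choiceType) (p : {malg rat[cmonom I]}) :
  peval (fun r : rat => r) (fun=> 0) p = p@_(onecm I).
Proof.
rewrite -(coef0_dual (fun=> 0)) -horner_coef0 -[RHS]/(horner_eval 0 _) /dual_eval.
rewrite (@peval_comp _ _ _ (horner_eval 0) _ (fun r => r)) => [|r]; last exact: hornerC.
by apply: eq_peval => i; rewrite /= /horner_eval hornerM hornerX mulr0.
Qed.

Lemma const_term_subst (c : nat -> MP) p : (forall k, const_term (c k) = 0) ->
  const_term (subst c p) = const_term p.
Proof.
move=> c0; rewrite /subst (@peval_comp _ _ _ const_term _ (fun r => r) c p const_termC).
by rewrite -[RHS]peval0; apply: eq_peval.
Qed.

Section ConstTerms.
Variable n : nat.

(** At [a = 0]: the coefficient of [x^k] in the product of [1 / (1 + i x)] over [0 <= i < j], as a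
    polynomial in [j]. *)
Definition gam (k : nat) : {poly rat} :=
  map_poly const_term (newton (mu malgC (clog n.+1)) k).

Lemma const_term_axX2 N k : const_term (ax N * 'X^2)`_k = 0.
Proof. by rewrite coef_axX2; case: ifP => _; rewrite ?const_term_var ?rmorph0. Qed.

Lemma const_term_clog N r : const_term (clog N r) = 0.
Proof.
rewrite /clog coefM rmorph_sum big1 // => i _ /=.
by rewrite rmorphM /= coef_xd rmorphM /= const_term_axX2 mulr0 mul0r.
Qed.

Lemma map_mu r : map_poly const_term (mu malgC (clog n.+1) r) = (-1) ^+ r * faulhaber r.
Proof.
rewrite /mu rmorphD [X in _ + X]rmorphM /= map_polyC /= const_term_clog mul0r addr0.
rewrite rmorphM rmorphXn rmorphN rmorph1 /=; congr (_ * _).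
by rewrite /faul -map_poly_comp map_poly_id // => c _; exact: const_termC.
Qed.

Lemma gam0 : gam 0 = 1.
Proof. by rewrite /gam /newton /= rmorph1. Qed.

Lemma gamS k : k.+1%:R * gam k.+1 =
  \sum_(r < k.+1) (-1) ^+ r.+1 * faulhaber r.+1 * gam (k - r).
Proof.
rewrite /gam newtonS rmorphM /= map_polyC /= const_termC rmorph_sum mulrA.
rewrite -(rmorph_nat (@polyC rat)) -polyCM mulfV ?pnatr_eq0 // mul1r.
by apply: eq_bigr => r _; rewrite -map_mu rmorphM.
Qed.

Lemma map_Tpoly :
  map_poly const_term (Tpoly n) = gam n.+1 - (gam n.+1 \Po (1 - 'X)).
Proof.
rewrite /Tpoly rmorph_sum big_ord_recl big1 ?addr0 => [|i _]; last first.
  by rewrite rmorphM /= map_polyC /= coefD coef1 add0r const_term_axX2 mul0r.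
rewrite rmorphM /= map_polyC /= coefD coef1 coef0_axX2 addr0 rmorph1 mul1r.
rewrite subn0 /gdiff rmorphB /= map_comp_poly; congr (_ - (_ \Po _)).
by rewrite rmorphB rmorph1 /= map_polyX.
Qed.
End ConstTerms.

(* Coefficients of index at most 2 of polynomials given by Newton's recursion
   with power sums [P r]; the coefficients of index 0 to 2 of [P] are those
   of the Faulhaber polynomials up to the sign [e r]. *)
Section NewtonCoefs.
Variables (g P : nat -> {poly rat}) (e : nat -> rat).
Hypothesis g0 : g 0%N = 1.
Hypothesis P0 : forall r, (P r.+1)`_0 = 0.
Hypothesis P1 : forall r, (P r.+1)`_1 = e r.+1 * bernoulli r.+1.
Hypothesis P2 : forall r, (P r.+1)`_2 = e r.+1 * (r.+1%:R / 2%:R * bernoulli r).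
Hypothesis gS : forall k, k.+1%:R * g k.+1 = \sum_(r < k.+1) P r.+1 * g (k - r)%N.

Let natr0 k : k.+1%:R != 0 :> rat.
Proof. by rewrite pnatr_eq0. Qed.

Lemma newton_rec_coef k i : k.+1%:R * (g k.+1)`_i = \sum_(r < k.+1) (P r.+1 * g (k - r)%N)`_i.
Proof. by rewrite -coef_sum -gS -polyC_natr coefCM. Qed.

Lemma newton_coef0 k : (g k.+1)`_0 = 0.
Proof.
apply: (mulfI (natr0 k)); rewrite newton_rec_coef mulr0 big1 // => r _.
by rewrite coef0M P0 mul0r.
Qed.

Lemma newton_coef1 k : (g k.+1)`_1 = e k.+1 * bernoulli k.+1 / k.+1%:R.
Proof.
apply: (mulfI (natr0 k)); rewrite newton_rec_coef mulrC divfK //.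
rewrite big_ord_recr big1 /= => [|r _]; last first.
  rewrite coefM !big_ord_recl big_ord0 /= P0 mul0r add0r addr0.
  by rewrite -[(k - r)%N]prednK ?subn_gt0 // newton_coef0 mulr0.
by rewrite subnn g0 mulr1 P1 add0r.
Qed.

Lemma newton_coef2 k : (g k.+1)`_2 = (e k.+1 * (k.+1%:R / 2%:R * bernoulli k)
  + \sum_(r < k) e r.+1 * e (k - r)%N * (bernoulli r.+1 * bernoulli (k - r) / (k - r)%:R)) / k.+1%:R.
Proof.
apply: (mulfI (natr0 k)); rewrite newton_rec_coef [RHS]mulrC divfK //.
rewrite big_ord_recr /= subnn g0 mulr1 P2 addrC; congr (_ + _).
apply: eq_bigr => r _.
rewrite coefM !big_ord_recl big_ord0 /= P0 mul0r add0r addr0 P1.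
have kr : (k - r = (k - r).-1.+1)%N by rewrite prednK // subn_gt0.
by rewrite /bump /= kr newton_coef0 mulr0 addr0 newton_coef1 -kr; ring.
Qed.

End NewtonCoefs.

Definition bernoulli_conv (n : nat) : rat :=
  \sum_(r < n) bernoulli r.+1 * bernoulli (n - r) / (n - r)%:R.

Lemma bernoulli_odd_eq0 k : odd k -> (2 < k)%N -> bernoulli k = 0.
Proof.
move=> ok k2; have -> : k = (k./2.-1).*2.+3 by lia.
exact: bernoulli_odd.
Qed.

(** The two indices add up to the odd number [2 m + 1], so one of them is odd, and the term vanishes
    unless that one is 1. Only the first and the last term survive. *)
Lemma bernoulli_conv_even m : (0 < m)%N ->
  bernoulli_conv m.*2 = - (m.*2.+1%:R / (4%:R * m%:R)) * bernoulli m.*2.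
Proof.
move=> m0; rewrite /bernoulli_conv.
case: m m0 => // m _; rewrite doubleS big_ord_recr big_ord_recl /= subn0.
rewrite subSnn divr1 big1 ?addr0 => [|r _]; last first.
  rewrite /bump /= add1n; have := ltn_ord r => rm.
  have [o|o] := boolP (odd r.+2).
    by rewrite (@bernoulli_odd_eq0 r.+2 o) ?mul0r //; case: (nat_of_ord r) o.
  rewrite (@bernoulli_odd_eq0 (m.*2.+2 - r.+1)) ?mulr0 ?mul0r //; lia.
rewrite bernoulli1; have m1 : m.+1%:R != 0 :> rat by rewrite pnatr_eq0.
have -> : m.*2.+2%:R = 2%:R * m.+1%:R :> rat by rewrite -natrM mul2n doubleS.
have -> : m.*2.+3%:R = 2%:R * m.+1%:R + 1 :> rat by rewrite -natrM mul2n doubleS natr1.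
by move: m1 (bernoulli _); move: (m.+1%:R) => x x0 b; field.
Qed.

Lemma SpolyP n : (0 < n)%N -> is_Sfam n (Spoly n).
Proof. by move=> n0; apply: epsilon_spec; exact: Sfam_exists. Qed.

Section SpolyConst.
Variable n : nat.
Hypothesis n0 : (0 < n)%N.

Let s i := const_term (Spoly n i).
Let T := gam n n.+1 - (gam n n.+1 \Po (1 - 'X)).

Lemma Spoly_const_nat (j : nat) : (0 < j)%N ->
  T.[j%:R] = (2%:R * j%:R - 1) *
     (s 0%N + \sum_(1 <= i < n.+1) s i * (j%:R * (j%:R - 1)) ^+ i).
Proof.
move=> j0; have -> : T.[j%:R] = const_term (Scoef n j).
  by rewrite /T -map_Tpoly -(rmorph_nat const_term) horner_map /= Tpoly_nat.
have [_ [_ /(_ j j0) ->]] := SpolyP n0.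
rewrite rmorphM /= const_termC; congr (_ * _).
rewrite !(rmorphD const_term) /= const_term_var add0r; congr (_ + _).
rewrite rmorph_sum; apply: eq_bigr => i _.
by rewrite rmorphM rmorphXn /= const_termC.
Qed.

Lemma Spoly_const_poly :
  T = (2%:R * 'X - 1) * ((s 0%N)%:P + \sum_(1 <= i < n.+1) (s i)%:P * ('X^2 - 'X) ^+ i).
Proof.
apply: poly_eq_nat => j j0; rewrite Spoly_const_nat //.
rewrite hornerM hornerD hornerM hornerN hornerX -polyC_natr -polyC1 !hornerC.
rewrite hornerD hornerC horner_sum; congr (_ * (_ + _)); apply: eq_bigr => i _.
rewrite hornerM hornerC horner_exp hornerD hornerN hornerX hornerXn.
by congr (_ * _ ^+ _); ring.
Qed.

End SpolyConst.

(** At [j = 1] one has [u = 1], [v = 0], [H = 1] and [G = 1 + F] with [F = a(x) x^2], so the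
    coefficient in question is that of [F + F^2], where [F] supplies [a_(n-1)]. Being quadratic,
    [S_0(n)] drops out of all linear parts. *)
Lemma Spoly0E n : (0 < n)%N -> Spoly n 0%N = ((ax n.+1 * 'X^2) ^+ 2)`_n.+1.
Proof.
move=> n0; have [_ [_ /(_ 1%N isT)]] := SpolyP n0.
rewrite /Scoef /Gser /Hser big_ord1 big_geq //.
have -> : inv1p n.+1 ('X * (ord0 : 'I_1)%:R) = 1.
  rewrite mulr0 /inv1p oppr0 big_ord_recl expr0 big1 ?addr0 // => i _.
  by rewrite expr0n.
have gen (A : comNzRingType) (F : {poly A}) : ((1 + F) * 1 - 1) * (1 + F) = F + F ^+ 2 by ring.
rewrite gen coefD coef_axX2; have -> : (1 < n.+1 < n.+4)%N by lia.
have -> : (2%:R * 1%:R - 1 : rat) = 1 by [].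
have -> : (1%:R * (1%:R - 1) : rat) = 0 by [].
rewrite subSS subn1 big1_seq => [|i]; last first.
  rewrite mem_index_iota => /andP[_ /andP[i0 _]].
  by rewrite (_ : 0%:MP = 0 :> MP) ?rmorph0 // expr0n; case: i i0 => // i _; rewrite mulr0.
have -> : (1 : rat)%:MP = 1 :> MP by exact: mpolyC1E.
have gen2 (A : zmodType) (a b c : A) : a + b = a + c -> c = b by move/addrI.
rewrite mul1r addr0; exact: gen2.
Qed.

Lemma subst_Spoly0 n (c : nat -> MP) : (0 < n)%N ->
  subst c (Spoly n 0%N) =
  \sum_(i < n.+2) subst c (ax n.+1 * 'X^2)`_i * subst c (ax n.+1 * 'X^2)`_(n.+1 - i).
Proof.
move=> n0; rewrite Spoly0E // expr2 coefM rmorph_sum.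
by apply: eq_bigr => i _; rewrite (rmorphM (subst c)).
Qed.

Lemma const_term_subst_axX2 N (c : nat -> MP) i : (forall k, const_term (c k) = 0) ->
  const_term (subst c (ax N * 'X^2)`_i) = 0.
Proof. by move=> c0; rewrite const_term_subst // const_term_axX2. Qed.

Lemma const_termM0 a b : const_term a = 0 -> const_term (a * b) = 0.
Proof. by rewrite /const_term mcoeff1M => ->; rewrite mul0r. Qed.

Lemma linM0 z a b : const_term a = 0 -> const_term b = 0 -> lin z (a * b) = 0.
Proof. by rewrite /const_term linM => -> ->; rewrite mulr0 mul0r addr0. Qed.

Lemma const_term_subst_Spoly0 n (c : nat -> MP) : (0 < n)%N ->
  (forall k, const_term (c k) = 0) -> const_term (subst c (Spoly n 0%N)) = 0.
Proof.
move=> n0 c0; rewrite subst_Spoly0 // rmorph_sum big1 // => i _.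
exact: (const_termM0 _ (const_term_subst_axX2 _ _ c0)).
Qed.

Lemma lin_subst_Spoly0 z n (c : nat -> MP) : (0 < n)%N ->
  (forall k, const_term (c k) = 0) -> lin z (subst c (Spoly n 0%N)) = 0.
Proof.
move=> n0 c0; rewrite subst_Spoly0 // raddf_sum big1 // => i _.
exact: (linM0 z (const_term_subst_axX2 _ _ c0) (const_term_subst_axX2 _ _ c0)).
Qed.

Lemma const_term_Spoly0 n : (0 < n)%N -> const_term (Spoly n 0%N) = 0.
Proof.
move=> n0; rewrite -(@const_term_subst (fun=> 0)) => [|k]; last by rewrite rmorph0.
by apply: const_term_subst_Spoly0 => // k; rewrite rmorph0.
Qed.

Section Values.
Variable n : nat.
Hypothesis n1 : (1 < n)%N.

Let s i := const_term (Spoly n i).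
Let g := gam n.
Let h k := g k \Po (1 - 'X).

Let n0 : (0 < n)%N. Proof. exact: ltnW. Qed.

Lemma gam_refl0 : h 0%N = 1.
Proof. by rewrite /h /g gam0 comp_polyC. Qed.

Lemma gam_reflS k : k.+1%:R * h k.+1 = \sum_(r < k.+1) (- faulhaber r.+1) * h (k - r)%N.
Proof.
rewrite /h; have <- : (k.+1%:R \Po (1 - 'X)) = k.+1%:R :> {poly rat}.
  by rewrite -polyC_natr comp_polyC.
rewrite -comp_polyM gamS rmorph_sum; apply: eq_bigr => r _ /=.
rewrite !comp_polyM faulhaber_refl; congr (_ * _).
rewrite rmorphXn rmorphN rmorph1 /= -mul_polyC rmorphXn rmorphN rmorph1 /= mulrA.
by rewrite -exprD addSn addnn exprS -signr_odd odd_double expr0 mulr1 mulN1r.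
Qed.

Lemma faulhaber_sign_coef r i :
  ((-1) ^+ r.+1 * faulhaber r.+1)`_i = (-1) ^+ r.+1 * (faulhaber r.+1)`_i.
Proof. by rewrite -coefCM rmorphXn rmorphN rmorph1. Qed.

Lemma faulhaber_sign0 r : ((-1) ^+ r.+1 * faulhaber r.+1)`_0 = 0.
Proof. by rewrite faulhaber_sign_coef faulhaber_coef0 mulr0. Qed.
Lemma faulhaber_sign1 r :
  ((-1) ^+ r.+1 * faulhaber r.+1)`_1 = (-1) ^+ r.+1 * bernoulli r.+1.
Proof. by rewrite faulhaber_sign_coef faulhaber_coef1. Qed.
Lemma faulhaber_sign2 r :
  ((-1) ^+ r.+1 * faulhaber r.+1)`_2 = (-1) ^+ r.+1 * (r.+1%:R / 2%:R * bernoulli r).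
Proof. by rewrite faulhaber_sign_coef faulhaber_coef2. Qed.
Lemma faulhaber_opp0 r : (- faulhaber r.+1)`_0 = 0.
Proof. by rewrite coefN faulhaber_coef0 oppr0. Qed.
Lemma faulhaber_opp1 r : (- faulhaber r.+1)`_1 = (fun=> -1) r.+1 * bernoulli r.+1.
Proof. by rewrite coefN faulhaber_coef1 mulN1r. Qed.
Lemma faulhaber_opp2 r :
  (- faulhaber r.+1)`_2 = (fun=> -1) r.+1 * (r.+1%:R / 2%:R * bernoulli r).
Proof. by rewrite coefN faulhaber_coef2 mulN1r. Qed.

Let T := g n.+1 - h n.+1.

Lemma T_coef1 : T`_1 = ((-1) ^+ n.+1 + 1) * bernoulli n.+1 / n.+1%:R.
Proof.
rewrite /T coefB.
rewrite (@newton_coef1 g (fun r => (-1) ^+ r * faulhaber r) (fun r => (-1) ^+ r) (gam0 n) faulhaber_sign0 faulhaber_sign1 (gamS n)).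
rewrite (@newton_coef1 h (fun r => - faulhaber r) (fun=> -1) gam_refl0 faulhaber_opp0 faulhaber_opp1 gam_reflS).
by ring.
Qed.

Lemma T_coef2 : T`_2 = (((-1) ^+ n.+1 + 1) * (n.+1%:R / 2%:R * bernoulli n)
   + ((-1) ^+ n.+1 - 1) * bernoulli_conv n) / n.+1%:R.
Proof.
rewrite /T coefB.
rewrite (@newton_coef2 g (fun r => (-1) ^+ r * faulhaber r) (fun r => (-1) ^+ r) (gam0 n) faulhaber_sign0 faulhaber_sign1 faulhaber_sign2 (gamS n)).
rewrite (@newton_coef2 h (fun r => - faulhaber r) (fun=> -1) gam_refl0 faulhaber_opp0 faulhaber_opp1 faulhaber_opp2 gam_reflS).
have -> : \sum_(r < n) (-1) ^+ r.+1 * (-1) ^+ (n - r) *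
    (bernoulli r.+1 * bernoulli (n - r) / (n - r)%:R) = (-1) ^+ n.+1 * bernoulli_conv n.
  rewrite mulr_sumr; apply: eq_bigr => r _; rewrite -exprD addSn subnKC //.
  exact: ltnW (ltn_ord r).
have -> : \sum_(r < n) -1 * -1 *
    (bernoulli r.+1 * bernoulli (n - r) / (n - r)%:R) = bernoulli_conv n.
  by apply: eq_bigr => r _; rewrite mulrNN !mul1r.
by ring.
Qed.

Lemma T_coefs : T`_1 = s 1%N /\ T`_2 = - 3%:R * s 1%N - s 2.
Proof.
have TE := Spoly_const_poly n0; rewrite const_term_Spoly0 // -/g -/(h _) -/T in TE.
have [r rE] : exists r : {poly rat}, T = (2%:R * 'X - 1) * ((s 1%N)%:P * ('X^2 - 'X)
    + (s 2)%:P * ('X^2 - 'X) ^+ 2) + r /\ forall k, (k <= 2)%N -> r`_k = 0.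
  exists ((2%:R * 'X - 1) * \sum_(3 <= i < n.+1) (s i)%:P * ('X^2 - 'X) ^+ i); split.
    rewrite TE polyC0 add0r big_ltn ?ltnS // big_ltn ?ltnS // expr1 addrA -mulrDr.
    by [].
  move=> k k2; rewrite coefM big1 // => i _; rewrite coef_sum big_nat big1 ?mulr0 // => l /andP[l3 _].
  rewrite coefCM coef_expr_lt ?mulr0 //; first by rewrite coefB coefXn coefX subrr.
  by rewrite (leq_ltn_trans (leq_subr _ _)) // (leq_ltn_trans k2).
case: rE => -> rE; rewrite !coefD !rE // !addr0.
have -> : (2%:R * 'X - 1) * ((s 1%N)%:P * ('X^2 - 'X) + (s 2)%:P * ('X^2 - 'X) ^+ 2)
  = (s 1%N)%:P * 'X + (- 3%:R * s 1%N - s 2)%:P * 'X^2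
   + ((2%:R * s 1%N + 4%:R * s 2)%:P + (2%:R * s 2)%:P * 'X^2 + (- 5%:R * s 2)%:P * 'X) * 'X^3 :> {poly rat}.
  by rewrite !(polyCB, polyCD, polyCM, polyCN) -!(rmorph_nat (@polyC rat)); ring.
split; rewrite !coefD !coefMXn /= addr0 coefCM coefX /= ?coefC.
  by rewrite mulr1 addr0.
by rewrite mulr0 add0r.
Qed.

End Values.

(** For the index [n = 2 m - 1] the signs cancel the convolution in [T_coef2] and leave a multiple
    of [B_(2m-1) = 0]; so the coefficient of [j^2] vanishes, and [s_2 = - 3 s_1]. *)
Lemma Spoly_const_odd m : (1 < m)%N ->
  const_term (Spoly m.*2.-1 1) = bernoulli m.*2 / m%:R /\
  const_term (Spoly m.*2.-1 2) = - 3%:R * (bernoulli m.*2 / m%:R).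
Proof.
case: m => // m m1; have n1 : (1 < m.+1.*2.-1)%N by rewrite doubleS /=; lia.
have [] := T_coefs n1; rewrite T_coef1 // T_coef2 //.
have -> : m.+1.*2.-1.+1 = m.+1.*2 by rewrite doubleS.
rewrite -signr_odd odd_double expr0 subrr mul0r addr0.
rewrite [bernoulli m.+1.*2.-1]bernoulli_odd_eq0; last 2 first.
- by rewrite doubleS /= odd_double.
- by rewrite doubleS; lia.
have m0 : m.+1%:R != 0 :> rat by rewrite pnatr_eq0.
have -> : m.+1.*2%:R = 2%:R * m.+1%:R :> rat by rewrite -natrM mul2n.
move: m0 (bernoulli _) (const_term _) (const_term _); move: (m.+1%:R) => x x0 b s1 s2 <-.
rewrite !mulr0 mul0r => e2; split; first by field.
have -> : s1 = - 3%:R * ((1 + 1) * b / (2%:R * x)).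
  by apply/esym/eqP; rewrite -subr_eq0 -e2.
by field.
Qed.

(** Here the signs are opposite: the coefficient of [j] vanishes and only the convolution
    contributes to that of [j^2]. *)
Lemma Spoly_const_even m : (1 < m)%N ->
  const_term (Spoly m.*2 1) = 0 /\
  const_term (Spoly m.*2 2) = - (bernoulli m.*2 / (2%:R * m%:R)).
Proof.
move=> m1; have n1 : (1 < m.*2)%N by lia.
have [] := T_coefs n1; rewrite T_coef1 // T_coef2 // exprS -signr_odd odd_double expr0.
rewrite mulr1 addNr mul0r mul0r => <-; rewrite mulr0 sub0r mul0r add0r.
rewrite bernoulli_conv_even ?(ltnW m1) // => /(canLR opprK) <-; split=> //.
have m0 : m%:R != 0 :> rat by rewrite pnatr_eq0; lia.
have m20 : m.*2.+1%:R != 0 :> rat by rewrite pnatr_eq0.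
move: m0 m20 (bernoulli _); move: (m%:R) (m.*2.+1%:R) => x y x0 y0 b.
by field; rewrite x0.
Qed.

(** At [j = 2] the product reduces to [1 / (1 + x)]. *)
Lemma gam_horner2 n k : (gam n k).[2%:R] = (-1) ^+ k.
Proof.
have [N] := ubnP k; elim: N k => // N IH [|k] kN; first by rewrite gam0 hornerC.
have k0 : k.+1%:R != 0 :> rat by rewrite pnatr_eq0.
apply: (mulfI k0); have -> : k.+1%:R * (gam n k.+1).[2%:R] = (k.+1%:R * gam n k.+1).[2%:R].
  by rewrite -polyC_natr hornerCM.
transitivity (\sum_(r < k.+1) (-1) ^+ k.+1 : rat); last by rewrite sumr_const card_ord mulr_natl.
rewrite gamS horner_sum.
apply: eq_bigr => r _; rewrite hornerM IH; last by rewrite (leq_ltn_trans (leq_subr _ _)).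
rewrite hornerM horner_exp hornerN hornerC (faulhaber_sum r.+1 2) !big_ord_recl big_ord0.
rewrite expr0n expr1n add0r addr0 mulr1 -exprD addSn subnKC //.
by rewrite -ltnS.
Qed.

(** The reflected series at [j = 2] is [1 - x]. Subtracting consecutive instances of the recursion
    gives [(i + 2) H_(i+2) = i H_(i+1)], whose right side vanishes at [i = 0]. *)
Lemma gam_refl_horner2 n k : (1 < k)%N -> (gam n k \Po (1 - 'X)).[2%:R] = 0.
Proof.
pose H k := (gam n k \Po (1 - 'X)).[2%:R].
have HS i : i.+1%:R * H i.+1 = - \sum_(r < i.+1) H (i - r)%N.
  have -> : i.+1%:R * H i.+1 = (i.+1%:R * (gam n i.+1 \Po (1 - 'X))).[2%:R].
    by rewrite -polyC_natr hornerCM.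
  rewrite gam_reflS horner_sum -sumrN; apply: eq_bigr => r _.
  rewrite hornerM hornerN (faulhaber_sum r.+1 2) !big_ord_recl big_ord0.
  by rewrite expr0n expr1n add0r addr0 mulN1r.
have HSS i : i.+2%:R * H i.+2 = i%:R * H i.+1.
  rewrite HS big_ord_recl subn0 /= opprD.
  have -> : - (\sum_(r < i.+1) H (i.+1 - bump 0 r)%N) = i.+1%:R * H i.+1.
    by rewrite HS; congr (- _); apply: eq_bigr => r _; rewrite /bump /= add1n subSS.
  by rewrite -natr1; ring.
case: k => [|[|k]] // _; rewrite -/(H k.+2).
have nz i : i.+2%:R != 0 :> rat by rewrite pnatr_eq0.
elim: k => [|k IH].
  by apply: (mulfI (nz 0%N)); rewrite HSS mul0r mulr0.
by apply: (mulfI (nz k.+1)); rewrite HSS IH !mulr0.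
Qed.

Lemma Spoly_const_sum n : (0 < n)%N ->
  \sum_(1 <= i < n.+1) const_term (Spoly n i) * 2%:R ^+ i = (-1) ^+ n.+1 / 3%:R.
Proof.
move=> n0; have := Spoly_const_nat n0 (j := 2) isT.
rewrite hornerD hornerN gam_horner2 gam_refl_horner2 // subr0 const_term_Spoly0 // add0r.
have -> : 2%:R * (2%:R - 1) = 2%:R :> rat by [].
have -> : 2%:R * 2%:R - 1 = 3%:R :> rat by [].
by move=> ->; rewrite mulrC mulKf.
Qed.

(** * Linear part of the recursion *)

Lemma const_term_Chat_step m (c : nat -> MP) : (0 < m)%N ->
  (forall k, const_term (c k) = 0) -> const_term (Chat_step m c) = 0.
Proof.
move=> m0 c0; rewrite /Chat_step (rmorphD const_term) (rmorphN const_term) /=.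
rewrite const_term_subst_Spoly0 // oppr0 add0r rmorph_sum big1 // => i _.
by rewrite (rmorphM const_term) /= [const_term (Ppoly i)]mcoeff1_Ppoly mulr0.
Qed.

Lemma const_term_Chat_upto m k : const_term (Chat_upto m k) = 0.
Proof.
elim: m k => [|m IH] k; first exact: rmorph0.
by rewrite /=; case: eqP => // _; apply: const_term_Chat_step.
Qed.

Lemma lin_natM z (a : nat) (p q : MP) : const_term q = 0 ->
  lin z (a%:R * p * q) = a%:R * const_term p * lin z q.
Proof.
rewrite /const_term => q0; rewrite linM q0 mulr0 add0r mcoeff1M.
by have -> : (a%:R : MP)@_(onecm nat) = a%:R by rewrite -mpolyC_nat; exact: malgCK.
Qed.

Lemma lin_Chat z m : (0 < m)%N ->
  lin z (Chat m) = \sum_(1 <= i < m.+1) (3 * 2 ^ i)%:R * const_term (Spoly m i) * z i.-1.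
Proof.
case: m => // m _; rewrite /Chat /= eqxx /Chat_step raddfD raddfN /=.
rewrite lin_subst_Spoly0 // => [|k]; last exact: const_term_Chat_upto.
rewrite oppr0 add0r raddf_sum; apply: eq_big_nat => i /andP[i1 _] /=.
rewrite lin_natM; last exact: mcoeff1_Ppoly.
have -> : lin z (Ppoly i) = z i.-1 by rewrite -{1}(prednK i1) lin_Ppoly.
rewrite const_term_subst // => k; exact: const_term_Chat_upto.
Qed.

Lemma lin_Chat0 m : (1 < m)%N ->
  lin (fun k => (k == 0%N)%:R) (Chat m) = 6%:R * const_term (Spoly m 1).
Proof.
move=> m1; rewrite lin_Chat ?(ltnW m1) // big_ltn ?ltnS ?(ltnW m1) //=.
rewrite mulr1 big_nat big1 ?addr0 // => i /andP[i2 _].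
by case: i i2 => [|[|i]] // _; rewrite mulr0.
Qed.

Lemma lin_Chat1 m : (1 < m)%N ->
  lin (fun k => (k == 1%N)%:R) (Chat m) = 12%:R * const_term (Spoly m 2).
Proof.
move=> m1; rewrite lin_Chat ?(ltnW m1) // big_ltn ?ltnS ?(ltnW m1) //= mulr0 add0r.
rewrite big_ltn //= mulr1 big_nat big1 ?addr0 // => i /andP[i3 _].
by case: i i3 => [|[|[|i]]] // _; rewrite mulr0.
Qed.

(** This functional reads off the coefficient of [Y_2] once all [A_k] with [k >= 2] are identified:
    the sum of all coefficients, less the first two. *)
Lemma lin_Chat2 m : (1 < m)%N ->
  lin (fun k => (1 < k)%N%:R) (Chat m) =
  (-1) ^+ m.+1 - 6%:R * const_term (Spoly m 1) - 12%:R * const_term (Spoly m 2).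
Proof.
move=> m1; have m0 := ltnW m1.
have e : (-1) ^+ m.+1 = \sum_(1 <= i < m.+1) (3 * 2 ^ i)%:R * const_term (Spoly m i).
  rewrite -[LHS](divfK (_ : 3%:R != 0)) // -(Spoly_const_sum m0) mulr_suml; apply: eq_bigr => i _; rewrite natrM natrX; ring.
rewrite e lin_Chat // !(big_ltn (m := 1)) ?ltnS // !(big_ltn (m := 2)) //= !mulr0 !add0r.
rewrite [LHS](eq_big_nat _ _ (F2 := fun i => (3 * 2 ^ i)%:R * const_term (Spoly m i))).
  by ring.
by move=> [|[|[|i]]] // _; rewrite mulr1.
Qed.

(** * Values of power series of polynomial growth *)

(** A class stable under sums and products that contains the constants and all [sA i], and whose
    members converge for [0 < q < 1]. *)
Definition poly_growth (f : fps) : Prop :=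
  exists K C : nat, forall m, `|f m| <= C%:R * m.+1%:R ^+ K.

Lemma poly_growthD f g : poly_growth f -> poly_growth g -> poly_growth (f + g).
Proof.
move=> [K [C fb]] [L [D gb]]; exists (K + L)%N, (C + D)%N => m.
have m1 : 1 <= m.+1%:R :> rat by rewrite ler1n.
rewrite scoefD (le_trans (ler_normD _ _)) // natrD mulrDl lerD //.
  by rewrite (le_trans (fb m)) // ler_wpM2l ?ler0n // ler_weXn2l // leq_addr.
by rewrite (le_trans (gb m)) // ler_wpM2l ?ler0n // ler_weXn2l // leq_addl.
Qed.

Lemma poly_growthM f g : poly_growth f -> poly_growth g -> poly_growth (f * g).
Proof.
move=> [K [C fb]] [L [D gb]]; exists (K + L).+1, (C * D)%N => m.
rewrite scoefM (le_trans (ler_norm_sum _ _ _)) //.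
have le i : (i <= m)%N -> i.+1%:R <= m.+1%:R :> rat by rewrite ler_nat ltnS.
apply: le_trans (_ : \sum_(i < m.+1) C%:R * m.+1%:R ^+ K * (D%:R * m.+1%:R ^+ L) <= _).
  apply: ler_sum => i _; rewrite normrM ler_pM //.
    rewrite (le_trans (fb i)) // ler_wpM2l ?ler0n // lerXn2r ?nnegrE ?ler0n // le // -ltnS //.
  by rewrite (le_trans (gb _)) // ler_wpM2l ?ler0n // lerXn2r ?nnegrE ?ler0n // le // leq_subr.
rewrite sumr_const card_ord -mulr_natr exprS exprD natrM.
by rewrite le_eqVlt; apply/orP; left; apply/eqP; ring.
Qed.

Lemma poly_growthC c : poly_growth (fpsC c).
Proof.
exists 0%N, (Num.bound `|c|) => -[|m]; rewrite expr0 mulr1 /=.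
  by rewrite ltW // archi_boundP.
by rewrite normr0 ler0n.
Qed.

Section Eval.
Variable R : realType.
Implicit Types (q r s : R).

(** Each of the [m + 1] terms of the geometric sum up to [s^m] is at least [s^m]. *)
Lemma expr_linear_bound s m : 0 < s < 1 -> m.+1%:R * s ^+ m <= (1 - s)^-1.
Proof.
move=> /andP[s0 s1].
have s1' : 0 < 1 - s by rewrite subr_gt0.
rewrite -[leRHS]div1r ler_pdivlMr //.
apply: le_trans (_ : (1 - s) * \sum_(i < m.+1) s ^+ i <= _); last first.
  have := subrX1 s m.+1 => /(congr1 -%R); rewrite -mulNr !opprB => <-.
  by rewrite gerBl exprn_ge0 // ltW.
rewrite mulrC ler_pM2l // mulr_natl -[X in _ *+ X](card_ord m.+1) -sumr_const.
by apply: ler_sum => i _; rewrite ler_wiXn2l ?(ltW s0) ?(ltW s1) // -ltnS.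
Qed.

(** The splitting [q = r (q / r)] leaves one geometric factor to absorb polynomial growth and
    another one for convergence. *)
Lemma between q : 0 < q < 1 -> exists2 r, 0 < r < 1 & 0 < q / r < 1.
Proof.
move=> /andP[q0 q1]; exists ((q + 1) / 2); first by apply/andP; split; lra.
have r0 : 0 < (q + 1) / 2 by lra.
by rewrite divr_gt0 //= ltr_pdivrMr // mul1r; lra.
Qed.

Lemma expr_poly_bound K s : 0 < s < 1 ->
  exists2 C, 0 < C & forall m, m.+1%:R ^+ K * s ^+ m <= C.
Proof.
elim: K s => [|K IH] s s01.
  exists 1 => // m; rewrite expr0 mul1r exprn_ile1 ?ltW //; by case/andP: s01.
have [t t01 st01] := between s01; have [C C0 HC] := IH _ st01.
have [[t0 t1] [s0 s1]] : (0 < t /\ t < 1) /\ (0 < s / t /\ s / t < 1).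
  by case/andP: t01; case/andP: st01.
exists ((1 - t)^-1 * C) => [|m]; first by rewrite mulr_gt0 // invr_gt0 subr_gt0.
have -> : m.+1%:R ^+ K.+1 * s ^+ m = (m.+1%:R * t ^+ m) * (m.+1%:R ^+ K * (s / t) ^+ m).
  rewrite expr_div_n exprS; have : t ^+ m != 0 by rewrite expf_neq0 ?gt_eqF.
  by move: (t ^+ m) (s ^+ m) (m.+1%:R ^+ K) => x y z x0; field.
apply: ler_pM; [| |exact: expr_linear_bound|exact: HC].
  by rewrite mulr_ge0 ?ler0n ?exprn_ge0 ?ltW.
by rewrite mulr_ge0 ?exprn_ge0 ?ler0n ?ltW.
Qed.

Lemma poly_growth_bound f q : poly_growth f -> 0 < q < 1 ->
  exists C r, [/\ 0 < C, 0 < r < 1 & forall m, `|ratr (f m) * q ^+ m| <= C * r ^+ m].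
Proof.
move=> [K [C fb]] q01; have [r r01 qr01] := between q01.
have [D D0 HD] := expr_poly_bound K qr01.
have [[r0 r1] [q0 q1]] : (0 < r /\ r < 1) /\ (0 < q / r /\ q / r < 1).
  by case/andP: r01; case/andP: qr01.
exists (C.+1%:R * D), r; split=> // [|m]; first by rewrite mulr_gt0 // ltr0n.
rewrite normrM -ratr_norm normrX (ger0_norm (_ : 0 <= q)); last by case/andP: q01 => /ltW.
have fm : ratr `|f m| <= C.+1%:R * m.+1%:R ^+ K :> R.
  have : `|f m| <= C.+1%:R * m.+1%:R ^+ K.
    by rewrite (le_trans (fb m)) // ler_wpM2r ?exprn_ge0 ?ler0n // ler_nat.
  by rewrite -(ler_rat R) rmorphM rmorphXn /= !ratr_nat.
have -> : q ^+ m = (q / r) ^+ m * r ^+ m by rewrite -exprMn divfK // gt_eqF.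
rewrite mulrA ler_wpM2r ?exprn_ge0 ?(ltW r0) //.
apply: le_trans (_ : C.+1%:R * m.+1%:R ^+ K * (q / r) ^+ m <= _).
  by rewrite ler_wpM2r ?exprn_ge0 ?(ltW q0).
by rewrite -mulrA ler_wpM2l ?ler0n.
Qed.

Definition psum (f : fps) q : nat -> R := series (fun m => ratr (f m) * q ^+ m).
Definition feval (f : fps) q : R := limn (psum f q).

Lemma is_cvg_psum f q : poly_growth f -> 0 < q < 1 -> cvgn (psum f q).
Proof.
move=> fg q01; have [C [r [C0 /andP[r0 r1] fb]]] := poly_growth_bound fg q01.
apply: normed_cvg; apply: (@series_le_cvg _ _ (geometric C r)) => [m|m|m|] //=.
- by rewrite mulr_ge0 ?exprn_ge0 // ltW.
- by apply: is_cvg_geometric_series; rewrite ger0_norm // ltW.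
Qed.

Lemma psumD f g q N : psum (f + g) q N = psum f q N + psum g q N.
Proof.
rewrite /psum /series -big_split; apply: eq_bigr => m _.
by rewrite scoefD rmorphD mulrDl.
Qed.

Lemma fevalD f g q : poly_growth f -> poly_growth g -> 0 < q < 1 ->
  feval (f + g) q = feval f q + feval g q.
Proof.
move=> fg gg q01; rewrite /feval -limD; try exact: is_cvg_psum.
by congr (limn _); apply/funext => N; rewrite psumD.
Qed.

Lemma fevalC c q : feval (fpsC c) q = ratr c.
Proof.
rewrite /feval; apply: (@cvg_lim _ _); first exact: norm_hausdorff.
apply: cvg_near_cst; near=> N.
have N0 : (0 < N)%N by near: N; exists 1%N.
rewrite /psum /series /= big_ltn // mulr1 big_nat big1 ?addr0 // => -[|m] //= _.
by rewrite rmorph0 mul0r.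
Unshelve. all: by end_near. Qed.


Lemma sum_triangle (G : nat -> nat -> R) N :
  \sum_(m < N) \sum_(i < m.+1) G i (m - i)%N = \sum_(i < N) \sum_(0 <= j < N - i) G i j.
Proof.
elim: N => [|N IH]; first by rewrite !big_ord0.
rewrite big_ord_recr IH [RHS]big_ord_recr /= subSnn big_nat1.
rewrite [\sum_(i < N.+1) _]big_ord_recr /= subnn addrA -big_split /=; congr (_ + _).
by apply: eq_bigr => i _; rewrite subSn ?big_nat_recr //= ltnW.
Qed.

Lemma psumM f g q N : psum f q N * psum g q N - psum (f * g) q N =
  \sum_(i < N) \sum_(N - i <= j < N) (ratr (f i) * q ^+ i) * (ratr (g j) * q ^+ j).
Proof.
pose G i j := (ratr (f i) * q ^+ i) * (ratr (g j) * q ^+ j).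
have -> : psum (f * g) q N = \sum_(i < N) \sum_(0 <= j < N - i) G i j.
  rewrite -sum_triangle [LHS]big_mkord; apply: eq_bigr => m _.
  rewrite scoefM rmorph_sum mulr_suml; apply: eq_bigr => i _; rewrite rmorphM /G.
  have -> : q ^+ m = q ^+ i * q ^+ (m - i) by rewrite -exprD subnKC // -ltnS.
  by rewrite mulrACA.
have -> : psum f q N * psum g q N = \sum_(i < N) \sum_(0 <= j < N) G i j.
  rewrite /psum /series /= big_mkord mulr_suml; apply: eq_bigr => i _.
  by rewrite mulr_sumr.
rewrite -sumrB; apply: eq_bigr => i _.
by rewrite (big_cat_nat (leq0n _) (leq_subr i N)) /= addrAC subrr add0r.
Qed.

(** The difference is the part [i + j >= N] of the square [i, j < N]: at most [N^2] terms of size at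
    most [C D r^N]. *)
Lemma psumM_cvg0 f g q : poly_growth f -> poly_growth g -> 0 < q < 1 ->
  ((fun N => psum f q N * psum g q N - psum (f * g) q N) @ \oo --> (0 : R))%classic.
Proof.
move=> fg gg q01.
have [C [r1 [C0 r101 fb]]] := poly_growth_bound fg q01.
have [D [r2 [D0 r201 gb]]] := poly_growth_bound gg q01.
pose r := Num.max r1 r2.
have [[r10 r11] [r20 r21]] : (0 < r1 /\ r1 < 1) /\ (0 < r2 /\ r2 < 1).
  by case/andP: r101; case/andP: r201.
have r01 : 0 < r < 1 by rewrite /r lt_max r10 /= gt_max r11.
have r0 : 0 < r by case/andP: r01.
have [t t01 rt01] := between r01; have [E E0 HE] := expr_poly_bound 2 rt01.
have [t0 t1] : 0 < t /\ t < 1 by case/andP: t01.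
have bound N : `|psum f q N * psum g q N - psum (f * g) q N| <= geometric (C * D * E) t N.
  rewrite psumM /geometric /=.
  apply: le_trans (_ : \sum_(i < N) \sum_(N - i <= j < N) C * D * r ^+ N <= _).
    apply: le_trans (ler_norm_sum _ _ _) _; apply: ler_sum => i _.
    apply: le_trans (ler_norm_sum _ _ _) _; rewrite !big_nat; apply: ler_sum => j /andP[ij jN].
    have ijN : (N <= i + j)%N by rewrite -leq_subLR.
    apply: le_trans (_ : C * r ^+ i * (D * r ^+ j) <= _).
      rewrite normrM ler_pM //.
        by rewrite (le_trans (fb i)) // ler_wpM2l ?(ltW C0) // lerXn2r ?nnegrE ?(ltW r10) ?(ltW r0) // /r le_max lexx.
      by rewrite (le_trans (gb j)) // ler_wpM2l ?(ltW D0) // lerXn2r ?nnegrE ?(ltW r20) ?(ltW r0) // /r le_max lexx orbT.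
    rewrite mulrACA -exprD ler_wpM2l ?mulr_ge0 ?(ltW C0) ?(ltW D0) //.
    by rewrite ler_wiXn2l ?(ltW r0) //; case/andP: r01 => _ /ltW.
  apply: le_trans (_ : C * D * (N.+1%:R ^+ 2 * r ^+ N) <= _).
    apply: le_trans (_ : \sum_(i < N) C * D * r ^+ N *+ N <= _).
      apply: ler_sum => i _; rewrite big_const_nat iter_addr_0.
      by apply: ler_wpMn2l; rewrite ?leq_subr // mulr_ge0 ?exprn_ge0 ?mulr_ge0 ?(ltW C0) ?(ltW D0) ?(ltW r0).
    rewrite sumr_const card_ord -mulrnA -[leLHS]mulr_natl [leLHS]mulrCA.
    rewrite ler_wpM2l ?mulr_ge0 ?(ltW C0) ?(ltW D0) // ler_wpM2r ?exprn_ge0 ?(ltW r0) // natrM expr2.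
    by rewrite ler_pM ?ler0n // ler_nat.
  have -> : r ^+ N = (r / t) ^+ N * t ^+ N by rewrite -exprMn divfK // gt_eqF.
  rewrite -[leRHS]mulrA ler_wpM2l ?mulr_ge0 ?(ltW C0) ?(ltW D0) // [leLHS]mulrA.
  by rewrite ler_wpM2r ?exprn_ge0 ?(ltW t0).
have g0 : (geometric (C * D * E) t @ \oo --> (0 : R))%classic by apply: cvg_geometric; rewrite ger0_norm ?ltW.
apply/cvgr0Pnorm_le => e e0; move/cvgr0Pnorm_le: g0 => /(_ e e0) g0.
near=> N; apply: le_trans (bound N) _; apply: le_trans (ler_norm _) _.
by near: N.
Unshelve. all: by end_near. Qed.

Lemma fevalM f g q : poly_growth f -> poly_growth g -> 0 < q < 1 ->
  feval (f * g) q = feval f q * feval g q.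
Proof.
move=> fg gg q01; rewrite /feval.
apply: (@cvg_lim _ _); first exact: norm_hausdorff.
have -> : psum (f * g) q = (fun N => psum f q N * psum g q N
   - (psum f q N * psum g q N - psum (f * g) q N)).
  by apply/funext => N; rewrite opprB addrC subrK.
rewrite -[limn (psum f q) * _]subr0; apply: cvgB; last exact: psumM_cvg0.
by apply: cvgM; apply: is_cvg_psum.
Qed.

(** Identity theorem at 0: if [m] is the order of [f], the tail beyond [m] is of size [q^(m+1)]
    uniformly for [q <= 1/2], which forces [|f_m| <= q B] for arbitrarily small [q]. *)
Lemma feval_eq0 f : poly_growth f -> (forall q, 0 < q < 1 -> feval f q = 0) -> f = 0.
Proof.
move=> fg f0; apply/eqP; apply: contraT => /sord_exists[m fm fm0].
have h01 : 0 < (2^-1 : R) < 1 by apply/andP; split; lra.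
have [C [r [C0 /andP[r0 r1] fb]]] := poly_growth_bound fg h01.
(* For [i > m] and [q <= 1/2], [|f_i| q^i <= (2 q)^(m+1) |f_i| 2^(-i) <= (2 q)^(m+1) C r^i]; summing
   over [i] gives [q^(m+1) B]. *)
pose B := 2 ^+ m.+1 * (C / (1 - r)).
have r1' : 0 < 1 - r by rewrite subr_gt0.
have B0 : 0 < B by rewrite /B !mulr_gt0 ?invr_gt0 ?exprn_gt0.
have key q : 0 < q <= 2^-1 -> `|ratr (f m) : R| <= q * B.
  move=> /andP[q0 q1].
  suff : `|ratr (f m) * q ^+ m| <= q * B * q ^+ m.
    by rewrite normrM (ger0_norm (exprn_ge0 m (ltW q0))) ler_pM2r // exprn_gt0.
  have q01 : 0 < q < 1 by apply/andP; split => //; lra.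
  have cv : (psum f q @ \oo --> (0 : R))%classic.
    by rewrite -(f0 q q01); exact: is_cvg_psum.
  apply/ler_addgt0Pl => e e0; move/cvgr0Pnorm_le: cv => /(_ e e0) [N _ HN].
  pose M := (N + m.+1)%N.
  have {}HN : `|psum f q M| <= e by apply: HN; rewrite /= /M leq_addr.
  have mM : (m < M)%N by rewrite /M leq_addl.
  pose c := ratr (f m) * q ^+ m; pose tl := \sum_(m.+1 <= i < M) ratr (f i) * q ^+ i.
  have pE : psum f q M = c + tl.
    have z0 : \sum_(0 <= i < m) ratr (f i) * q ^+ i = 0.
      by rewrite big_nat big1 // => i im; rewrite (fm _ im) rmorph0 mul0r.
    by rewrite [LHS](big_cat_nat (leq0n m) (ltnW mM)) [X in X + _ = _]z0 add0r big_ltn.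
  have tlB : `|tl| <= q * B * q ^+ m.
    apply: le_trans (ler_norm_sum _ _ _) _.
    apply: le_trans (_ : \sum_(m.+1 <= i < M) q ^+ m.+1 * 2 ^+ m.+1 * (C * r ^+ i) <= _).
      rewrite !big_nat; apply: ler_sum => i /andP[mi _].
      apply: le_trans (_ : q ^+ m.+1 * 2 ^+ m.+1 * `|ratr (f i) * 2^-1 ^+ i| <= _); last first.
        by rewrite ler_wpM2l // mulr_ge0 ?exprn_ge0 ?(ltW q0).
      rewrite [leLHS]normrM [X in _ <= _ * X]normrM !normrX (ger0_norm (ltW q0)).
      rewrite (ger0_norm (_ : 0 <= 2^-1)) ?invr_ge0 // mulrCA ler_wpM2l // -(subnKC mi).
      move: (i - m.+1)%N => l.
      have -> : q ^+ m.+1 * 2 ^+ m.+1 * 2^-1 ^+ (m.+1 + l) = q ^+ m.+1 * 2^-1 ^+ l :> R.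
        by rewrite exprD mulrA -[q ^+ _ * _ * _]mulrA -exprMn mulfV ?pnatr_eq0 // expr1n mulr1.
      rewrite exprD ler_wpM2l ?exprn_ge0 ?(ltW q0) // lerXn2r ?nnegrE ?invr_ge0 ?(ltW q0) //.
    rewrite -mulr_sumr -mulr_sumr exprS /B.
    have -> : q * (2 ^+ m.+1 * (C / (1 - r))) * q ^+ m = q * q ^+ m * 2 ^+ m.+1 * (C * (1 - r)^-1) by ring.
    rewrite ler_wpM2l ?mulr_ge0 ?exprn_ge0 ?(ltW q0) // ler_wpM2l ?(ltW C0) //.
    apply: le_trans (_ : \sum_(0 <= i < M) r ^+ i <= _).
      rewrite (big_cat_nat (leq0n m.+1) mM) /=.
      by rewrite lerDr sumr_ge0 // => i _; rewrite exprn_ge0 ?(ltW r0).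
    rewrite -[leRHS]div1r ler_pdivlMr // big_mkord.
    have := subrX1 r M => /(congr1 -%R); rewrite -mulNr !opprB mulrC => <-.
    by rewrite gerBl exprn_ge0 // ltW.
  have -> : ratr (f m) * q ^+ m = psum f q M - tl by rewrite pE addrK.
  by apply: le_trans (ler_normB _ _) _; exact: lerD.
have fm0' : 0 < `|ratr (f m) : R| by rewrite normr_gt0 fmorph_eq0.
pose a := `|ratr (f m) : R|.
(* With this choice [q B <= a / 2], which contradicts [a <= q B]. *)
pose q := Num.min 2^-1 (a / (2 * B)).
have B2 : 0 < 2 * B by rewrite mulr_gt0.
have q0 : 0 < q by rewrite lt_min invr_gt0 ltr0n /=; exact: (divr_gt0 fm0' B2).
have [q1 q2] : q <= 2^-1 /\ q <= a / (2 * B) by split; rewrite ge_min lexx ?orbT.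
have := key q; rewrite q0 q1 => /(_ isT).
rewrite leNgt; case/negP.
apply: le_lt_trans (_ : a / (2 * B) * B < _); first by rewrite ler_pM2r //; exact: q2.
have -> : a / (2 * B) * B = a / 2 by field; rewrite gt_eqF.
by rewrite -/a in fm0' *; lra.
Qed.

End Eval.

(** * The series A_i and the Eisenstein series P, Q, R *)

Definition sA (i : nat) : fps := Fps (fun m => m%:R ^+ i * sigma0 m).

Lemma sD_sA i : sD (sA i) = sA i.+1.
Proof. by apply: fpsP => n; rewrite sDE /= exprS mulrA. Qed.

Lemma sigma_le m : (0 < m)%N -> (sigma m <= m.+1 ^ 2)%N.
Proof.
move=> m0; rewrite /sigma big_seq.
apply: leq_trans (_ : \sum_(d <- divisors m | d \in divisors m) m.+1 <= _)%N.
  apply: leq_sum => d; rewrite -dvdn_divisors // => /(dvdn_leq m0) dm.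
  exact: leqW.
rewrite -big_seq big_const_seq count_predT iter_addn_0 -mulnn leq_mul2l /=.
rewrite -[X in (_ <= X)%N](size_iota 0); apply: uniq_leq_size (divisors_uniq m) _ => d.
by rewrite -dvdn_divisors // mem_iota add0n ltnS => /(dvdn_leq m0).
Qed.

Lemma poly_growth_sA i : poly_growth (sA i).
Proof.
exists (i + 2)%N, 1%N => m; rewrite mul1r exprD ger0_norm; last first.
  by rewrite /= mulr_ge0 ?exprn_ge0 //; case: m => [|m] //=; rewrite ler0n.
rewrite /= ler_pM ?exprn_ge0 //; first by case: m => [|m] //=; rewrite ler0n.
  by rewrite lerXn2r ?nnegrE ?ler0n // ler_nat.
case: m => [|m]; first by rewrite exprn_ge0.
by rewrite -natrX ler_nat sigma_le.
Qed.

Lemma Aser_feval (R : realType) i (q : R) : Aser i q = feval (sA i) q.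
Proof.
rewrite /Aser /feval; congr (limn _); apply/funext => -[|N].
  by rewrite [LHS]big_geq // [RHS]big_geq.
rewrite [RHS]big_ltn // [X in _ = X + _](_ : _ = 0); last first.
  by rewrite /= mulr0 rmorph0 mul0r.
rewrite add0r !big_nat; apply: eq_bigr => -[|m] //= _.
by rewrite rmorphM rmorphXn /= !ratr_nat.
Qed.

Lemma peval_feval (R : realType) (I : choiceType) (x : I -> fps) (q : R) p :
  0 < q < 1 -> (forall i, poly_growth (x i)) ->
  poly_growth (peval fpsC x p) /\
  reval (fun i => feval (x i) q) p = feval (peval fpsC x p) q.
Proof.
move=> q01 gx.
have rE : @reval R I (fun i => feval (x i) q) =
  peval (ratr : {rmorphism rat -> R}) (fun i => feval (x i) q) by [].
rewrite rE; elim/malg_poly_ind: p => [c|i|p r [gp Ep] [gr Er]|p r [gp Ep] [gr Er]].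
- by rewrite !pevalC; split; [exact: poly_growthC|rewrite fevalC].
- by rewrite !pevalU; split.
- by rewrite !rmorphD /= fevalD // Ep Er; split=> //; apply: poly_growthD.
- by rewrite !rmorphM /= fevalM // Ep Er; split=> //; apply: poly_growthM.
Qed.

Lemma reval_Aser (R : realType) (I : choiceType) (k : I -> nat) (q : R) p :
  0 < q < 1 ->
  reval (fun i => Aser (k i) q) p = feval (peval fpsC (fun i => sA (k i)) p) q.
Proof.
move=> q01; have [_ <-] := peval_feval p q01 (fun i => poly_growth_sA (k i)).
by apply: eq_peval => i; rewrite Aser_feval.
Qed.

Lemma chazy : sA 3 = sA 2 - 24%:R * (sA 0 * sA 2) + 36%:R * sA 1 ^+ 2.
Proof.
apply: fpsP => n; have vdp := van_der_pol n.
pose s (u : nat -> nat -> rat) := \sum_(k < n.+1) u k (n - k)%N * sigma0 k * sigma0 (n - k).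
have sC u : s u = s (fun k l => u l k).
  rewrite /s (reindex_inj rev_ord_inj) /=; apply: eq_bigr => k _.
  by rewrite subSS (subKn (leq_ord k)) mulrAC.
have e02 : (sA 0 * sA 2) n = s (fun k l => l%:R ^+ 2).
  by rewrite scoefM; apply: eq_bigr => k _; rewrite /= expr0 mul1r mulrCA mulrA.
have e11 : (sA 1 ^+ 2) n = s (fun k l => k%:R * l%:R).
  by rewrite expr2 scoefM; apply: eq_bigr => k _; rewrite /= !expr1 mulrACA mulrA.
have natC m : m%:R = fpsC m%:R by rewrite rmorph_nat.
rewrite scoefD scoefB !natC !scoef_fpsCM e02 e11.
(* Van der Pol's identity is symmetric in [k] and [n - k], so the coefficient of [A_0 A_2] is
   symmetrized. *)
have e20 : s (fun k l => l%:R ^+ 2) = 2^-1 * (s (fun k l => l%:R ^+ 2) + s (fun k l => k%:R ^+ 2)).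
  by rewrite [X in _ + X]sC; field.
have key : 12%:R * (3 * s (fun k l => k%:R * l%:R) - s (fun k l => k%:R ^+ 2) - s (fun k l => l%:R ^+ 2))
   = (n%:R ^+ 3 - n%:R ^+ 2) * sigma0 n.
  transitivity (12%:R * ((n%:R ^+ 3 - n%:R ^+ 2) * sigma0 n / 12%:R) : rat); last by field.
  rewrite -vdp; congr (_ * _); rewrite /s mulr_sumr -!sumrB; apply: eq_bigr => k _; ring.
rewrite /= e20; move: key; rewrite mulrBl.
move: (s _) (s _) (s _) => a b c key; lra.
Qed.

Definition triple (T : Type) (a b c : T) (i : 'I_3) : T :=
  match val i with 0 => a | 1 => b | _ => c end%N.

Lemma tripleE (T : Type) (a b c : T) :
  (triple a b c 0 = a) * (triple a b c 1 = b) * (triple a b c 2%:R = c).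
Proof. by []. Qed.

Lemma ord3P (P : 'I_3 -> Prop) : P 0 -> P 1 -> P 2%:R -> forall i, P i.
Proof.
move=> P0 P1 P2 [[|[|[|//]]] i3].
- by rewrite (_ : Ordinal i3 = 0) //; apply: val_inj.
- by rewrite (_ : Ordinal i3 = 1) //; apply: val_inj.
- by rewrite (_ : Ordinal i3 = 2%:R) //; apply: val_inj.
Qed.

Notation T3 := {poly {poly {poly rat}}}.
Definition constT (c : rat) : T3 := c%:P%:P%:P.
HB.instance Definition _ := GRing.RMorphism.copy constT (polyC \o (polyC \o polyC)).

Lemma mon_eval_triple (S : comNzRingType) (r s t : S) (k : cmonom 'I_3) :
  mon_eval (triple (r * s) (r ^+ 2 * t) (r ^+ 3 * t)) k =
  r ^+ (k 0%R + 2 * k 1%R + 3 * k 2%:R) * s ^+ k 0%R * t ^+ (k 1%R + k 2%:R).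
Proof.
elim/cmonom_ind: k => [|i k IH].
  by rewrite mon_eval1 !onecmE !expr0 !mulr1.
rewrite mon_evalM mon_evalU IH !mulcmE !ucmE; move: (k _) (k _) (k _) => a b c.
elim/ord3P: i; rewrite /triple /= ?add0n.
- by rewrite !exprD expr1; ring.
- by rewrite !mulnDr !exprD expr1; ring.
- by rewrite !mulnDr !exprD expr1; ring.
Qed.

(* [P = p rho], [Q = tau rho^2], [R = tau rho^3]: distinct monomials in
   [P, Q, R] give distinct monomials in [tau, p, rho]. *)
Definition mono : 'I_3 -> T3 :=
  triple ('X * 'X%:P) ('X ^+ 2 * 'X%:P%:P) ('X ^+ 3 * 'X%:P%:P).

Lemma constT_monomial c a b d :
  constT c * ('X ^+ a * 'X%:P ^+ b * 'X%:P%:P ^+ d) =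
  ((c%:P * 'X ^+ d)%:P * 'X ^+ b)%:P * 'X^a.
Proof.
rewrite /constT [in RHS]polyCM [(c%:P * _)%:P]polyCM [(c%:P%:P * _)%:P]polyCM.
rewrite !polyC_exp; move: (c%:P%:P%:P) ('X%:P%:P) ('X%:P) 'X => C T S0 X.
have gen (A : comNzRingType) (u x y z : A) : u * (x * y * z) = u * z * y * x by ring.
exact: gen.
Qed.

Lemma peval_mono_neq0 (F : QY) : F != 0 -> peval constT mono F != 0.
Proof.
move=> F0; have [k0 Fk0] : exists k0, F@_k0 != 0.
  apply: contrapT => /forallNP F00; case/eqP: F0; apply/malgP => k.
  by rewrite mcoeff0; apply/eqP/negPn/negP; exact: F00.
apply: contra Fk0 => /eqP pF0.
pose cf (H : T3) : rat :=
  H`_(k0 0%R + 2 * k0 1%R + 3 * k0 2%:R)`_(k0 0%R)`_(k0 1%R + k0 2%:R).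
have <- : cf (peval constT mono F) = F@_k0; last by rewrite pF0 /cf !coef0.
rewrite pevalE [in RHS](monalgE F) raddf_sum /cf !coef_sum /=.
apply: eq_bigr => k _; rewrite mcoeffU mon_eval_triple.
have -> : constT F@_k * ('X ^+ (k 0%R + 2 * k 1%R + 3 * k 2%:R) * 'X%:P ^+ k 0%R * 'X%:P%:P ^+ (k 1%R + k 2%:R))
  = (((F@_k)%:P * 'X ^+ (k 1%R + k 2%:R))%:P * 'X ^+ k 0%R)%:P * 'X^(k 0%R + 2 * k 1%R + 3 * k 2%:R).
  exact: constT_monomial.
rewrite coefCM coefXn mulr_natr !coefMn coefCM coefXn mulr_natr coefMn coefCM coefXn mulr_natr.
rewrite -!mulrnA; congr (_ *+ _).
rewrite [k == k0](_ : _ = [&& k0 0%R + 2 * k0 1%R + 3 * k0 2%:R == k 0%R + 2 * k 1%R + 3 * k 2%:R,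
   k0 0%R == k 0%R & k0 1%R + k0 2%:R == k 1%R + k 2%:R])%N; last first.
  apply/eqP/and3P => [->|[/eqP e1 /eqP e2 /eqP e3]]; first by rewrite !eqxx.
  apply/eqP/cmP.
  have lin3 a b c a' b' c' : (a' + 2 * b' + 3 * c' = a + 2 * b + 3 * c -> a' = a ->
    b' + c' = b + c -> [/\ a = a', b = b' & c = c'])%N by move=> *; split; lia.
  by have [E0 E1 E2] := lin3 _ _ _ _ _ _ e1 e2 e3; apply: ord3P.
by do 3 case: (_ == _).
Qed.

Lemma sD_natM n (f : fps) : sD (n%:R * f) = n%:R * sD f.
Proof. by rewrite !mulr_natl raddfMn. Qed.

(* Ramanujan's [12 D P = P^2 - Q] and [3 D Q = P Q - R] determine [Q] and [R]
   from [P]. *)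
Definition sP : fps := 1 - 24%:R * sA 0.
Definition sQ : fps := sP ^+ 2 + 288%:R * sA 1.
Definition sR : fps := sP ^+ 3 + 432%:R * (sP * sA 1) - 864%:R * sA 2.

Lemma sD_sPE : sD sP = - 24%:R * sA 1.
Proof. by rewrite /sP raddfB /= sD1 sD_natM sD_sA sub0r mulNr. Qed.

Lemma sD_sP : 12%:R * sD sP = sP ^+ 2 - sQ.
Proof. by rewrite sD_sPE /sQ; move: sP (sA 1) => p a; ring. Qed.

Lemma sD_sQ : 3%:R * sD sQ = sP * sQ - sR.
Proof.
rewrite {1}/sQ raddfD /= sD_natM sD_sA expr2 sDM sD_sPE /sR /sQ.
by move: sP (sA 1) (sA 2) => p a b; ring.
Qed.

Lemma sD_sR : 2%:R * sD sR = sP * sR - sQ ^+ 2.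
Proof.
have A3 : sA 3 = sP * sA 2 + 36%:R * sA 1 ^+ 2.
  by rewrite chazy /sP; move: (sA 0) (sA 1) (sA 2) => x y z; ring.
rewrite {1}/sR raddfB raddfD /= !sD_natM !sD_sA A3 exprS expr2 !sDM !sD_sPE !sD_sA /sR /sQ.
by move: sP (sA 1) (sA 2) => p a b; ring.
Qed.

(** With [Q = r^2 t] and [R = r^3 t], the combination [r (3 D Q) - 2 D R] eliminates [dr] and yields
    [dt]; then [dr] and [dp] follow by cancelling [r] and [t]. *)
Lemma projective_ramanujan (A : idomainType) (r t p dr dt dp : A) :
  r != 0 -> t != 0 ->
  12%:R * (dp * r + p * dr) = (p * r) ^+ 2 - r ^+ 2 * t ->
  3%:R * (2%:R * r * dr * t + r ^+ 2 * dt) = p * r * (r ^+ 2 * t) - r ^+ 3 * t ->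
  2%:R * (3%:R * r ^+ 2 * dr * t + r ^+ 3 * dt) =
    p * r * (r ^+ 3 * t) - (r ^+ 2 * t) ^+ 2 ->
  [/\ 12%:R * dt = r * (12%:R * (t ^+ 2 - t)),
      12%:R * dp = r * (- p ^+ 2 + (6%:R * t - 4%:R) * p - t) &
      12%:R * dr = r ^+ 2 * (2%:R * p - 6%:R * t + 4%:R)].
Proof.
move=> r0 t0 E1 E2 E3.
have dtE : dt = r * (t ^+ 2 - t).
  apply: (mulfI (expf_neq0 3 r0)).
  have -> : r ^+ 3 * dt = r * (3%:R * (2%:R * r * dr * t + r ^+ 2 * dt))
     - 2%:R * (3%:R * r ^+ 2 * dr * t + r ^+ 3 * dt) by ring.
  by rewrite E2 E3; ring.
have drE : 6%:R * dr = r ^+ 2 * (p - 3%:R * t + 2%:R).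
  apply: (mulfI (mulf_neq0 r0 t0)).
  have -> : r * t * (6%:R * dr) = 3%:R * (2%:R * r * dr * t + r ^+ 2 * dt)
    - 3%:R * r ^+ 2 * dt by ring.
  by rewrite E2 dtE; ring.
have drE' : 12%:R * dr = r ^+ 2 * (2%:R * p - 6%:R * t + 4%:R).
  have -> : 12%:R * dr = 2%:R * (6%:R * dr) by ring.
  by rewrite drE; ring.
split=> //; first by rewrite dtE; ring.
apply: (mulfI r0).
have -> : r * (12%:R * dp) = 12%:R * (dp * r + p * dr) - p * (12%:R * dr) by ring.
by rewrite E1 drE'; ring.
Qed.

Lemma scoef1M (f g : fps) : (f * g) 1%N = f 0%N * g 1%N + f 1%N * g 0%N.
Proof. by rewrite scoefM !big_ord_recl big_ord0 addr0. Qed.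

Lemma natr_fpsC n : n%:R = fpsC n%:R.
Proof. by rewrite rmorph_nat. Qed.

Lemma sA0 i : sA i 0%N = 0.
Proof. by rewrite /= mulr0. Qed.
Lemma sA1 i : sA i 1%N = 1.
Proof. by rewrite /= expr1n mul1r /sigma /= big_seq1. Qed.

Lemma sP_coef : sP 0%N = 1 /\ sP 1%N = - 24%:R.
Proof.
by rewrite /sP !scoefB !natr_fpsC !scoef_fpsCM sA0 sA1 !scoef1 mulr0 mulr1 subr0 sub0r.
Qed.

Lemma sQ_coef : sQ 0%N = 1 /\ sQ 1%N = 240%:R.
Proof.
have [p0 p1] := sP_coef.
rewrite /sQ !scoefD natr_fpsC !scoef_fpsCM sA0 sA1 expr2 scoef0M scoef1M p0 p1.
by split; ring.
Qed.

Lemma sR_coef : sR 0%N = 1 /\ sR 1%N = - 504%:R.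
Proof.
have [p0 p1] := sP_coef.
rewrite /sR !scoefB !scoefD !natr_fpsC !scoef_fpsCM sA0 sA1 exprS expr2.
rewrite !scoef0M !scoef1M !scoef0M p0 p1 sA0 sA1.
by split; ring.
Qed.

(** The coefficients of [q] are 720 and -1008; hence [tau] is not constant. *)
Lemma sQ3_neq_sR2 : sQ ^+ 3 != sR ^+ 2.
Proof.
have [q0 q1] := sQ_coef; have [r0 r1] := sR_coef.
apply/eqP => /(congr1 (fun f : fps => f 1%N)).
by rewrite exprS !expr2 !scoef1M scoef0M q0 q1 r0 r1; lra.
Qed.

Lemma eisenstein_fields : exists rho tau p : fps,
  [/\ rho 0%N = 1, tau 0%N = 1, tau != 1 &
   [/\ sP = p * rho, sQ = rho ^+ 2 * tau & sR = rho ^+ 3 * tau]].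
Proof.
have [p0 _] := sP_coef; have [q0 _] := sQ_coef; have [r0 _] := sR_coef.
have Qu := series_unit q0; have Ru := series_unit r0.
have inv0 (f : fps) : f 0%N = 1 -> f^-1 0%N = 1.
  move=> f0; have := congr1 (fun g : fps => g 0%N) (mulrV (series_unit f0)).
  by rewrite scoef0M f0 mul1r.
pose qi := sQ^-1; pose ri := sR^-1.
have qi1 : sQ * qi = 1 := mulrV Qu.
have ri1 : sR * ri = 1 := mulrV Ru.
exists (sR * qi), (sQ ^+ 3 * ri ^+ 2), (sP * sQ * ri); split.
- by rewrite scoef0M r0 inv0 // mulr1.
- by rewrite exprS !expr2 !scoef0M q0 inv0 // !mulr1.
- apply: contraNneq sQ3_neq_sR2 => E.
  have -> : sQ ^+ 3 = sQ ^+ 3 * (sR * ri) ^+ 2 by rewrite ri1 expr1n mulr1.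
  by rewrite exprMn mulrCA E mulr1.
have gen (A : comNzRingType) (P Q R q r : A) : Q * q = 1 -> R * r = 1 ->
  [/\ P = P * Q * r * (R * q), Q = (R * q) ^+ 2 * (Q ^+ 3 * r ^+ 2) &
      R = (R * q) ^+ 3 * (Q ^+ 3 * r ^+ 2)].
  move=> Eq Er; split.
  - have -> : P * Q * r * (R * q) = P * ((Q * q) * (R * r)) by ring.
    by rewrite Eq Er !mulr1.
  - have -> : (R * q) ^+ 2 * (Q ^+ 3 * r ^+ 2) = Q * ((Q * q) ^+ 2 * (R * r) ^+ 2) by ring.
    by rewrite Eq Er !expr1n !mulr1.
  - have -> : (R * q) ^+ 3 * (Q ^+ 3 * r ^+ 2) = R * ((Q * q) ^+ 3 * (R * r) ^+ 2) by ring.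
    by rewrite Eq Er !expr1n !mulr1.
exact: gen.
Qed.

(** * Passage between the series [A_0, A_1, A_2] and the Eisenstein series *)

Section Coordinates.
Variables (S : comNzRingType) (cf : {rmorphism rat -> S}).

Definition eis (a : 'I_3 -> S) : 'I_3 -> S :=
  triple (1 - 24%:R * a 0) ((1 - 24%:R * a 0) ^+ 2 + 288%:R * a 1)
    ((1 - 24%:R * a 0) ^+ 3 + 432%:R * ((1 - 24%:R * a 0) * a 1) - 864%:R * a 2%:R).

(** The inverse of the triangular substitution [eis]; its last line is
    [3 P Q - P^3 - 2 R = 1728 A_2]. *)
Definition uneis (b : 'I_3 -> S) : 'I_3 -> S :=
  triple (cf 24%:R^-1 * (1 - b 0)) (cf 288%:R^-1 * (b 1 - b 0 ^+ 2))
    (cf 1728%:R^-1 * (3%:R * (b 0 * b 1) - b 0 ^+ 3 - 2%:R * b 2%:R)).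

Lemma eisK a i : uneis (eis a) i = a i.
Proof.
have cfK n : cf n.+1%:R^-1 * n.+1%:R = 1.
  by rewrite -[X in _ * X](rmorph_nat cf) -rmorphM mulVf ?rmorph1 // pnatr_eq0.
have g0 (d x : S) : d * 24%:R = 1 -> d * (1 - (1 - 24%:R * x)) = x.
  by move=> dE; rewrite -[RHS]mul1r -[in RHS]dE; ring.
have g1 (d u y : S) : d * 288%:R = 1 -> d * (u ^+ 2 + 288%:R * y - u ^+ 2) = y.
  by move=> dE; rewrite -[RHS]mul1r -[in RHS]dE; ring.
have g2 (d u y z : S) : d * 1728%:R = 1 ->
    d * (3%:R * (u * (u ^+ 2 + 288%:R * y)) - u ^+ 3
      - 2%:R * (u ^+ 3 + 432%:R * (u * y) - 864%:R * z)) = z.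
  by move=> dE; rewrite -[RHS]mul1r -[in RHS]dE; ring.
elim/ord3P: i; rewrite /uneis /eis !tripleE.
- exact: (g0 _ _ (cfK 23%N)).
- exact: (g1 _ _ _ (cfK 287%N)).
- exact: (g2 _ _ _ _ (cfK 1727%N)).
Qed.

End Coordinates.

Lemma rmorph_uneis (S T : comNzRingType) (f : {rmorphism S -> T})
    (cf : {rmorphism rat -> S}) (cg : {rmorphism rat -> T}) b i :
  (forall c, f (cf c) = cg c) ->
  f (uneis cf b i) = uneis cg (fun i => f (b i)) i.
Proof.
move=> fc; elim/ord3P: i; rewrite /uneis !tripleE.
- by rewrite [LHS](rmorphM f) fc (rmorphB f) (rmorph1 f).
- by rewrite [LHS](rmorphM f) fc (rmorphB f) (rmorphXn f).
- by rewrite [LHS](rmorphM f) fc !(rmorphB f) (rmorphXn f) !(rmorphM f) !(rmorph_nat f).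
Qed.

Lemma peval_id (I : choiceType) (F : {malg rat[cmonom I]}) :
  peval (@malgC _ rat) (fun i => << ucm i >>) F = F.
Proof.
elim/malg_poly_ind: F => [c|i|p q IHp IHq|p q IHp IHq].
- exact: (pevalC _ (@malgC _ rat : {rmorphism rat -> {malg rat[cmonom I]}})).
- exact: (pevalU _ (@malgC _ rat : {rmorphism rat -> {malg rat[cmonom I]}})).
- by rewrite [LHS](rmorphD (peval (@malgC _ rat : {rmorphism rat -> {malg rat[cmonom I]}}) _)) /= IHp IHq.
- by rewrite [LHS](rmorphM (peval (@malgC _ rat : {rmorphism rat -> {malg rat[cmonom I]}}) _)) /= IHp IHq.
Qed.

Definition to_eis (F : QY) : QY :=
  peval (@malgC _ rat) (uneis (@malgC _ rat) (fun i => << ucm i >>)) F.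

Lemma peval_to_eis (S : comNzRingType) (cf : {rmorphism rat -> S}) a F :
  peval cf (eis a) (to_eis F) = peval cf a F.
Proof.
rewrite /to_eis.
have h c : peval cf (eis a) (malgC c) = cf c by apply: pevalC.
rewrite [LHS](@peval_comp _ _ _ (peval cf (eis a)) _ cf _ F h).
apply: eq_peval => i.
rewrite (@rmorph_uneis _ _ (peval cf (eis a)) _ cf _ i h) -[RHS](eisK cf a).
by congr (uneis cf _ i); apply/funext => j; exact: pevalU.
Qed.

Lemma to_eis_neq0 F : F != 0 -> to_eis F != 0.
Proof.
apply: contra_neq => F0.
have := peval_to_eis (@malgC _ rat : {rmorphism rat -> QY}) (fun i => << ucm i >>) F.
rewrite F0 => E; rewrite -(peval_id F) -[LHS]E.
exact: (rmorph0 (peval (@malgC _ rat : {rmorphism rat -> QY}) _)).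
Qed.

Theorem sA_independent (F : QY) : F != 0 ->
  peval fpsC (fun i : 'I_3 => sA i) F != 0.
Proof.
move=> F0; have [rho [tau [p [rho0 tau0 tau1 [eP eQ eR]]]]] := eisenstein_fields.
have rho_n0 : rho != 0 by apply/eqP => r0; move: rho0; rewrite r0 scoef0 => /eqP; rewrite eq_sym oner_eq0.
have tau_n0 : tau != 0 by apply/eqP => r0; move: tau0; rewrite r0 scoef0 => /eqP; rewrite eq_sym oner_eq0.
have [E1 E2 E3] : [/\ 12%:R * (sD p * rho + p * sD rho) = (p * rho) ^+ 2 - rho ^+ 2 * tau,
  3%:R * (2%:R * rho * sD rho * tau + rho ^+ 2 * sD tau) = p * rho * (rho ^+ 2 * tau) - rho ^+ 3 * tau &
  2%:R * (3%:R * rho ^+ 2 * sD rho * tau + rho ^+ 3 * sD tau) =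
    p * rho * (rho ^+ 3 * tau) - (rho ^+ 2 * tau) ^+ 2].
  have := (sD_sP, sD_sQ, sD_sR); rewrite eP eQ eR => -[[D1 D2] D3].
  rewrite -D1 -D2 -D3 !exprS expr0 mulr1 !sDM.
  move: (sD rho) (sD tau) (sD p) => dr dt dp.
  have gen (A : comNzRingType) (r t x y : A) :
    2%:R * r * x * t + r * r * y = (x * r + r * x) * t + r * r * y /\
    3%:R * (r * r) * x * t + r * (r * r) * y =
      (x * (r * r) + r * (x * r + r * x)) * t + r * (r * r) * y by split; ring.
  by have [<- <-] := gen _ rho tau dr dt.
have [H1 H2 H3] := projective_ramanujan rho_n0 tau_n0 E1 E2 E3.
have evE i : ev3 tau p rho (mono i) = eis (fun i : 'I_3 => sA i) i.
  have evX : ev3 tau p rho 'X = rho by exact: eval_atX.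
  have evXX : ev3 tau p rho ('X%:P) = p.
    by rewrite [LHS]eval_atC; exact: eval_atX.
  have evXXX : ev3 tau p rho ('X%:P%:P) = tau.
    by rewrite [LHS]eval_atC [LHS]eval_atC; exact: eval_atX.
  elim/ord3P: i; rewrite /mono /eis !tripleE rmorphM ?rmorphXn /= evX ?evXX ?evXXX.
  - by rewrite mulrC -eP.
  - by rewrite -eQ.
  - by rewrite -eR.
have h c : ev3 tau p rho (constT c) = fpsC c.
  by rewrite [LHS]eval_atC [LHS]eval_atC; exact: eval_atC.
rewrite -(peval_to_eis fpsC).
have -> : peval fpsC (eis (fun i : 'I_3 => sA i)) (to_eis F) =
   ev3 tau p rho (peval constT mono (to_eis F)).
  rewrite (@peval_comp _ _ _ (ev3 tau p rho) _ fpsC _ _ h).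
  by apply: eq_peval => i; exact/esym/evE.
apply: (ev3_neq0 rho0 tau0 tau1 H1 H2 H3).
exact/peval_mono_neq0/to_eis_neq0.
Qed.

(** * The polynomials Phi_n *)

Lemma linD (I : choiceType) z (p q : {malg rat[cmonom I]}) :
  lin z (p + q) = lin z p + lin z q.
Proof. exact: raddfD. Qed.

(** The chain rule at the origin. *)
Lemma lin_peval (I J : choiceType) (Z : I -> {malg rat[cmonom J]}) z p :
  (forall i, (Z i)@_(onecm J) = 0) ->
  (peval (@malgC _ rat) Z p)@_(onecm J) = p@_(onecm I) /\
  lin z (peval (@malgC _ rat) Z p) = lin (fun i => lin z (Z i)) p.
Proof.
move=> Z0; pose f := peval (@malgC _ rat : {rmorphism rat -> {malg rat[cmonom J]}}) Z.
change (peval (@malgC _ rat) Z p) with (f p).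
have fC c : f (malgC c) = malgC c := pevalC _ _ c.
have fU i : f << ucm i >> = Z i := pevalU _ _ i.
have fD p1 p2 : f (p1 + p2) = f p1 + f p2 := rmorphD f p1 p2.
have fM p1 p2 : f (p1 * p2) = f p1 * f p2 := rmorphM f p1 p2.
move: {+}f fC fU fD fM => {}f fC fU fD fM.
elim/malg_poly_ind: p => [c|i|p q [Cp Lp] [Cq Lq]|p q [Cp Lp] [Cq Lq]].
- by rewrite [f _]fC !linC !mcoeffC !eqxx.
- by rewrite [f _]fU linU Z0 mcoeffU [_ == _]cm1_eq1.
- by rewrite [f _]fD !linD !mcoeffD Cp Cq Lp Lq.
- by rewrite [f _]fM !mcoeff1M !linM Cp Cq Lp Lq.
Qed.

Definition evA : QY -> fps := peval fpsC (fun i : 'I_3 => sA i).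
HB.instance Definition _ := GRing.RMorphism.on evA.

Lemma rmorph_quadratic (S T : comNzRingType) (f : {rmorphism S -> T}) y0 y1 y2 c d a0 a1 a2 c' d' :
  f y0 = a0 -> f y1 = a1 -> f y2 = a2 -> f c = c' -> f d = d' ->
  a2 - c' * (a0 * a2) + d' * a1 ^+ 2 = f (y2 - c * (y0 * y2) + d * (y1 * y1)).
Proof. by move=> <- <- <- <- <-; rewrite rmorphD rmorphB !rmorphM expr2. Qed.

Lemma lin_quadratic (I : choiceType) z c d (y0 y1 y2 : {malg rat[cmonom I]}) :
  y0@_(onecm I) = 0 -> y1@_(onecm I) = 0 -> y2@_(onecm I) = 0 ->
  (y2 - c%:MP * (y0 * y2) + d%:MP * (y1 * y1))@_(onecm I) = 0 /\
  lin z (y2 - c%:MP * (y0 * y2) + d%:MP * (y1 * y1)) = lin z y2.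
Proof.
have lin0M (p q : {malg rat[cmonom I]}) :
    q@_(onecm I) = 0 -> lin z (p * q) = p@_(onecm I) * lin z q.
  by move=> q0; rewrite linM q0 mulr0 add0r.
have c0M (p q : {malg rat[cmonom I]}) : q@_(onecm I) = 0 -> (p * q)@_(onecm I) = 0.
  by move=> q0; rewrite mcoeff1M q0 mulr0.
have scaled0 e (u v : {malg rat[cmonom I]}) : u@_(onecm I) = 0 -> v@_(onecm I) = 0 ->
    (e%:MP * (u * v))@_(onecm I) = 0 /\ lin z (e%:MP * (u * v)) = 0.
  move=> u0 v0; split; first exact/c0M/c0M.
  by rewrite (lin0M _ _ (c0M u v v0)) (lin0M _ _ v0) u0 mul0r mulr0.
have sum0 (y s t : {malg rat[cmonom I]}) : y@_(onecm I) = 0 ->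
    s@_(onecm I) = 0 /\ lin z s = 0 -> t@_(onecm I) = 0 /\ lin z t = 0 ->
    (y - s + t)@_(onecm I) = 0 /\ lin z (y - s + t) = lin z y.
  move=> yc0 [s0 Ls] [t0 Lt]; split; first by rewrite mcoeffD mcoeffB yc0 s0 t0 subr0 addr0.
  by rewrite linD (raddfB (lin z)) /= Ls Lt subr0 addr0.
by move=> Y0 Y1 Y2; exact: (sum0 _ _ _ Y2 (scaled0 c _ _ Y0 Y2) (scaled0 d _ _ Y1 Y1)).
Qed.

(** [D] lifts to [Q[Y_0, Y_1, Y_2]]. On linear parts it sends [Y_0] to [Y_1] and [Y_1] to [Y_2], and
    it fixes [Y_2], since [A_3 - A_2] is quadratic. *)
Lemma sD_evA (F : QY) : exists G : QY, [/\ sD (evA F) = evA G, G@_Yone = 0 &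
  forall z, lin z G = lin (triple (z 1) (z 2%:R) (z 2%:R)) F].
Proof.
have one1 (i : 'I_3) : (<< ucm i >> : QY)@_Yone = 0 by rewrite mcoeffU [_ == _]cm1_eq1.
have evU (i : 'I_3) : evA << ucm i >> = sA i by exact: pevalU.
elim/malg_poly_ind: F => [c|i|F1 F2 [G1 [D1 C1 L1]] [G2 [D2 C2 L2]]|F1 F2 [G1 [D1 C1 L1]] [G2 [D2 C2 L2]]].
- exists 0; split; first by rewrite rmorph0 [evA _]pevalC sD_fpsC.
    exact: mcoeff0.
  by move=> z; rewrite raddf0 linC.
- elim/ord3P: i.
  + exists << ucm 1 >>; split; [|exact: one1|by move=> z; apply: etrans (linU z 1) (esym (linU _ 0))].
    exact: etrans (congr1 sD (evU 0)) (etrans (sD_sA 0) (esym (evU 1))).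
  + exists << ucm 2%:R >>; split; [|exact: one1|by move=> z; apply: etrans (linU z 2%:R) (esym (linU _ 1))].
    exact: etrans (congr1 sD (evU 1)) (etrans (sD_sA 1) (esym (evU 2%:R))).
  + exists (<< ucm 2%:R >> - (24%:R)%:MP * (<< ucm 0 >> * << ucm 2%:R >>)
       + (36%:R)%:MP * (<< ucm 1 >> * << ucm 1 >>)); split.
    * apply: etrans (congr1 sD (evU 2%:R)) (etrans (sD_sA 2) (etrans chazy _)).
      by apply: (rmorph_quadratic (f := evA)) => //; rewrite [LHS]pevalC rmorph_nat.
    * by have [] := lin_quadratic (fun=> 0) 24%:R 36%:R (one1 0) (one1 1) (one1 2%:R).
    * move=> z; have [_ ->] := lin_quadratic z 24%:R 36%:R (one1 0) (one1 1) (one1 2%:R).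
      by apply: etrans (linU z 2%:R) (esym (linU _ 2%:R)).
- exists (G1 + G2); split; first by rewrite !rmorphD /= raddfD /= D1 D2.
    by rewrite raddfD /= C1 C2 addr0.
  by move=> z; rewrite !raddfD /= L1 L2.
- exists (G1 * F2 + F1 * G2); split.
  + apply: etrans (congr1 sD (rmorphM evA F1 F2)) _.
    apply: etrans (sDM _ _) _; rewrite D1 D2.
    have gen (S T : comNzRingType) (f : {rmorphism S -> T}) a b c d :
      f a * f b + f c * f d = f (a * b + c * d) by rewrite rmorphD !rmorphM.
    exact: (gen _ _ evA).
  + apply: etrans (mcoeffD _ _ _) _; apply: etrans (congr2 +%R (mcoeff1M _ _) (mcoeff1M _ _)) _.
    by rewrite C1 C2 mul0r mulr0 addr0.
  + move=> z; apply: etrans (linD _ _ _) _.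
    apply: etrans (congr2 +%R (linM _ _ _) (linM _ _ _)) (esym _); apply: etrans (linM _ _ _) _.
    by rewrite L1 L2 C1 C2 mulr0 mul0r addr0 add0r.
Qed.

Definition lin_index (k : nat) : 'I_3 := match k with 0%N => 0 | 1%N => 1 | _ => 2%:R end.

Lemma sA_repr k : exists Z : QY, [/\ evA Z = sA k, Z@_Yone = 0 &
  forall z, lin z Z = z (lin_index k)].
Proof.
elim: k => [|k [Z [evZ Z0 LZ]]].
  exists << ucm 0 >>; split; first exact: pevalU.
    by rewrite mcoeffU [_ == _]cm1_eq1.
  by move=> z; rewrite linU.
have [G [DG G0 LG]] := sD_evA Z; exists G; split=> //.
  by rewrite -DG evZ sD_sA.
by move=> z; rewrite LG LZ; case: k {evZ LZ} => [|[|k]].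
Qed.

Lemma Cq_repr n : exists Phi : QY, [/\
  forall (R : realType) (q : R), 0 < q < 1 -> Cq n q = reval (fun i : 'I_3 => Aser i q) Phi,
  Phi@_Yone = 0 & forall z, lin z Phi = lin (fun k => z (lin_index k)) (Chat n)].
Proof.
have [Z HZ] := boolp.choice sA_repr.
exists (peval (@malgC _ rat) Z (Chat n)).
have Z0 i : (Z i)@_(onecm 'I_3) = 0 by case: (HZ i).
split=> [R q q01||z].
- rewrite /Cq !reval_Aser //; congr (feval _ _).
  have h c : evA (malgC c) = fpsC c by apply: pevalC.
  rewrite -[RHS]/(evA _) (@peval_comp _ _ _ evA _ fpsC _ _ h).
  by apply: eq_peval => k; case: (HZ k).
- by case: (lin_peval (fun=> 0) (Chat n) Z0) => -> _; exact: const_term_Chat_upto.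
- case: (lin_peval z (Chat n) Z0) => _ ->; congr (lin _ _).
  by apply/funext => k; case: (HZ k) => _ _.
Qed.

(** An identity for all real [q] in the interval becomes one of formal series, to which algebraic
    independence applies. *)
Lemma reval_Aser_inj (R : realType) (F G : QY) :
  (forall q : R, 0 < q < 1 ->
     reval (fun i : 'I_3 => Aser i q) F = reval (fun i : 'I_3 => Aser i q) G) -> F = G.
Proof.
move=> FG; apply/eqP; rewrite -subr_eq0; apply: contraT => /sA_independent.
have gr H : poly_growth (evA H).
  have h01 : 0 < (2^-1 : R) < 1 by apply/andP; split; lra.
  by have [] := peval_feval H h01 (fun i : 'I_3 => poly_growth_sA i).
case/eqP; apply: (feval_eq0 (R := R) (gr (F - G))) => q q01.
have : feval (evA F) q = feval (evA G) q.
  by have := FG q q01; rewrite !reval_Aser.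
move=> E.
apply: (addIr (feval (evA G) q)); rewrite -fevalD //.
by rewrite (rmorphB evA) subrK add0r.
Qed.

Lemma lin_index_coefs n (Phi : QY) : 
  (forall z, lin z Phi = lin (fun k => z (lin_index k)) (Chat n)) ->
  [/\ Phi@_(Yvar 0) = lin (fun k => (k == 0%N)%:R) (Chat n),
      Phi@_(Yvar 1) = lin (fun k => (k == 1%N)%:R) (Chat n) &
      Phi@_(Yvar 2%:R) = lin (fun k => (1 < k)%N%:R) (Chat n)].
Proof.
move=> L; rewrite -!lin_coef !L; split; congr (lin _ _); apply/funext => -[|[|k]] //.
Qed.

Theorem theorem1p2 (R : realType) :
  (forall n : nat, (1 <= n)%N ->
     exists! Phi : QY, forall q : R, 0 < q < 1 ->
       Cq n q = reval (fun i : 'I_3 => Aser i q) Phi) /\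
  (forall n : nat, (2 <= n)%N -> forall Phi : QY,
     (forall q : R, 0 < q < 1 ->
        Cq (2 * n - 1) q = reval (fun i : 'I_3 => Aser i q) Phi) ->
     [/\ Phi@_Yone = 0,
         Phi@_(Yvar 0) = 6%:R * bernoulli (2 * n) / n%:R,
         Phi@_(Yvar 1) = - (36%:R * bernoulli (2 * n) / n%:R) &
         Phi@_(Yvar 2) = 1 + 30%:R * bernoulli (2 * n) / n%:R]) /\
  (forall n : nat, (2 <= n)%N -> forall Phi : QY,
     (forall q : R, 0 < q < 1 ->
        Cq (2 * n) q = reval (fun i : 'I_3 => Aser i q) Phi) ->
     [/\ Phi@_Yone = 0,
         Phi@_(Yvar 0) = 0,
         Phi@_(Yvar 1) = - (6%:R * bernoulli (2 * n) / n%:R) &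
         Phi@_(Yvar 2) = 6%:R * bernoulli (2 * n) / n%:R - 1]).
Proof.
have coefs m Phi : (forall q : R, 0 < q < 1 ->
    Cq m q = reval (fun i : 'I_3 => Aser i q) Phi) ->
  [/\ Phi@_Yone = 0, Phi@_(Yvar 0) = lin (fun k => (k == 0%N)%:R) (Chat m),
      Phi@_(Yvar 1) = lin (fun k => (k == 1%N)%:R) (Chat m) &
      Phi@_(Yvar 2%:R) = lin (fun k => (1 < k)%N%:R) (Chat m)].
  have [Psi [EPsi Psi0 LPsi]] := Cq_repr m => EPhi.
  have -> : Phi = Psi by apply: (@reval_Aser_inj R) => q q01; rewrite -EPhi // EPsi.
  by have [] := lin_index_coefs LPsi.
split; [move=> n _|split=> n n_gt Phi].
- have [Psi [EPsi _ _]] := Cq_repr n; exists Psi; split=> [q|Phi EPhi]; first exact: EPsi.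
  by apply: (@reval_Aser_inj R) => q q01; rewrite -EPhi // EPsi.
- have n0 : n%:R != 0 :> rat by rewrite pnatr_eq0; lia.
  have m1 : (1 < n.*2.-1)%N by lia.
  have -> : (2 * n - 1 = n.*2.-1)%N by lia.
  case/coefs => -> -> -> ->; rewrite lin_Chat0 // lin_Chat1 // lin_Chat2 //.
  have [-> ->] := Spoly_const_odd n_gt.
  (* The coefficient of [Y_2] is [1 - 6 s_1 - 12 s_2] with [s_1 = B_(2n) / n] and [s_2 = - 3 s_1],
     hence [1 + 30 s_1]. *)
  have -> : (-1) ^+ n.*2.-1.+1 = 1 :> rat.
    by rewrite prednK ?double_gt0 ?(ltnW n_gt) // -mul2n exprM sqrrN !expr1n.
  rewrite -mul2n; split=> //; field => //.
- have n0 : n%:R != 0 :> rat by rewrite pnatr_eq0; lia.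
  have m1 : (1 < n.*2)%N by lia.
  rewrite mul2n; case/coefs => -> -> -> ->; rewrite lin_Chat0 // lin_Chat1 // lin_Chat2 //.
  have [-> ->] := Spoly_const_even n_gt.
  (* Here [s_1 = 0] and [s_2 = - B_(2n) / (2 n)], so [- 1 - 12 s_2] gives the coefficient of
     [Y_2]. *)
  have -> : (-1) ^+ n.*2.+1 = -1 :> rat.
    by rewrite exprS -mul2n exprM sqrrN !expr1n mulr1.
  split=> //; rewrite ?mulr0 //; field => //.
Qed.
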